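(* Let $n\ge2$ and let $K\subset\mathbb{R}^n$ be a convex body. If $\partial K$ is $C^2$ with positive curvature, then $$\lim_{q\to0^+}F_q(K,\eta)=\frac{(n-1)\omega_{n-1}}{n\omega_n}S'(K,\eta)$$ for each Borel set $\eta\subset S^{n-1}$.
   Context: A convex body in $\mathbb{R}^n$ is a compact convex subset of $\mathbb{R}^n$ with nonempty interior. $\omega_m$ is the volume of the unit ball of $\mathbb{R}^m$, $\mathcal{H}^{n-1}$ is $(n-1)$-dimensional Hausdorff measure, and $du$ is spherical Lebesgue measure on $S^{n-1}$. For $z\in K$ and $u\in S^{n-1}$, let $\rho_{K,z}(u)=\max\{\lambda\in\mathbb{R}: z+\lambda u\in K\}\ge 0$, and $S_z^+=\{u\in S^{n-1}:\rho_{K,z}(u)>0\}$. For $p\in\mathbb{R}$ and $z\in K$ the dual quermassintegral is $$\widetilde V_p(K,z)=\frac1n\int_{S_z^+}\rho_{K,z}(u)^p\,du .$$ $\nu_K$ is the Gauss map (outer unit normal) of $\partial K$. For $q>0$ the chord measure is $$F_q(K,\eta)=\frac{2q}{\omega_n}\int_{\nu_K^{-1}(\eta)}\widetilde V_{q-1}(K,z)\,d\mathcal{H}^{n-1}(z),\qquad\eta\subset S^{n-1}\text{ Borel}.$$ $S'(K,\cdot)$ is the $(n-2)$-th area measure of $K$; when $\partial K$ is $C^2$ with positive curvature (all principal curvatures positive), it is given by $$S'(K,\eta)=\int_{\nu_K^{-1}(\eta)}H(z)\,d\mathcal{H}^{n-1}(z),$$ where $H(z)$ is the mean curvature of $\partial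 K$ at $z$, i.e. the average of the $n-1$ principal curvatures. *)

(* Defs.v *)
From HB Require Import structures.
From mathcomp Require Import all_boot all_order all_algebra.
From mathcomp Require Import all_classical all_reals all_analysis.

Set Implicit Arguments.
Unset Strict Implicit.
Unset Printing Implicit Defensive.

Import Order.TTheory GRing.Theory Num.Theory.
Import numFieldNormedType.Exports.

Local Open Scope classical_set_scope.
Local Open Scope ring_scope.

(* Points of R^n are row vectors.  The library norm on 'rV[R]_n is the sup
   norm: it induces the usual topology, but lengths have to be measured with
   the Euclidean norm below. *)
Section Euclidean.
Context {R : realType} {n : nat}.
Implicit Types (u v x : 'rV[R]_n) (A : set 'rV[R]_n).

Definition dot u v : R := \sum_(i < n) u 0 i * v 0 i.

Definition enorm x : R := Num.sqrt (dot x x).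

Definition unit_ball : set 'rV[R]_n := [set x | enorm x <= 1].

Definition unit_sphere : set 'rV[R]_n := [set x | enorm x = 1].

Definition bdry A : set 'rV[R]_n := closure A `\` A°.

Definition Borel A : Prop := <<s [set U : set 'rV[R]_n | open U] >> A.

Definition diam A : \bar R :=
  ereal_sup [set (enorm (p.1 - p.2))%:E | p in A `*` A].

End Euclidean.

(* A copy of T in which every set is measurable: [mu_ext tau] on this copy is
   the infimum of the sums of the tau (U k) over all the countable covers by
   arbitrary sets U k. *)
Definition any_set (T : Type) : Type := T.

Section AnySet.
Variable T : pointedType.

HB.instance Definition _ := Pointed.on (any_set T).
HB.instance Definition _ := @isMeasurable.Build default_measure_display
  (any_set T) setT I (fun _ _ => I) (fun _ _ => I).

End AnySet.

Section CoverMeasure.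
Context {R : realType} {T : pointedType}.
Local Open Scope ereal_scope.

(* The empty set may always be used in a cover at no cost. *)
Definition cover_cost (tau : set T -> \bar R) (U : set T) : \bar R :=
  if `[< U = set0 >] then 0 else tau U.

Definition cover_measure (tau : set T -> \bar R) (A : set T) : \bar R :=
  @mu_ext _ (any_set T) R (cover_cost tau) A.

Variable tau : set T -> \bar R.
Hypothesis tau_ge0 : forall U, 0 <= tau U.

Lemma cover_cost0 : cover_cost tau set0 = 0.
Proof. by rewrite /cover_cost asboolT. Qed.

Lemma cover_cost_ge0 U : 0 <= cover_cost tau U.
Proof. by rewrite /cover_cost; case: ifP. Qed.

Lemma cover_measure0 : cover_measure tau set0 = 0.
Proof. exact: (@mu_ext0 _ (any_set T) _ _ cover_cost0 cover_cost_ge0). Qed.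

Lemma cover_measure_ge0 A : 0 <= cover_measure tau A.
Proof. exact: (@mu_ext_ge0 _ (any_set T) _ _ cover_cost_ge0). Qed.

Lemma le_cover_measure :
  {homo cover_measure tau : A B / A `<=` B >-> A <= B}.
Proof. exact: (@le_mu_ext _ (any_set T)). Qed.

Lemma cover_measure_sigma_subadditive :
  sigma_subadditive (cover_measure tau).
Proof.
exact: (@mu_ext_sigma_subadditive _ (any_set T) _ _ cover_cost_ge0).
Qed.

End CoverMeasure.

Section LebesgueMeasure.
Context {R : realType}.
Variable n : nat.
Local Open Scope ereal_scope.

Definition box (a b : 'rV[R]_n) : set 'rV[R]_n :=
  [set x | forall i, (a 0 i <= x 0 i <= b 0 i)%R].

(* The volume of U if U is a nonempty closed box, +oo otherwise. *)
Definition box_volume (U : set 'rV[R]_n) : \bar R :=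
  ereal_inf [set v | exists a b : 'rV[R]_n,
    [/\ forall i, (a 0 i <= b 0 i)%R, U = box a b &
        v = (\prod_(i < n) (b 0 i - a 0 i)%R)%:E]].

Definition lebesgue_outer : set 'rV[R]_n -> \bar R := cover_measure box_volume.

Lemma box_volume_ge0 U : 0 <= box_volume U.
Proof.
apply: le_ereal_inf_tmp => _ [a [b [ab _ ->]]].
by rewrite lee_fin prodr_ge0// => i _; rewrite subr_ge0.
Qed.

HB.instance Definition _ := isOuterMeasure.Build R 'rV[R]_n lebesgue_outer
  (cover_measure0 box_volume_ge0) (cover_measure_ge0 box_volume_ge0)
  (@le_cover_measure _ _ box_volume)
  (cover_measure_sigma_subadditive box_volume_ge0).

Definition omega : R := fine (lebesgue_outer unit_ball).

End LebesgueMeasure.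

Section HausdorffMeasure.
Context {R : realType}.
Variables n m : nat.
Local Open Scope ereal_scope.

(* The factor makes the n-dimensional measure of R^n the Lebesgue measure. *)
Definition hausdorff_cost (d : R) (U : set 'rV[R]_n) : \bar R :=
  if diam U <= d%:E then (omega m / 2 ^+ m)%:E * diam U ^+ m else +oo.

Definition hausdorff_outer (A : set 'rV[R]_n) : \bar R :=
  ereal_sup [set cover_measure (hausdorff_cost d) A | d in [set d | (0 < d)%R]].

Lemma omega_ge0 k : (0 <= @omega R k)%R.
Proof. by apply: fine_ge0; exact: outer_measure_ge0. Qed.

Lemma diam_ge0 (U : set 'rV[R]_n) : U !=set0 -> 0 <= diam U.
Proof.
move=> [x Ux]; apply: (@le_trans _ _ (enorm (x - x))%:E).
  by rewrite lee_fin sqrtr_ge0.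
by apply: ereal_sup_ubound; exists (x, x).
Qed.

Lemma cover_cost_hausdorff_ge0 (d : R) U : 0 <= cover_cost (hausdorff_cost d) U.
Proof.
rewrite /cover_cost; case: asboolP => // U0; rewrite /hausdorff_cost.
case: ifP => // _; apply: mule_ge0.
  by rewrite lee_fin divr_ge0 ?omega_ge0 ?exprn_ge0.
by apply/expe_ge0/diam_ge0/set0P/eqP.
Qed.

Lemma hausdorff_outer_ge0 A : 0 <= hausdorff_outer A.
Proof.
apply: (@le_trans _ _ (cover_measure (hausdorff_cost 1) A)).
  exact: (@mu_ext_ge0 _ (any_set _) _ _ (@cover_cost_hausdorff_ge0 1)).
by apply: ereal_sup_ubound; exists 1%R => //=.
Qed.

Lemma hausdorff_outer0 : hausdorff_outer set0 = 0.
Proof.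
apply/eqP; rewrite eq_le hausdorff_outer_ge0 andbT.
apply: ge_ereal_sup => _ [d _ <-].
by rewrite /cover_measure (@mu_ext0 _ (any_set _))//;
  [exact: cover_cost0 | exact: cover_cost_hausdorff_ge0].
Qed.

Lemma le_hausdorff_outer :
  {homo hausdorff_outer : A B / A `<=` B >-> A <= B}.
Proof.
move=> A B AB; apply: ge_ereal_sup => _ [d d0 <-].
apply: le_trans (le_cover_measure _ AB) _.
by apply: ereal_sup_ubound; exists d.
Qed.

Lemma hausdorff_outer_sigma_subadditive : sigma_subadditive hausdorff_outer.
Proof.
move=> F; apply: ge_ereal_sup => _ [d d0 <-].
apply: (@le_trans _ _ (\sum_(i <oo) cover_measure (hausdorff_cost d) (F i))).
  exact: (@mu_ext_sigma_subadditive _ (any_set _) _ _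
            (@cover_cost_hausdorff_ge0 d)).
apply: lee_nneseries => i *.
  exact: (@mu_ext_ge0 _ (any_set _) _ _ (@cover_cost_hausdorff_ge0 d)).
by apply: ereal_sup_ubound; exists d.
Qed.

HB.instance Definition _ := isOuterMeasure.Build R 'rV[R]_n hausdorff_outer
  hausdorff_outer0 hausdorff_outer_ge0 le_hausdorff_outer
  hausdorff_outer_sigma_subadditive.

Definition hausdorff : set (caratheodory_type hausdorff_outer) -> \bar R :=
  hausdorff_outer.

HB.instance Definition _ := isMeasure.Build _ _ _ hausdorff
  (@caratheodory_measure0 _ _ hausdorff_outer) (@caratheodory_measure_ge0 _ _ hausdorff_outer)
  (@caratheodory_measure_sigma_additive _ _ hausdorff_outer).

End HausdorffMeasure.

Arguments hausdorff {R} n m _.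

Section SphericalMeasure.
Context {R : realType}.
Variable n : nat.
Local Open Scope ereal_scope.

Definition cone (A : set 'rV[R]_n) : set 'rV[R]_n :=
  [set x | exists r u, [/\ (0 <= r <= 1)%R, A u & x = (r *: u)%R]].

(* The spherical Lebesgue measure gives to A `<=` unit_sphere the mass
   n * vol (cone A). *)
Definition spherical_outer (A : set 'rV[R]_n) : \bar R :=
  n%:R%:E * lebesgue_outer (cone (A `&` unit_sphere)).

Lemma spherical_outer0 : spherical_outer set0 = 0.
Proof.
rewrite /spherical_outer set0I (_ : cone set0 = set0) ?outer_measure0 ?mule0//.
by apply/seteqP; split => // x [r [u []]].
Qed.

Lemma spherical_outer_ge0 A : 0 <= spherical_outer A.
Proof. by apply: mule_ge0; [rewrite lee_fin | exact: outer_measure_ge0]. Qed.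

Lemma le_spherical_outer :
  {homo spherical_outer : A B / A `<=` B >-> A <= B}.
Proof.
move=> A B AB; apply: lee_wpmul2l; first by rewrite lee_fin.
apply: le_outer_measure => x [r [u [r01 [Au Su] ->]]].
by exists r, u; split => //; split => //; exact: AB.
Qed.

Lemma spherical_outer_sigma_subadditive : sigma_subadditive spherical_outer.
Proof.
move=> F; rewrite /spherical_outer nneseriesZl; last first.
  by move=> i _; exact: outer_measure_ge0.
apply: lee_wpmul2l; first by rewrite lee_fin.
apply: le_trans (outer_measure_sigma_subadditive _ _).
apply: le_outer_measure => x [r [u [r01 [[i _ Fu] Su] ->]]].
by exists i => //; exists r, u.
Qed.

HB.instance Definition _ := isOuterMeasure.Build R 'rV[R]_n spherical_outer
  spherical_outer0 spherical_outer_ge0 le_spherical_outer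
  spherical_outer_sigma_subadditive.

Definition spherical : set (caratheodory_type spherical_outer) -> \bar R :=
  spherical_outer.

HB.instance Definition _ := isMeasure.Build _ _ _ spherical
  (@caratheodory_measure0 _ _ spherical_outer) (@caratheodory_measure_ge0 _ _ spherical_outer)
  (@caratheodory_measure_sigma_additive _ _ spherical_outer).

End SphericalMeasure.

Arguments spherical {R} n _.

Section ConvexBodies.
Context {R : realType} {n : nat}.
Implicit Types (K eta : set 'rV[R]_n) (z u : 'rV[R]_n).

Definition convex_body K : Prop :=
  [/\ compact K, convex_set (K : set (convex_lmodType 'rV[R]_n)) &
      K° !=set0].

(* For K compact and z in K the set is compact, so that this is a maximum. *)
Definition radial K z u : R := sup [set t : R | K (z + t *: u)].

Definition positive_directions K z : set 'rV[R]_n :=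
  [set u | unit_sphere u /\ 0 < radial K z u].

Definition dual_quermass (p : R) K z : \bar R :=
  ((n%:R^-1)%:E *
   \int[spherical n]_(u in positive_directions K z) (radial K z u `^ p)%:E)%E.

Definition outer_normal K z u : Prop :=
  unit_sphere u /\ forall y, K y -> dot (y - z) u <= 0.

(* The Gauss map is only meaningful at the regular boundary points, those with
   a unique outer unit normal; the convention elsewhere is irrelevant. *)
Definition regular_bdry K : set 'rV[R]_n :=
  [set z | bdry K z /\ exists! u, outer_normal K z u].

Definition gauss_map K z : 'rV[R]_n := xget 0 (outer_normal K z).

Definition gauss_preimage K eta : set 'rV[R]_n :=
  regular_bdry K `&` gauss_map K @^-1` eta.

Definition chord_measure (q : R) K eta : \bar R :=
  ((2 * q / omega n)%:E *
   \int[hausdorff n n.-1]_(z in gauss_preimage K eta)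
     dual_quermass (q - 1) K z)%E.

(* Continuity of all the partial derivatives of g of order at most k on U. *)
Fixpoint Ck (k : nat) (U : set 'rV[R]_n) (g : 'rV[R]_n -> R^o) : Prop :=
  (forall x, U x -> {for x, continuous g}) /\
  if k is k'.+1 then
    forall i : 'I_n,
      (forall x, U x -> derivable g x (delta_mx 0 i)) /\
      Ck k' U ('D_(delta_mx 0 i) g)
  else True.

(* Locally, the boundary is the zero set of a C^2 function whose gradient does
   not vanish on it. *)
Definition C2_bdry K : Prop :=
  forall z, bdry K z ->
  exists (U : set 'rV[R]_n) (g : 'rV[R]_n -> R^o),
    [/\ open U, U z, Ck 2 U g,
        forall x, U x -> (bdry K x <-> g x = 0) &
        forall x, U x -> bdry K x ->
          exists i : 'I_n, 'D_(delta_mx 0 i) g x != 0].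

(* A is the matrix, acting on the right on row vectors, of the differential at
   z of the Gauss map along the boundary, which is an endomorphism of the
   tangent hyperplane, extended by 0 to the normal line. *)
Definition weingarten K z (A : 'M[R]_n) : Prop :=
  gauss_map K z *m A = 0 /\
  forall e : R, 0 < e -> \forall y \near within (bdry K) (nbhs z),
    `|gauss_map K y - gauss_map K z - (y - z) *m A| <= e * `|y - z|.

(* The extension by 0 adds one factor 'X to the characteristic polynomial. *)
Definition are_principal_curvatures K z (k : 'rV[R]_n.-1) : Prop :=
  exists2 A, weingarten K z A &
    char_poly A = 'X * \prod_(i < n.-1) ('X - (k 0 i)%:P).

Definition positive_curvature K : Prop :=
  forall z, bdry K z ->
  exists2 k, are_principal_curvatures K z k & forall i, 0 < k 0 i.

(* The principal curvatures are unique up to the order, which does not affect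
   the average. *)
Definition mean_curvature K z : R :=
  (\sum_(i < n.-1) (xget 0 (are_principal_curvatures K z)) 0 i) / n.-1%:R.

(* The formula for the (n-2)-th area measure of a convex body is only valid if
   the boundary is C^2 with positive curvature. *)
Definition area_measure_n2 K eta : \bar R :=
  (\int[hausdorff n n.-1]_(z in gauss_preimage K eta) (mean_curvature K z)%:E)%E.

End ConvexBodies.

(* Main.v *)
Require Import Defs.
From mathcomp Require Import all_boot all_order all_algebra.
From mathcomp Require Import all_classical all_reals all_analysis.
From mathcomp Require Import measurable_realfun.
From mathcomp Require Import ring lra.

Set Implicit Arguments.
Unset Strict Implicit.
Unset Printing Implicit Defensive.

Import Order.TTheory GRing.Theory Num.Theory.
Import numFieldNormedType.Exports.

Local Open Scope classical_set_scope.
Local Open Scope ring_scope.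

(** As q tends to 0 the dual quermassintegral of order q - 1 at a boundary point
    z becomes singular, and q times it concentrates on the directions u almost
    tangent to the boundary. To second order the body near z is the region under
    a paraboloid, so that the chord in a direction u at the small height
    a = - dot u nu above the tangent hyperplane has length
    rho = 2 a / quad M u, where M is the second fundamental form. Hence
    q rho ^ (q - 1) behaves like q a ^ (q - 1) quad M u / 2, and as the measure
    q a ^ (q - 1) da tends to the Dirac mass at a = 0, the limit is the half of
    the integral of the quadratic form of M over the equator of the sphere, i.e.
    omega_(n-1) \tr M / 2, by symmetry. Since \tr M is n - 1 times the mean
    curvature H(z), multiplying by 2 / (n omega_n) and integrating over the
    boundary gives the constant of the theorem.

    The limit is exchanged with the integral over the boundary by uniformity:
    near every boundary point z0 the estimates hold with the same constants
    (radial_estimates, local_limit), so that by compactness of the boundary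
    the integrand lies between (1 - e) and (1 + e) times its limit for all
    small q (uniform_relative). The integrals are suprema over simple
    functions, hence monotone and homogeneous on all nonnegative functions, and
    these bounds pass to them.

    The sphere side is the computation of the quadratic moments of the thin band
    of height between 0 and d above the equator (integral_quad_asymptotics). The
    spherical measure is built on a Lebesgue outer measure defined by covers, so
    that its invariance under reflections is proved by factoring reflections into
    shears (lebesgue_outer_reflection), and the measure of thin bands by slicing
    cones (band_asymptotics).

    On the boundary side a C^2 defining function f is normalized to have the
    outer unit normal as its gradient at z0. Its gradient being parallel to the
    Gauss map, its Hessian and the differential of the Gauss map define the same
    form on the tangent hyperplane (tangent_hessian), symmetric by the Schwarz
    theorem, semidefinite by monotonicity of the Gauss map, and definite because
    0 is a simple root of the characteristic polynomial
    (second_form_definite). Taylor expansions along chords, uniform in the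
    boundary point, then give the length of the chords. *)

(** * Lebesgue outer measure and linear maps *)

Section LebesgueOuter.
Context {R : realType}.
Local Open Scope ereal_scope.

Lemma cover_measure_le (T : pointedType) (tau : set T -> \bar R)
    (tau0 : forall U, 0 <= cover_cost tau U) (A : set T) (F : nat -> set T) :
  A `<=` \bigcup_k F k ->
  cover_measure tau A <= \sum_(k <oo) cover_cost tau (F k).
Proof. by move=> AF; apply: ereal_inf_lbound; exists F. Qed.

Lemma cover_measure_le_cost (T : pointedType) (tau : set T -> \bar R)
    (tau0 : forall U, 0 <= cover_cost tau U) (A : set T) :
  cover_measure tau A <= cover_cost tau A.
Proof.
pose F k := if k is 0%N then A else set0.
have AF : A `<=` \bigcup_k F k by move=> x Ax; exists 0%N.
apply: (le_trans (cover_measure_le tau0 AF)).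
rewrite (nneseries_split 0 1) => [|k _]; last exact: tau0.
rewrite big_mkord big_ord1 /= eseries0 ?adde0// => -[//|k] _ _.
by rewrite /cover_cost asboolT.
Qed.

Variable n : nat.
Implicit Types (a b : 'rV[R]_n) (A U : set 'rV[R]_n).

Definition volume a b : R := (\prod_(i < n) (b 0 i - a 0 i))%R.

Lemma volume_ge0 a b : (forall i, a 0 i <= b 0 i)%R -> (0 <= volume a b)%R.
Proof. by move=> ab; apply: prodr_ge0 => i _; rewrite subr_ge0. Qed.

Lemma box_volume_box a b : (forall i, a 0 i <= b 0 i)%R ->
  box_volume (box a b) = (volume a b)%:E.
Proof.
move=> ab; apply/eqP; rewrite eq_le; apply/andP; split.
  by apply: ereal_inf_lbound; exists a, b.
apply: le_ereal_inf_tmp => _ [a' [b' [ab' eqb ->]]].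
suff [-> ->] : a = a' /\ b = b' by [].
have Ba : box a' b' a by rewrite -eqb => i; rewrite lexx ab.
have Bb : box a' b' b by rewrite -eqb => i; rewrite lexx ab.
have Ba' : box a b a' by rewrite eqb => i; rewrite lexx ab'.
have Bb' : box a b b' by rewrite eqb => i; rewrite lexx ab'.
split; apply/rowP => i; apply/eqP; rewrite eq_le.
  by move: (Ba i) (Ba' i) => /andP[-> _] /andP[-> _].
by move: (Bb i) (Bb' i) => /andP[_ ->] /andP[_ ->].
Qed.

Lemma cover_cost_box_ge0 U : 0 <= cover_cost (@box_volume R n) U.
Proof. exact/cover_cost_ge0/box_volume_ge0. Qed.

Lemma lebesgue_outer_box a b : (forall i, a 0 i <= b 0 i)%R ->
  lebesgue_outer (box a b) <= (volume a b)%:E.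
Proof.
move=> ab; apply: (le_trans (cover_measure_le_cost cover_cost_box_ge0 _)).
rewrite /cover_cost; case: asboolP => _; first by rewrite lee_fin volume_ge0.
by rewrite box_volume_box.
Qed.

Lemma le_lebesgue_outer A B : A `<=` B -> lebesgue_outer A <= lebesgue_outer B.
Proof. exact: le_outer_measure. Qed.

Lemma cover_cost_box_fin U : cover_cost (@box_volume R n) U < +oo ->
  U = set0 \/ exists a b, [/\ (forall i, a 0 i <= b 0 i)%R, U = box a b &
    cover_cost (@box_volume R n) U = (volume a b)%:E].
Proof.
rewrite /cover_cost; case: asboolP => [->|U0]; first by left.
move=> /ereal_inf_lt[_ [a [b [ab -> ->]]] _].
by right; exists a, b; rewrite box_volume_box.
Qed.

Lemma nneseries_fin_term (u : nat -> \bar R) k : (forall i, 0 <= u i) ->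
  \sum_(i <oo) u i < +oo -> u k < +oo.
Proof.
move=> u0 us; rewrite ltNge; apply/negP; rewrite leye_eq => /eqP uk.
by move: us; rewrite (@eseries_pinfty _ _ _ k)// => i _; rewrite -ltNye (lt_le_trans _ (u0 i)).
Qed.

(** The outer measure is an infimum over covers by boxes, so that a countably
    subadditive set function has to be compared with it on boxes only. Applied
    to linear images, to cylinders and to the two sides of a half-space, this
    replaces all the changes of variables. *)
Lemma lebesgue_outer_dominates (psi : set 'rV[R]_n -> \bar R) (c : R) :
  (0 < c)%R -> psi set0 = 0 -> (forall A, 0 <= psi A) ->
  {homo psi : A B / A `<=` B >-> A <= B} -> sigma_subadditive psi ->
  (forall a b, (forall i, a 0 i <= b 0 i)%R ->
     psi (box a b) <= (c * volume a b)%:E) ->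
  forall A, psi A <= c%:E * lebesgue_outer A.
Proof.
move=> c0 psi0 psi_ge0 psi_le psi_sub psi_box A.
rewrite -lee_pdivrMl//; apply: le_ereal_inf_tmp => _ [F [_ AF] <-].
rewrite lee_pdivrMl// -nneseriesZl => [|k _]; last exact: cover_cost_box_ge0.
apply: (le_trans (psi_le _ _ AF)); apply: (le_trans (psi_sub _)).
apply: lee_nneseries => [k _ _|k _]; first exact: psi_ge0.
have [Foo|/eqP] := eqVneq (cover_cost (@box_volume R n) (F k)) +oo.
  by rewrite Foo gt0_muley ?lte_fin ?leey.
move/eqP; rewrite -ltey => /cover_cost_box_fin[->|[a [b [ab -> ->]]]].
  by rewrite psi0 mule_ge0 ?cover_cost_box_ge0 ?lee_fin ?ltW.
by rewrite -EFinM psi_box.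
Qed.

End LebesgueOuter.

Section LinearImages.
Context {R : realType}.
Variable n : nat.
Implicit Types (M : 'M[R]_n) (a b : 'rV[R]_n) (A : set 'rV[R]_n).
Local Open Scope ereal_scope.

Definition linimg M A : set 'rV[R]_n := [set x *m M | x in A].

Lemma linimg_bigcup M (F : nat -> set 'rV[R]_n) :
  linimg M (\bigcup_k F k) = \bigcup_k linimg M (F k).
Proof. by rewrite /linimg image_bigcup. Qed.

Lemma linimg_mul M N A : linimg (M *m N) A = linimg N (linimg M A).
Proof.
by rewrite /linimg image_comp; congr image; apply/funext => x /=; rewrite mulmxA.
Qed.

Lemma linimg1 A : linimg 1%:M A = A.
Proof. by rewrite -[RHS]image_id; congr image; apply/funext => x; rewrite mulmx1. Qed.

Lemma lebesgue_outer_linimg_le M (c : R) : (0 < c)%R ->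
  (forall a b, (forall i, a 0 i <= b 0 i)%R ->
     lebesgue_outer (linimg M (box a b)) <= (c * volume a b)%:E) ->
  forall A, lebesgue_outer (linimg M A) <= c%:E * lebesgue_outer A.
Proof.
move=> c0 Mbox.
apply: (@lebesgue_outer_dominates _ _ (fun A => lebesgue_outer (linimg M A))) => //=.
- by rewrite /linimg image_set0 outer_measure0.
- by move=> A; apply: outer_measure_ge0.
- by move=> A B AB; apply: le_outer_measure; apply: image_subset.
- by move=> F /=; rewrite linimg_bigcup; apply: outer_measure_sigma_subadditive.
Qed.

Lemma lebesgue_outer_diag_le (d : 'rV[R]_n) A : (forall i, d 0 i != 0)%R ->
  lebesgue_outer (linimg (diag_mx d) A) <=
  (\prod_(i < n) `|d 0 i|)%:E * lebesgue_outer A.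
Proof.
move=> d0; apply: lebesgue_outer_linimg_le.
  by apply: prodr_gt0 => i _; rewrite normr_gt0.
move=> a b ab.
pose a' := (\row_i Num.min (d 0 i * a 0 i) (d 0 i * b 0 i))%R.
pose b' := (\row_i Num.max (d 0 i * a 0 i) (d 0 i * b 0 i))%R.
have ab' i : (a' 0 i <= b' 0 i)%R.
  by rewrite !mxE; rewrite ge_min le_max !lexx.
have sub : linimg (diag_mx d) (box a b) `<=` box a' b'.
  move=> _ [x xab <-] i; rewrite mul_mx_diag !mxE [(x 0 i * _)%R]mulrC.
  have /andP[ax xb] := xab i.
  rewrite ge_min le_max.
  have [dp|dn] := ltP 0%R (d 0 i)%R.
    by rewrite !ler_pM2l// ax xb orbT.
  have dn' : (d 0 i < 0)%R by rewrite lt_neqAle d0.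
  by rewrite !ler_nM2l// ax xb orbT.
apply: (le_trans (le_lebesgue_outer sub)).
apply: (le_trans (lebesgue_outer_box ab')).
rewrite lee_fin /volume -big_split/=; apply: ler_prod => i _.
rewrite subr_ge0 ab'/= !mxE.
have abi : (0 <= b 0 i - a 0 i)%R by rewrite subr_ge0.
rewrite -[X in (_ <= _ * X)%R](ger0_norm abi) -normrM mulrBr.
have [//|] := leP (d 0 i * a 0 i)%R (d 0 i * b 0 i)%R => h.
  by rewrite ger0_norm// subr_ge0.
by rewrite distrC gtr0_norm// subr_gt0.
Qed.

Definition shear (i j : 'I_n) (c : R) : 'M[R]_n := (1%:M + c *: delta_mx j i)%R.

Lemma shearE i j c (x : 'rV[R]_n) k :
  ((x *m shear i j c) 0 k = x 0 k + (k == i)%:R * (c * x 0 j))%R.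
Proof.
rewrite mulmxDr mulmx1 -scalemxAr !mxE; congr (_ + _)%R.
rewrite (bigD1 j)//= big1 ?addr0; last first.
  by move=> l lj; rewrite !mxE (negbTE lj) mulr0.
by rewrite !mxE eqxx/=; ring.
Qed.

Lemma le_lebesgue_outer_bigcup_lt (N : nat) (F : nat -> set 'rV[R]_n) A (v : R) :
  A `<=` \bigcup_(k < N) F k ->
  (forall k, (k < N)%N -> lebesgue_outer (F k) <= v%:E) ->
  lebesgue_outer A <= (N%:R * v)%:E.
Proof.
move=> AF Fv; apply: (le_trans (le_lebesgue_outer AF)).
rewrite bigcup_mkord; apply: (@le_trans _ _ (\sum_(k < N) lebesgue_outer (F k))).
  elim/big_ind2 : _ => [|? ? X Y h1 h2|//]; first by rewrite outer_measure0.
  by apply: le_trans (outer_measureU2 _ _ _) _; apply: leeD.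
apply: (@le_trans _ _ (\sum_(k < N) v%:E)); first by apply: lee_sum => k _; exact: Fv.
by rewrite sumEFin sumr_const card_ord mulr_natl.
Qed.

(** Cut the box into N slabs in the direction of the coordinate j. The image of
    each slab lies in one box, and the excess of the volumes of these boxes is
    of order 1 / N in total. *)
Lemma lebesgue_outer_shear_box i j c a b : i != j -> (forall i, a 0 i <= b 0 i)%R ->
  lebesgue_outer (linimg (shear i j c) (box a b)) <= (volume a b)%:E.
Proof.
move=> ij ab; pose w := (b 0 j - a 0 j)%R.
have w0 : (0 <= w)%R by rewrite subr_ge0.
pose r := (\prod_(k < n | (k != i) && (k != j)) (b 0 k - a 0 k))%R.
have r0 : (0 <= r)%R by apply: prodr_ge0 => k _; rewrite subr_ge0.
have volE : volume a b = ((b 0 i - a 0 i) * w * r)%R.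
  rewrite /volume (bigD1 i)//= (bigD1 j) ?(eq_sym j)//= mulrA.
  by congr (_ * _)%R; apply: eq_bigl => k; rewrite andbC.
suff key N : (0 < N)%N -> lebesgue_outer (linimg (shear i j c) (box a b)) <=
    (volume a b + `|c| * w ^+ 2 * r / N%:R)%:E.
  apply/lee_addgt0Pr => e e0.
  pose C := (`|c| * w ^+ 2 * r)%R.
  have C0 : (0 <= C)%R by rewrite !mulr_ge0// exprn_ge0.
  have := truncnS_gt (C / e); set N := Num.trunc _ => Nlt.
  apply: (le_trans (key N.+1 _)) => //; rewrite -EFinD lee_fin lerD2l.
  by rewrite ler_pdivrMr ?ltr0n// [leRHS]mulrC -ler_pdivrMr// ltW.
move=> N0; pose h := (w / N%:R)%R.
have N0' : (0 < N%:R :> R)%R by rewrite ltr0n.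
have h0 : (0 <= h)%R by rewrite divr_ge0// ler0n.
pose t (k : nat) := (a 0 j + k%:R * h)%R.
(* The boxes that cover the images of the slabs. *)
pose lo k := (\row_l if l == i then a 0 i + Num.min (c * t k) (c * t k.+1)
  else if l == j then t k else a 0 l)%R.
pose hi k := (\row_l if l == i then b 0 i + Num.max (c * t k) (c * t k.+1)
  else if l == j then t k.+1 else b 0 l)%R.
have tS k : (t k <= t k.+1)%R by rewrite /t lerD2l ler_wpM2r// ler_nat.
have lohi k l : (lo k 0 l <= hi k 0 l)%R.
  rewrite !mxE; case: ifP => _; last by case: ifP.
  by apply: lerD => //; rewrite ge_min le_max !lexx.
have -> : (volume a b + `|c| * w ^+ 2 * r / N%:R =
    N%:R * (((b 0 i - a 0 i) + `|c| * h) * h * r))%R.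
  rewrite volE /h; field; exact: lt0r_neq0.
apply: (@le_lebesgue_outer_bigcup_lt _ (fun k => box (lo k) (hi k))) => [y|k _].
  case=> x xab <-.
  have [k kN /andP[tx xt]] : exists2 k, (k < N)%N & (t k <= x 0 j <= t k.+1)%R.
    have /andP[ax xb] := xab j.
    have tN : t N = (b 0 j)%R.
      by rewrite /t /h mulrC divfK ?lt0r_neq0// /w addrCA subrr addr0.
    have : (x 0 j <= t N)%R by rewrite tN.
    have : (0 < N)%N by [].
    elim: (N) => // k IH _ xk.
    have [xt|tx] := leP (x 0 j)%R (t k); last first.
      by exists k => //; rewrite (ltW tx).
    case: k IH xk xt => [|k] IH _ xt; last first.
      by have [//|l lk hl] := IH _ xt; exists l => //; exact: ltnW.
    exists 0%N => //; rewrite (le_trans xt (tS _)) andbT.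
    by rewrite /t mul0r addr0.
  exists k => //= l; rewrite shearE !mxE; have /andP[al bl] := xab l.
  have [->|li] := eqVneq l i.
    have /andP[ai bi] := xab i.
    rewrite mul1r; apply/andP; split; apply: lerD => //; rewrite ?ge_min ?le_max.
      have [c0|c0] := leP 0%R c; first by rewrite ler_wpM2l.
      by rewrite orbC ler_wnM2l// ltW.
    have [c0|c0] := leP 0%R c; first by rewrite orbC ler_wpM2l.
    by rewrite ler_wnM2l// ltW.
  rewrite mul0r addr0; have [->|lj] := eqVneq l j; first by rewrite tx xt.
  by rewrite al bl.
apply: (le_trans (lebesgue_outer_box (lohi k))).
rewrite lee_fin /volume (bigD1 i)//= (bigD1 j) ?(eq_sym j)//=.
rewrite !mxE eqxx (eq_sym j) (negbTE ij) eqxx -mulrA.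
have -> : (t k.+1 - t k = h)%R by rewrite /t; ring.
have -> : (\prod_(l < n | (l != i) && (l != j)) (hi k 0 l - lo k 0 l) = r)%R.
  by apply: eq_bigr => l /andP[li lj]; rewrite !mxE (negbTE li) (negbTE lj).
rewrite ler_wpM2r// ?mulr_ge0//.
have -> : (`|c| * h = `|c * t k.+1 - c * t k|)%R.
  by rewrite -mulrBr normrM /t; congr (_ * _)%R; rewrite ger0_norm; [ring|rewrite subr_ge0; exact: tS].
have [cc|cc] := leP (c * t k)%R (c * t k.+1)%R.
  by rewrite ger0_norm ?subr_ge0//; lra.
by rewrite ltr0_norm ?subr_lt0//; lra.
Qed.

End LinearImages.

(** * Reflections preserve the volume *)

Section Reflections.
Context {R : realType}.
Variable n : nat.
Implicit Types (M : 'M[R]_n) (u v x : 'rV[R]_n) (A : set 'rV[R]_n).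

Lemma dotC u v : dot u v = dot v u.
Proof. by apply: eq_bigr => i _; rewrite mulrC. Qed.

Lemma dotDl u v x : dot (u + v) x = dot u x + dot v x.
Proof. by rewrite -big_split; apply: eq_bigr => i _; rewrite mxE mulrDl. Qed.

Lemma dotZl c u v : dot (c *: u) v = c * dot u v.
Proof. by rewrite mulr_sumr; apply: eq_bigr => i _; rewrite mxE mulrA. Qed.

Lemma dotNl u v : dot (- u) v = - dot u v.
Proof. by rewrite -scaleN1r dotZl mulN1r. Qed.

Lemma dotBl u v x : dot (u - v) x = dot u x - dot v x.
Proof. by rewrite dotDl dotNl. Qed.

Lemma dotDr u v x : dot x (u + v) = dot x u + dot x v.
Proof. by rewrite !(dotC x) dotDl. Qed.

Lemma dotZr c u v : dot u (c *: v) = c * dot u v.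
Proof. by rewrite !(dotC u) dotZl. Qed.

Lemma dotNr u v : dot u (- v) = - dot u v.
Proof. by rewrite !(dotC u) dotNl. Qed.

Lemma dotBr u v x : dot x (u - v) = dot x u - dot x v.
Proof. by rewrite dotDr dotNr. Qed.

Lemma dot0l u : dot 0 u = 0.
Proof. by rewrite -(scale0r u) dotZl mul0r. Qed.

Lemma dot_ge0 u : 0 <= dot u u.
Proof. by apply: sumr_ge0 => i _; rewrite -expr2 sqr_ge0. Qed.

Lemma dot_eq0 u : (dot u u == 0) = (u == 0).
Proof.
apply/idP/eqP => [|->]; last by rewrite dot0l.
rewrite psumr_eq0 => [/allP h|i _]; last by rewrite -expr2 sqr_ge0.
apply/rowP => i; have := h i; rewrite mem_index_enum => /(_ isT).
by rewrite mulf_eq0 orbb mxE => /eqP.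
Qed.

Lemma dot_gt0 u : (0 < dot u u) = (u != 0).
Proof. by rewrite lt_neqAle dot_ge0 andbT eq_sym dot_eq0. Qed.

(** Stable under products; an invertible map preserves the outer measure as soon
    as it and its inverse have this property. *)
Definition shrinking M := forall A, (lebesgue_outer (linimg M A) <= lebesgue_outer A)%E.

Lemma shrinking1 : shrinking 1%:M.
Proof. by move=> A; rewrite linimg1. Qed.

Lemma shrinkingM M N : shrinking M -> shrinking N -> shrinking (M *m N).
Proof. by move=> hM hN A; rewrite linimg_mul (le_trans (hN _)). Qed.

Lemma shrinking_shear i j c : i != j -> shrinking (shear i j c).
Proof.
move=> ij A; rewrite -[leRHS]mul1e; apply: lebesgue_outer_linimg_le => // a b ab.
by rewrite mul1r lebesgue_outer_shear_box.
Qed.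

(** A product of shears with the same target coordinate. *)
Lemma shrinking_gather i (c : 'I_n -> R) : exists2 M, shrinking M &
  forall x k, (x *m M) 0 k = x 0 k + (k == i)%:R * \sum_(j < n | j != i) c j * x 0 j.
Proof.
suff [M hM ME] : exists2 M, shrinking M & forall x k, (x *m M) 0 k =
    x 0 k + (k == i)%:R * \sum_(j <- index_enum 'I_n | j != i) c j * x 0 j.
  by exists M.
elim: (index_enum _) => [|j s [M hM ME]].
  exists 1%:M; first exact: shrinking1.
  by move=> x k; rewrite mulmx1 big_nil mulr0 addr0.
have [ji|ji] := eqVneq j i.
  by exists M => // x k; rewrite big_cons ji eqxx ME.
exists (M *m shear i j (c j)).
  by apply: shrinkingM => //; apply: shrinking_shear; rewrite eq_sym.
move=> x k; rewrite mulmxA shearE !ME big_cons ji (negbTE ji) mul0r addr0.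
by rewrite mulrDr -addrA [X in _ + X]addrC.
Qed.

(** A product of shears with the same source coordinate. *)
Lemma shrinking_spread i (c : 'I_n -> R) : exists2 M, shrinking M &
  forall x k, (x *m M) 0 k = x 0 k + (k != i)%:R * (c k * x 0 i).
Proof.
suff [M hM ME] : exists2 M, shrinking M & forall x k, (x *m M) 0 k =
    x 0 k + (k != i)%:R * ((k \in index_enum 'I_n)%:R * (c k * x 0 i)).
  by exists M => // x k; rewrite ME mem_index_enum mul1r.
elim: (index_enum _) (index_enum_uniq 'I_n) => [_|j s IH /= /andP[js /IH[M hM ME]]].
  exists 1%:M; first exact: shrinking1.
  by move=> x k; rewrite mulmx1 in_nil mul0r mulr0 addr0.
have [ji|ji] := eqVneq j i.
  exists M => // x k; rewrite ME inE ji.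
  by case: eqVneq => [->|//]; rewrite !mul0r.
exists (M *m shear j i (c j)).
  by apply: shrinkingM => //; exact: shrinking_shear.
move=> x k; rewrite mulmxA shearE !ME inE eqxx mul0r addr0.
have [->|kj] := eqVneq k j; last by rewrite mul0r addr0.
by rewrite (negbTE js) ji /= !mul1r mul0r addr0.
Qed.

Lemma shrinking_flip i : exists2 M, shrinking M &
  forall x k, (x *m M) 0 k = if k == i then - x 0 k else x 0 k.
Proof.
pose d : 'rV[R]_n := \row_k (if k == i then -1 else 1).
exists (diag_mx d) => [A|x k]; last first.
  by rewrite mul_mx_diag !mxE; case: ifP; rewrite ?mulrN1 ?mulr1.
have d0 k : d 0 k != 0 by rewrite mxE; case: ifP; rewrite ?oppr_eq0 oner_eq0.
apply: (le_trans (lebesgue_outer_diag_le A d0)).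
rewrite big1 ?mul1e// => k _.
by rewrite mxE; case: ifP; rewrite ?normrN normr1.
Qed.

Definition reflection v : 'M[R]_n := 1%:M - (2 / dot v v) *: (v^T *m v).

Lemma reflectionE v x : x *m reflection v = x - (2 * dot x v / dot v v) *: v.
Proof.
rewrite mulmxBr mulmx1 -scalemxAr mulmxA; congr (_ - _).
have -> : x *m v^T = (dot x v)%:M.
  by rewrite [LHS]mx11_scalar; congr _%:M; rewrite mxE; apply: eq_bigr => i _; rewrite mxE.
by rewrite mul_scalar_mx scalerA mulrAC.
Qed.

Lemma reflectionK v : v != 0 -> reflection v *m reflection v = 1%:M.
Proof.
move=> v0; apply/row_matrixP => i; rewrite row_mul reflectionE !rowE.
rewrite reflectionE dotBl dotZl -addrA -opprD -scalerDl mulmx1.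
have := dot_eq0 v; rewrite (negbTE v0) => /negbT vv.
suff -> : forall d : R, 2 * d / dot v v + 2 * (d - 2 * d / dot v v * dot v v) / dot v v = 0.
  by rewrite scale0r subr0.
by move=> d; field.
Qed.

(** Factorization: S replaces the coordinate i by a multiple of the component
    along v, P subtracts from the other coordinates their part of the
    reflection, F changes the sign of the coordinate i, and T undoes S. *)
Lemma shrinking_reflection v : v != 0 -> shrinking (reflection v).
Proof.
move=> v0; have [i vi] : exists i, v 0 i != 0.
  apply/existsP; apply: contraNT v0; rewrite negb_exists => /forallP h.
  by apply/eqP/rowP => i; rewrite mxE; apply/eqP; rewrite -[_ == _]negbK.
have := dot_eq0 v; rewrite (negbTE v0) => /negbT vv.
have [S hS SE] := shrinking_gather i (fun j => v 0 j / v 0 i).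
have [T hT TE] := shrinking_gather i (fun j => - (v 0 j / v 0 i)).
have [P hP PE] := shrinking_spread i (fun j => - (2 * v 0 i * v 0 j / dot v v)).
have [F hF FE] := shrinking_flip i.
suff -> : reflection v = S *m P *m F *m T by do !apply: shrinkingM => //.
apply/row_matrixP => k; rewrite row_mul !rowE.
move: 'e_k => x; rewrite !mulmxA reflectionE; set D := dot x v; apply/rowP => l.
have vvE : dot v v = v 0 i ^+ 2 + \sum_(j < n | j != i) v 0 j ^+ 2.
  by rewrite /dot (bigD1 i)//= expr2; congr (_ + _); apply: eq_bigr => j _.
have DE : D = x 0 i * v 0 i + \sum_(j < n | j != i) x 0 j * v 0 j.
  by rewrite /D /dot (bigD1 i).
have yi : (x *m S) 0 i = D / v 0 i.
  rewrite DE SE eqxx mul1r mulrDl mulfK//; congr (_ + _).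
  by rewrite mulr_suml; apply: eq_bigr => j _; rewrite mulrAC [v 0 j * _]mulrC.
have yj j : j != i -> (x *m S *m P *m F) 0 j = x 0 j - 2 * v 0 j * D / dot v v.
  move=> ji; rewrite FE (negbTE ji) PE ji yi SE (negbTE ji) mul0r addr0 mul1r.
  congr (_ + _); rewrite mulNr; congr (- _).
  by field; rewrite vi vv.
have yi' : (x *m S *m P *m F) 0 i = - (D / v 0 i).
  by rewrite FE eqxx PE eqxx mul0r addr0 yi.
rewrite TE; have [->|li] := eqVneq l i; last by rewrite mul0r addr0 yj// !mxE; ring.
rewrite yi' mul1r !mxE.
under eq_bigr => j ji do rewrite (yj _ ji).
have -> : \sum_(j < n | j != i) - (v 0 j / v 0 i) * (x 0 j - 2 * v 0 j * D / dot v v) =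
   - (\sum_(j < n | j != i) x 0 j * v 0 j) / v 0 i +
   2 * D / (dot v v * v 0 i) * \sum_(j < n | j != i) v 0 j ^+ 2.
  rewrite mulNr mulr_suml mulr_sumr -sumrN -big_split; apply: eq_bigr => j _ /=.
  by field; rewrite vi vv.
have -> : \sum_(j < n | j != i) x 0 j * v 0 j = D - x 0 i * v 0 i.
  by rewrite DE addrC addKr.
have -> : \sum_(j < n | j != i) v 0 j ^+ 2 = dot v v - v 0 i ^+ 2.
  by rewrite vvE addrC addKr.
by field; rewrite vi vv.
Qed.

(** A reflection is its own inverse. *)
Lemma lebesgue_outer_reflection v A : v != 0 ->
  lebesgue_outer (linimg (reflection v) A) = lebesgue_outer A.
Proof.
move=> v0; apply/eqP; rewrite eq_le (shrinking_reflection v0) /=.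
by rewrite -{1}[A]linimg1 -(reflectionK v0) linimg_mul; exact: shrinking_reflection.
Qed.

Lemma lebesgue_outerZ (c : R) A : 0 < c ->
  (lebesgue_outer [set c *: x | x in A] = (c ^+ n)%:E * lebesgue_outer A)%E.
Proof.
move=> c0; have scale (d : R) (B : set 'rV[R]_n) : 0 < d ->
    (lebesgue_outer [set d *: x | x in B] <= (d ^+ n)%:E * lebesgue_outer B)%E.
  move=> d0; have -> : [set d *: x | x in B] = linimg (diag_mx (const_mx d)) B.
    by congr image; apply/funext => x; rewrite diag_const_mx mul_mx_scalar.
  have := @lebesgue_outer_diag_le R n (const_mx d) B.
  under eq_bigr do rewrite mxE gtr0_norm//.
  by rewrite prodr_const card_ord; apply => i; rewrite mxE lt0r_neq0.
apply/eqP; rewrite eq_le scale//=.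
rewrite -lee_pdivlMl ?exprn_gt0//.
rewrite -exprVn; apply: le_trans (scale c^-1 _ _); rewrite ?invr_gt0//.
apply: le_lebesgue_outer => x Ax; exists (c *: x); first by exists x.
by rewrite scalerA mulVf ?scale1r// lt0r_neq0.
Qed.

End Reflections.

(** * Open sets are Lebesgue measurable *)

Section LebesgueMeasurable.
Context {R : realType}.
Variable n : nat.
Implicit Types (a b x : 'rV[R]_n) (A : set 'rV[R]_n).

Definition Lmeas A := @measurable _ (caratheodory_type (@lebesgue_outer R n)) A.

(** The sum of the outer measures of the two parts of A is countably subadditive
    in A, and a coordinate hyperplane cuts a box into two boxes whose volumes
    add up. *)
Lemma measurable_halfspace (i : 'I_n) (c : R) : Lmeas [set x : 'rV[R]_n | x 0 i < c].
Proof.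
apply: le_caratheodory_measurable => X; set H := [set x : 'rV[R]_n | _].
have key := @lebesgue_outer_dominates R n
  (fun A => lebesgue_outer (A `&` H) + lebesgue_outer (A `&` ~` H))%E 1.
rewrite -[leRHS]mul1e; apply: key => //=.
- by rewrite !set0I outer_measure0 adde0.
- by move=> A; rewrite adde_ge0 ?outer_measure_ge0.
- by move=> A B AB; apply: leeD; apply: le_lebesgue_outer; exact: setSI.
- move=> F /=; rewrite nneseriesD => [|k _ _|k _ _]; try exact: outer_measure_ge0.
  rewrite !setI_bigcupl.
  rewrite leeD// outer_measure_sigma_subadditive//.
move=> a b ab; rewrite mul1r.
pose b' : 'rV[R]_n := \row_k if k == i then c else b 0 k.
pose a' : 'rV[R]_n := \row_k if k == i then c else a 0 k.
have [ci|ic] := ltP c (a 0 i).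
  have -> : box a b `&` H = set0.
    rewrite -subset0 => x [/(_ i)/andP[ax _]]; rewrite /H/=.
    by move=> /(le_lt_trans ax)/lt_trans/(_ ci); rewrite ltxx.
  rewrite outer_measure0 add0e (le_trans _ (lebesgue_outer_box ab))//.
  by apply: le_lebesgue_outer; exact: subIsetl.
have [bi|ib] := ltP (b 0 i) c.
  have -> : box a b `&` ~` H = set0.
    rewrite -subset0 => x [/(_ i)/andP[_ xb]]; rewrite /H/=; apply.
    exact: le_lt_trans bi.
  rewrite outer_measure0 adde0 (le_trans _ (lebesgue_outer_box ab))//.
  by apply: le_lebesgue_outer; exact: subIsetl.
have ab' k : a 0 k <= b' 0 k by rewrite mxE; case: eqVneq => [->|].
have a'b k : a' 0 k <= b 0 k by rewrite mxE; case: eqVneq => [->|].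
apply: (@le_trans _ _ (lebesgue_outer (box a b') + lebesgue_outer (box a' b))%E).
  apply: leeD; apply: le_lebesgue_outer => x [xab xH] k; have := xab k; rewrite mxE.
    case: eqVneq => [->|_ //]; case/andP => -> _.
    by rewrite ltW.
  case: eqVneq => [->|_ //]; case/andP => _ ->.
  by move: xH; rewrite /H/= => /negP; rewrite -leNgt => ->.
apply: (le_trans (leeD (lebesgue_outer_box ab') (lebesgue_outer_box a'b))).
rewrite -EFinD lee_fin /volume [in leRHS](bigD1 i)//= (bigD1 i)//= [X in _ + X <= _](bigD1 i)//=.
rewrite !mxE eqxx.
rewrite [X in (c - _) * X](eq_bigr (fun k => b 0 k - a 0 k)) => [|k ki]; last first.
  by rewrite !mxE (negbTE ki).
rewrite [X in _ + (b 0 i - c) * X](eq_bigr (fun k => b 0 k - a 0 k)) => [|k ki]; last first.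
  by rewrite !mxE (negbTE ki).
by rewrite -mulrDl addrC addrA subrK.
Qed.

Lemma LmeasC A : Lmeas A -> Lmeas (~` A).
Proof. exact: measurableC. Qed.

Lemma LmeasI A B : Lmeas A -> Lmeas B -> Lmeas (A `&` B).
Proof. exact: measurableI. Qed.

Lemma measurable_halfspace_gt (i : 'I_n) (c : R) : Lmeas [set x : 'rV[R]_n | c < x 0 i].
Proof.
have -> : [set x : 'rV[R]_n | c < x 0 i] =
    \bigcup_k ~` [set x : 'rV[R]_n | x 0 i < c + k.+1%:R^-1].
  apply/seteqP; split => x /=; last first.
    by move=> [k _ /negP]; rewrite -leNgt; apply: lt_le_trans; rewrite ltrDl invr_gt0.
  move=> cx; have xc : 0 < x 0 i - c by rewrite subr_gt0.
  exists (Num.trunc (x 0 i - c)^-1) => //=; apply/negP; rewrite -leNgt.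
  rewrite -lerBrDl invf_ple ?posrE ?ltr0n//; apply/ltW; exact: truncnS_gt.
apply: (@bigcupT_measurable _ (caratheodory_type (@lebesgue_outer R n))) => k.
by apply: LmeasC; apply: measurable_halfspace.
Qed.

Lemma ball_rowP (x y : 'rV[R]_n) (r : R) :
  ball x r y <-> 0 < r /\ forall i, `|x 0 i - y 0 i| < r.
Proof.
split=> [[r0 h]|[r0 h]]; split=> // i; first exact: h.
by move=> j; rewrite (ord1 i); exact: h.
Qed.

Lemma ball_rowE (x : 'rV[R]_n) (r : R) : 0 < r ->
  ball x r = \bigcap_(i in [set: 'I_n])
    ([set y : 'rV[R]_n | x 0 i - r < y 0 i] `&` [set y : 'rV[R]_n | y 0 i < x 0 i + r]).
Proof.
move=> r0; apply/seteqP; split => y /=.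
  by move=> /ball_rowP[_ xyr] i _; have := xyr i; rewrite ltr_distlC => /andP[? ?].
move=> h; apply/ball_rowP; split=> // i; have [h1 h2] := h i I.
by rewrite ltr_distlC h1 h2.
Qed.

Lemma measurable_ball_row (x : 'rV[R]_n) (r : R) : Lmeas (ball x r).
Proof.
have [r0|r0] := ltP 0 r; last first.
  suff -> : ball x r = set0 by exact: measurable0.
  by rewrite -subset0 => y /ball_rowP[]; rewrite ltNge r0.
rewrite ball_rowE//.
apply: (@fin_bigcap_measurable _ (caratheodory_type (@lebesgue_outer R n))).
  exact: finite_finset.
by move=> i _; apply: LmeasI; [exact: measurable_halfspace_gt | exact: measurable_halfspace].
Qed.

Definition rational_ball (k : 'rV[rat]_n * rat) : set 'rV[R]_n :=
  ball (\row_i ratr (k.1 0 i) : 'rV[R]_n) (ratr k.2).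

Lemma open_rational_balls (U : set 'rV[R]_n) : open U ->
  U = \bigcup_k (rational_ball k `&` [set _ | rational_ball k `<=` U]).
Proof.
move=> oU; apply/seteqP; split => [x Ux|x [k _ [kx kU]]]; last exact: kU.
have [e /= e0 eU] : exists2 e : R, 0 < e & ball x e `<=` U.
  by have /nbhs_ballP[e e0 eU] := open_nbhs_nbhs (conj oU Ux); exists e.
have [r] := rat_in_itvoo (divr_gt0 e0 (ltr0n _ 2)).
rewrite in_itv/= => /andP[r0 re].
have H i : {q : rat | ratr q \in `]x 0 i - ratr r, x 0 i + ratr r[ }.
  by apply/cid; apply: rat_in_itvoo; lra.
exists (\row_i sval (H i), r) => //; split => [|y /ball_rowP[_ hy]] /=.
  apply/ball_rowP; split => // i; rewrite !mxE.
  case: (H i) => q /=; rewrite in_itv/= ltr_distlC.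
  by move=> /andP[? ?]; apply/andP; split; lra.
apply: eU; apply/ball_rowP; split => // i; have := hy i.
rewrite !mxE; case: (H i) => q /=; rewrite in_itv/= !ltr_distlC.
by move: re => /[swap] /andP[? ?] ? /andP[? ?]; apply/andP; split; lra.
Qed.

Lemma measurable_open_row (U : set 'rV[R]_n) : open U -> Lmeas U.
Proof.
move=> /open_rational_balls ->.
apply: (@countable_bigcupT_measurable _ (caratheodory_type (@lebesgue_outer R n))) => [|k].
  exact: countableP.
apply: LmeasI; first exact: measurable_ball_row.
have [kU|kU] := pselect (rational_ball k `<=` U).
  by rewrite (_ : [set _ | _] = setT); [exact: measurableT|apply/seteqP; split].
by rewrite (_ : [set _ | _] = set0); [exact: measurable0|apply/seteqP; split].
Qed.

End LebesgueMeasurable.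

(** * Slices *)

Section Slices.
Context {R : realType}.
Variable m : nat.
Implicit Types (x : 'rV[R]_m.+1) (y : 'rV[R]_m) (h : R).

Definition cons_row h y : 'rV[R]_m.+1 :=
  \row_i (if unlift ord0 i is Some j then y 0 j else h).

Definition tail_row x : 'rV[R]_m := \row_j x 0 (lift ord0 j).

Lemma cons_row0 h y : cons_row h y 0 ord0 = h.
Proof. by rewrite mxE unlift_none. Qed.

Lemma cons_rowS h y j : cons_row h y 0 (lift ord0 j) = y 0 j.
Proof. by rewrite mxE liftK. Qed.

Lemma tail_cons_row h y : tail_row (cons_row h y) = y.
Proof. by apply/rowP => j; rewrite mxE cons_rowS. Qed.

Lemma volume_cons_row h k y z :
  volume (cons_row h y) (cons_row k z) = (k - h) * volume y z.
Proof.
rewrite /volume big_ord_recl !cons_row0; congr (_ * _).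
by apply: eq_bigr => i _; rewrite !cons_rowS.
Qed.

Lemma lebesgue_outer_cylinder (A : set 'rV[R]_m) :
  (lebesgue_outer [set x : 'rV[R]_m.+1 | (0 <= x 0%R ord0 <= 1)%R /\ A (tail_row x)]
   <= lebesgue_outer A)%E.
Proof.
pose cyl (A : set 'rV[R]_m) := [set x : 'rV[R]_m.+1 | 0 <= x 0 ord0 <= 1 /\ A (tail_row x)].
rewrite -[leRHS]mul1e.
apply: (@lebesgue_outer_dominates R m (fun A => lebesgue_outer (cyl A))) => //=.
- suff -> : cyl set0 = set0 by rewrite outer_measure0.
  by rewrite -subset0 => x [].
- by move=> B; exact: outer_measure_ge0.
- by move=> B C BC; apply: le_lebesgue_outer => x [x0 /BC].
- move=> F; apply: le_trans (outer_measure_sigma_subadditive _ _).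
  by apply: le_lebesgue_outer => x [x0 [k _ Fk]]; exists k.
move=> a b ab.
have ab' i : cons_row 0 a 0 i <= cons_row 1 b 0 i.
  by rewrite !mxE; case: unliftP => // _; rewrite ler01.
rewrite -(subr0 1) -volume_cons_row; apply: le_trans (lebesgue_outer_box ab').
apply: le_lebesgue_outer => x [x0 xab] i.
case: (unliftP ord0 i) => [j ->|->]; rewrite ?cons_row0//.
by rewrite !cons_rowS; have := xab j; rewrite mxE.
Qed.

(** One half of the Cavalieri principle: a box of a cover contributes to the
    slices a multiple of the indicator function of an interval, whose integral
    is at most the volume of the box. The other half is needed for cylinders only. *)
Lemma lebesgue_outer_slices (A : set 'rV[R]_m.+1) (f : R -> R) :
  measurable_fun (`]0, 1[%classic : set R) f ->
  (forall h, 0 < h < 1 -> 0 <= f h) ->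
  (forall h, 0 < h < 1 -> ((f h)%:E <= lebesgue_outer [set y | A (cons_row h y)])%E) ->
  (\int[lebesgue_measure]_(h in (`]0%R, 1%R[%classic : set R)) (f h)%:E <= lebesgue_outer A)%E.
Proof.
move=> mf f0 fA; apply: le_ereal_inf_tmp => _ [F [_ AF] <-].
have cost0 := @cover_cost_box_ge0 R m.+1.
have [soo|/eqP] := eqVneq (\sum_(k <oo) cover_cost (@box_volume R m.+1) (F k))%E +oo%E.
  by rewrite soo leey.
move=> /eqP; rewrite -ltey => soo.
have H k : {p : R * (R * R) | [/\ 0 <= p.1, p.2.1 <= p.2.2,
    ((p.1 * (p.2.2 - p.2.1))%:E <= cover_cost (@box_volume R m.+1) (F k))%E &
    forall h, (lebesgue_outer [set y | F k (cons_row h y)] <=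
      (p.1 * \1_(`[p.2.1, p.2.2]%classic) h)%:E)%E]}.
  apply/cid.
  have /cover_cost_box_fin[Fk|[a [b [ab Fk ck]]]] := nneseries_fin_term k (fun i => cost0 (F i)) soo.
    exists (0, (0, 0)); split => //=; first by rewrite mul0r.
    by move=> h; rewrite mul0r Fk outer_measure0.
  have abT i : tail_row a 0 i <= tail_row b 0 i by rewrite !mxE.
  exists (volume (tail_row a) (tail_row b), (a 0 ord0, b 0 ord0)); split => //=.
  - exact: volume_ge0.
  - rewrite ck lee_fin mulrC /volume [leRHS]big_ord_recl.
    by under eq_bigr do rewrite !mxE.
  - move=> h; rewrite indicE; case: (boolP (h \in _)) => [/set_mem/= hab|/negP hab].
      rewrite mulr1; apply: le_trans (lebesgue_outer_box abT).
      apply: le_lebesgue_outer => y; rewrite Fk /= => yab i.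
      by have := yab (lift ord0 i); rewrite cons_rowS !mxE.
    rewrite mulr0 (_ : [set y | _] = set0) ?outer_measure0//.
    rewrite -subset0 => y; rewrite Fk /= => /(_ ord0); rewrite cons_row0 => yab.
    by apply: hab; rewrite inE/= in_itv.
pose v k := (sval (H k)).1; pose a k := (sval (H k)).2.1; pose b k := (sval (H k)).2.2.
have v0 k : 0 <= v k by rewrite /v; case: (H k) => ? [].
have ab k : a k <= b k by rewrite /a /b; case: (H k) => ? [].
have vc k : ((v k * (b k - a k))%:E <= cover_cost (@box_volume R m.+1) (F k))%E.
  by rewrite /v /a /b; case: (H k) => ? [].
have vF k h : (lebesgue_outer [set y | F k (cons_row h y)] <=
      (v k * \1_(`[a k, b k]%classic) h)%:E)%E.
  by rewrite /v /a /b; case: (H k) => ? [].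
have m1 k : measurable_fun (`]0, 1[%classic : set R) (fun h => (v k * \1_(`[a k, b k]%classic) h)%:E).
  apply/measurable_EFinP; apply: measurable_funM => //.
have ge1 k h : (0 <= (v k * \1_(`[a k, b k]%classic) h)%:E)%E.
  by rewrite lee_fin mulr_ge0// indicE.
apply: (@le_trans _ _ (\int[lebesgue_measure]_(h in (`]0%R, 1%R[%classic : set R))
    \sum_(k <oo) (v k * \1_(`[a k, b k]%classic) h)%:E)%E).
  apply: ge0_le_integral => //.
  - exact/measurable_EFinP.
  - apply: ge0_emeasurable_sum => [k h _ _|k _]; [exact: ge1 | exact: m1].
  - move=> h /=; rewrite in_itv/= => hh; apply: (le_trans (fA _ hh)).
    apply: (@le_trans _ _ (\sum_(k <oo) lebesgue_outer [set y | F k (cons_row h y)])%E).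
      apply: le_trans (outer_measure_sigma_subadditive _ _).
      by apply: le_lebesgue_outer => y /= /AF[k _ Fk]; exists k.
    by apply: lee_nneseries => // k _ _; exact: outer_measure_ge0.
rewrite integral_nneseries//; apply: lee_nneseries => [k _ _|k _].
  by apply: integral_ge0.
apply: le_trans (vc k).
under eq_integral do rewrite EFinM.
rewrite ge0_integralZl_EFin//; last exact/measurable_EFinP.
rewrite integral_indic// EFinM lee_wpmul2l ?lee_fin//.
apply: (@le_trans _ _ (lebesgue_measure (`[a k, b k]%classic : set R))).
  by apply: le_measure; rewrite ?inE//; apply: measurableI.
rewrite lebesgue_measure_itv/= lte_fin; case: ifP => //.
by rewrite lee_fin subr_ge0.
Qed.

End Slices.

(** * Volumes of balls and wedges *)

Section GenericContinuity.
Context {R : realType} {T : topologicalType}.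
Implicit Types f g : T -> R.

Lemma continuous_addr f g : continuous f -> continuous g -> continuous (fun x => f x + g x).
Proof. by move=> cf cg x; apply: cvgD; [exact: cf | exact: cg]. Qed.

Lemma continuous_oppr f : continuous f -> continuous (fun x => - f x).
Proof. by move=> cf x; apply: cvgN; exact: cf. Qed.

Lemma continuous_subr f g : continuous f -> continuous g -> continuous (fun x => f x - g x).
Proof. by move=> cf cg; apply: continuous_addr => //; exact: continuous_oppr. Qed.

Lemma continuous_mulr f g : continuous f -> continuous g -> continuous (fun x => f x * g x).
Proof. by move=> cf cg x; apply: cvgM; [exact: cf | exact: cg]. Qed.

Lemma continuous_sumr (I : Type) (r : seq I) (f : I -> T -> R) :
  (forall i, continuous (f i)) -> continuous (fun x => \sum_(i <- r) f i x).
Proof.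
move=> cf; elim: r => [|i r IH].
  by under eq_fun do rewrite big_nil; exact: cst_continuous.
by under eq_fun do rewrite big_cons; exact: continuous_addr.
Qed.

Lemma continuous_sqrtr f : continuous f -> continuous (fun x => Num.sqrt (f x)).
Proof.
by move=> cf x; apply: continuous_comp; [exact: cf | exact: sqrt_continuous].
Qed.

End GenericContinuity.

Section BallVolumes.
Context {R : realType}.

Lemma enorm_le n (x : 'rV[R]_n) (c : R) : 0 <= c -> (enorm x <= c) = (dot x x <= c ^+ 2).
Proof. by move=> c0; rewrite /enorm -{1}(ger0_norm c0) -sqrtr_sqr ler_sqrt// sqr_ge0. Qed.

Lemma enorm_ge0 n (x : 'rV[R]_n) : 0 <= enorm x.
Proof. exact: sqrtr_ge0. Qed.

Lemma enorm_sqr n (x : 'rV[R]_n) : enorm x ^+ 2 = dot x x.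
Proof. by rewrite sqr_sqrtr// dot_ge0. Qed.

Lemma enormZ n (c : R) (x : 'rV[R]_n) : 0 <= c -> enorm (c *: x) = c * enorm x.
Proof.
move=> c0; rewrite /enorm dotZl dotZr mulrA -expr2 sqrtrM ?sqr_ge0//.
by rewrite sqrtr_sqr ger0_norm.
Qed.

Lemma coord_le_enorm n (x : 'rV[R]_n) i : `|x 0 i| <= enorm x.
Proof.
rewrite -sqrtr_sqr ler_sqrt ?dot_ge0// /dot (bigD1 i)//= expr2 lerDl.
by apply: sumr_ge0 => j _; rewrite -expr2 sqr_ge0.
Qed.

Lemma lebesgue_outer_unit_ball n : lebesgue_outer (@unit_ball R n) = (omega n)%:E.
Proof.
rewrite /omega fineK// ge0_fin_numE ?outer_measure_ge0//.
have ab i : (const_mx (-1) : 'rV[R]_n) 0 i <= (const_mx 1 : 'rV[R]_n) 0 i.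
  by rewrite !mxE; lra.
apply: (le_lt_trans _ (ltry (volume (const_mx (-1)) (const_mx 1)))).
apply: le_trans (lebesgue_outer_box ab); apply: le_lebesgue_outer => x x1 i.
by rewrite !mxE -ler_norml (le_trans (coord_le_enorm x i)).
Qed.

(** The induction on the dimension by slices replaces a compactness argument on
    covers of the cube. *)
Lemma lebesgue_outer_unit_box n :
  (1 <= lebesgue_outer (box (0 : 'rV[R]_n) (const_mx 1%R)))%E.
Proof.
elim: n => [|n IH].
  apply: le_ereal_inf_tmp => _ [F [_ AF] <-].
  have B0 : box (0 : 'rV[R]_0) (const_mx 1%R) 0 by move=> i; rewrite !mxE lexx ler01.
  have [k _ Fk] := AF _ B0.
  apply: (@le_trans _ _ (cover_cost (@box_volume R 0) (F k))); last first.
    apply: le_trans (@nneseries_lim_ge _ _ _ 0%N k.+1 _); last first.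
      by move=> i _ _; exact: cover_cost_box_ge0.
    rewrite big_mkord (bigD1 ord_max)//= leeDl//.
    by apply: sume_ge0 => i _; exact: cover_cost_box_ge0.
  rewrite /cover_cost; case: asboolP => [F0|_]; first by rewrite F0 in Fk.
  by apply: le_ereal_inf_tmp => _ [a [b [_ _ ->]]]; rewrite big_ord0.
apply: (@le_trans _ _ (\int[lebesgue_measure]_(h in (`]0%R, 1%R[%classic : set R)) 1%R%:E)%E).
  by rewrite integral_cst//= mul1e lebesgue_measure_itv/= lte01 oppr0 adde0.
apply: lebesgue_outer_slices => [|//|h /andP[h0 h1]]; first exact: measurable_cst.
apply: (le_trans IH); apply: le_lebesgue_outer => y yb i /=.
case: (unliftP ord0 i) => [j ->|->]; rewrite ?cons_row0 ?cons_rowS !mxE.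
  by have := yb j; rewrite !mxE.
by rewrite !ltW.
Qed.

(** The ball enlarged n + 1 times contains the unit cube. *)
Lemma omega_gt0 n : 0 < @omega R n.
Proof.
have -> : (0 < @omega R n) = (0 < lebesgue_outer (@unit_ball R n))%E.
  by rewrite lebesgue_outer_unit_ball lte_fin.
have N0 : 0 < n.+1%:R :> R by [].
have := lebesgue_outer_unit_box n; apply: contraTT; rewrite -!leNgt -ltNge => ball0.
apply: le_lt_trans lte01.
rewrite -(mule0 (n.+1%:R ^+ n)%:E).
have -> : 0%E = lebesgue_outer (@unit_ball R n).
  by apply/eqP; rewrite eq_le ball0 outer_measure_ge0.
rewrite -lebesgue_outerZ//; apply: le_lebesgue_outer => x x01.
exists (n.+1%:R^-1 *: x); last by rewrite scalerA mulfV ?scale1r ?lt0r_neq0.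
rewrite /unit_ball/= enormZ ?invr_ge0 ?ler0n// mulrC ler_pdivrMr// mul1r.
rewrite enorm_le//; apply: (@le_trans _ _ (\sum_(i < n) 1)).
  apply: ler_sum => i _; have := x01 i; rewrite !mxE => /andP[x0 x1].
  by rewrite -expr2 exprn_ile1.
rewrite sumr_const card_ord -natrX ler_nat.
by rewrite (leq_trans (leqnSn n))// leq_pmulr.
Qed.

Lemma measurable_sublevel n (f : 'rV[R]_n -> R) c : continuous f -> Lmeas [set x | f x <= c].
Proof.
move=> cf; have -> : [set x | f x <= c] = ~` (f @^-1` [set r | c < r]).
  by apply/seteqP; split => x /=; [move/le_gtF => ->|move/negP; rewrite -leNgt].
by apply/LmeasC/measurable_open_row; apply: open_comp => // x _; exact: cf.
Qed.

Variable m : nat.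
Implicit Types (x : 'rV[R]_m.+1) (y : 'rV[R]_m) (h : R).

Lemma dot_tail x : dot x x = x 0 ord0 ^+ 2 + dot (tail_row x) (tail_row x).
Proof.
rewrite /dot big_ord_recl expr2; congr (_ + _).
by apply: eq_bigr => i _; rewrite mxE.
Qed.

(** To first order in t, the cone over the part of the sphere at height between
    0 and t above the equator. *)
Definition wedge (t : R) : set 'rV[R]_m.+1 :=
  [set x | enorm (tail_row x) <= 1 /\ 0 < x 0 ord0 < t * enorm (tail_row x)].

Definition circular_cone : set 'rV[R]_m.+1 :=
  [set x | enorm (tail_row x) <= x 0 ord0 <= 1].

Lemma continuous_tail_dot :
  continuous (fun x : 'rV[R]_m.+1 => dot (tail_row x) (tail_row x)).
Proof.
apply: continuous_sumr => i; apply: continuous_mulr; under eq_fun do rewrite mxE;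
  exact: coord_continuous.
Qed.

Lemma measurable_circular_cone : Lmeas circular_cone.
Proof.
have -> : circular_cone =
    [set x : 'rV[R]_m.+1 | dot (tail_row x) (tail_row x) - x 0 ord0 * x 0 ord0 <= 0] `&`
    ([set x : 'rV[R]_m.+1 | - x 0 ord0 <= 0] `&` [set x : 'rV[R]_m.+1 | x 0 ord0 <= 1]).
  apply/seteqP; split => x; rewrite /circular_cone/= subr_le0 oppr_le0.
    move=> /andP[tx x1]; have x0 := le_trans (enorm_ge0 _) tx.
    by rewrite -expr2 -enorm_le.
  by move=> [tx [x0 x1]]; rewrite x1 andbT enorm_le.
apply: LmeasI; last apply: LmeasI.
- apply: measurable_sublevel; apply: continuous_subr; first exact: continuous_tail_dot.
  by apply: continuous_mulr; exact: coord_continuous.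
- apply: measurable_sublevel; apply: continuous_oppr; exact: coord_continuous.
- apply: measurable_sublevel; exact: coord_continuous.
Qed.

Lemma lebesgue_outer_scaled_ball h : 0 < h ->
  lebesgue_outer [set y : 'rV[R]_m | (enorm y <= h)%R] = (h ^+ m * omega m)%:E.
Proof.
move=> h0; rewrite EFinM -lebesgue_outer_unit_ball -lebesgue_outerZ//; congr lebesgue_outer.
apply/seteqP; split => [y /= yh|_ [y /= y1 <-]]; last first.
  by rewrite /= enormZ ?(ltW h0)// ger_pMr.
exists (h^-1 *: y); last by rewrite scalerA mulfV ?scale1r ?lt0r_neq0.
by rewrite /unit_ball/= enormZ ?invr_ge0 ?(ltW h0)// mulrC ler_pdivrMr// mul1r.
Qed.

Lemma integral_pow (w c : R) : 
  (\int[lebesgue_measure]_(h in (`]0%R, 1%R[%classic : set R)) (w + c * h ^+ m)%:E =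
   (w + c / m.+1%:R)%:E)%E.
Proof.
have mf : measurable_fun (`]0, 1[%classic : set R) (fun h : R => w + c * h ^+ m).
  apply: measurable_funTS; apply: measurable_funD => //.
  by apply: measurable_funM => //; exact: exprn_measurable.
rewrite -(@integral_itv_bndoo _ _ _ _ true false); last exact/measurable_EFinP.
pose F (h : R) := w * h + c / m.+1%:R * h ^+ m.+1.
have dF (h : R) : is_derive h 1 (F : R -> R^o) (w + c * h ^+ m).
  have h1 := is_deriveZ (c / m.+1%:R) (@is_deriveX R _ id m.+1 h 1 1 (is_derive_id _ _)).
  have h2 := is_deriveZ w (@is_derive_id R R^o h 1).
  have := is_deriveD h2 h1.
  rewrite (_ : _ + _ = F); last by apply/funext => y; rewrite /F /= !fctE.
  move=> /is_derive_eq; apply; rewrite /= /GRing.scale/=.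
  by rewrite !mulr1 mulrA divfK// pnatr_eq0.
have cF : continuous F.
  move=> h; apply: differentiable_continuous; apply/derivable1_diffP.
  by case: (dF h).
rewrite (@continuous_FTC2 _ _ F 0 1)//.
- rewrite -EFinB /F; congr (_%:E); by rewrite !expr1n !expr0n/= !mulr1 !mulr0 addr0 subr0.
- apply: continuous_subspaceT => h; apply: cvgD; first exact: cvg_cst.
  by apply: cvgM; [exact: cvg_cst | exact: exprn_continuous].
- split=> [h _||]; first by case: (dF h).
  + by apply: cvg_at_right_filter; exact: cF.
  + by apply: cvg_at_left_filter; exact: cF.
- by move=> h _; rewrite derive1E; case: (dF h).
Qed.

Lemma lebesgue_outer_annulus h : 0 < h -> 
  ((omega m - omega m * h ^+ m)%:E <=
   lebesgue_outer [set y : 'rV[R]_m | (h < enorm y <= 1)%R])%E.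
Proof.
move=> h0; rewrite EFinB leeBlDr// mulrC -(lebesgue_outer_scaled_ball h0).
rewrite -lebesgue_outer_unit_ball; apply: le_trans (outer_measureU2 _ _ _).
apply: le_lebesgue_outer => y y1 /=.
by case: (leP (enorm y) h) => yh; [right|left; rewrite y1].
Qed.

(** The wedge and the circular cone fill the unit cylinder. Slices bound the
    volume of each of them from below, and the sum of the two lower bounds is
    the volume of the cylinder. *)
Lemma lebesgue_outer_wedge1 :
  lebesgue_outer (wedge 1) = (m%:R / m.+1%:R * omega m)%:E.
Proof.
have w0 := @omega_gt0 m; have m0 : (m.+1%:R : R) != 0 by rewrite pnatr_eq0.
have mE : m%:R = m.+1%:R - 1 :> R by rewrite -natr1 addrK.
have pow01 h : 0 < h < 1 -> 0 <= h ^+ m <= 1.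
  by move=> /andP[h0 h1]; rewrite exprn_ge0 ?exprn_ile1 ?ltW.
have Wge : ((omega m - omega m / m.+1%:R)%:E <= lebesgue_outer (wedge 1))%E.
  rewrite -mulNr -integral_pow.
  apply: lebesgue_outer_slices => [|h h01|h h01].
  - apply: measurable_funTS; apply: measurable_funD => //.
    by apply: measurable_funM => //; exact: exprn_measurable.
  - by have := pow01 _ h01; nra.
  - have /andP[h0 h1] := h01; rewrite mulNr.
    apply: (le_trans (lebesgue_outer_annulus h0)); apply: le_lebesgue_outer => y /= /andP[hy y1].
    by rewrite /wedge/= tail_cons_row cons_row0 mul1r h0 hy.
have Cge : ((omega m / m.+1%:R)%:E <= lebesgue_outer circular_cone)%E.
  rewrite -[(_ / _)%R]add0r -integral_pow.
  apply: lebesgue_outer_slices => [|h h01|h h01].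
  - apply: measurable_funTS; apply: measurable_funD => //.
    by apply: measurable_funM => //; exact: exprn_measurable.
  - by have := pow01 _ h01; nra.
  - have /andP[h0 h1] := h01; rewrite add0r mulrC -(lebesgue_outer_scaled_ball h0).
    apply: le_lebesgue_outer => y /= hy.
    by rewrite /circular_cone/= tail_cons_row cons_row0 hy ltW.
have sum_le : (lebesgue_outer (wedge 1) + lebesgue_outer circular_cone <= (omega m)%:E)%E.
  rewrite -lebesgue_outer_unit_ball; apply: le_trans (lebesgue_outer_cylinder _).
  set Cyl := [set x | _]; rewrite (measurable_circular_cone Cyl) addeC.
  apply: leeD; apply: le_lebesgue_outer => x.
    move=> /andP[xt x1]; split; last by rewrite /circular_cone/= xt.
    split; first by rewrite x1 (le_trans (enorm_ge0 _) xt).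
    exact: le_trans x1.
  rewrite /wedge/= mul1r => -[t1 /andP[x0 xt]].
  split; last by rewrite /circular_cone/= => /andP[]; rewrite leNgt xt.
  by split => //; rewrite ltW//= (le_trans (ltW xt)).
have Wfin : lebesgue_outer (wedge 1) \is a fin_num.
  rewrite ge0_fin_numE ?outer_measure_ge0//; apply: le_lt_trans (ltry (omega m)).
  by apply: le_trans sum_le; rewrite leeDl// outer_measure_ge0.
apply/eqP; rewrite eq_le; apply/andP; split; last first.
  by apply: le_trans Wge; rewrite lee_fin le_eqVlt; apply/orP; left; apply/eqP; rewrite mE; field.
have -> : (m%:R / m.+1%:R * omega m)%R = (omega m - omega m / m.+1%:R)%R :> R
  by rewrite mE; field.
rewrite EFinB leeBrDr//; apply: le_trans sum_le; exact: leeD.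
Qed.

Lemma lebesgue_outer_wedge t : 0 < t ->
  lebesgue_outer (wedge t) = (t * (m%:R / m.+1%:R * omega m))%:E.
Proof.
move=> t0; rewrite EFinM -lebesgue_outer_wedge1.
pose d c : 'rV[R]_m.+1 := \row_i (if i == ord0 then c else 1).
have dE c (x : 'rV[R]_m.+1) : [/\ (x *m diag_mx (d c)) 0 ord0 = x 0 ord0 * c &
    tail_row (x *m diag_mx (d c)) = tail_row x].
  split; first by rewrite mul_mx_diag !mxE eqxx.
  by apply/rowP => i; rewrite mxE mul_mx_diag !mxE/= mulr1.
have dle c A : 0 < c -> (lebesgue_outer (linimg (diag_mx (d c)) A) <= c%:E * lebesgue_outer A)%E.
  move=> c0; have := @lebesgue_outer_diag_le R _ (d c) A.
  rewrite big_ord_recl big1 => [|i _]; last by rewrite mxE/= normr1.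
  rewrite mxE eqxx mulr1 gtr0_norm//; apply => i; rewrite mxE; case: ifP => // _.
  exact: lt0r_neq0.
apply/eqP; rewrite eq_le; apply/andP; split.
  apply: le_trans (dle _ _ t0); apply: le_lebesgue_outer => x [x1 /andP[x0 xt]].
  exists (x *m diag_mx (d t^-1)).
    have [h0 ht] := dE t^-1 x; rewrite /wedge/= h0 ht; split => //.
    by rewrite divr_gt0// ltr_pdivrMr// mul1r mulrC.
  apply/rowP => i; rewrite !mul_mx_diag !mxE; case: ifP => _; last by rewrite !mulr1.
  by rewrite mulfVK// lt0r_neq0.
rewrite -lee_pdivlMl//; apply: le_trans (dle t^-1 _ _); last by rewrite invr_gt0.
apply: le_lebesgue_outer => x [x1 /andP[x0 xt]]; exists (x *m diag_mx (d t)).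
  have [h0 ht] := dE t x; rewrite /wedge/= h0 ht; split => //.
  by rewrite mulr_gt0//= mulrC ltr_pM2l//; rewrite mul1r in xt.
apply/rowP => i; rewrite !mul_mx_diag !mxE; case: ifP => _; last by rewrite !mulr1.
by rewrite mulfK// lt0r_neq0.
Qed.

End BallVolumes.

(** * Spherical measure *)

Lemma integral_preserving d (T : measurableType d) (R : realType)
    (mu : {measure set T -> \bar R}) (h : T -> T) (D : set T) (f : T -> \bar R) :
  measurable_fun setT h -> (forall A, measurable A -> mu (h @^-1` A) = mu A) ->
  measurable D -> measurable_fun setT f ->
  mu.-integrable (h @^-1` D) (f \o h) ->
  (\int[mu]_(x in h @^-1` D) f (h x) = \int[mu]_(x in D) f x)%E.
Proof.
move=> mh muh mD mf intf; rewrite -[LHS](integral_pushforward mh mf intf mD).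
by apply: eq_measure_integral => A mA _; exact: muh.
Qed.

Lemma measurable_sum_mulr d (T : measurableType d) (R : realType) (I : finType)
    (f g : I -> T -> R) :
  (forall i, measurable_fun setT (f i)) -> (forall i, measurable_fun setT (g i)) ->
  measurable_fun setT (fun x => \sum_i f i x * g i x).
Proof. by move=> mf mg; apply: measurable_sum => i; apply: measurable_funM. Qed.

Section Spherical.
Context {R : realType}.
Variable n : nat.
Hypothesis n_gt0 : (0 < n)%N.
Implicit Types (u v x : 'rV[R]_n) (A X : set 'rV[R]_n).

Definition sphere_type := caratheodory_type (@spherical_outer R n).
Definition Smeas A := @measurable _ sphere_type A.

Lemma lebesgue_outer_origin : lebesgue_outer [set 0 : 'rV[R]_n] = 0%E.
Proof.
apply/eqP; rewrite eq_le outer_measure_ge0 andbT.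
have -> : [set 0 : 'rV[R]_n] = box 0 0.
  apply/seteqP; split => [_ -> i|x x0]; first by rewrite lexx.
  by apply/rowP => i; have := x0 i; rewrite !mxE => /le_anti ->.
apply: (le_trans (@lebesgue_outer_box R n 0 0 _)) => [i|]; first by [].
by rewrite lee_fin /volume (bigD1 (Ordinal n_gt0))//= subrr mul0r.
Qed.

(** Away from the origin, splitting a cone over a subset of the sphere by V is
    splitting this subset by A. *)
Lemma Smeas_cone A (V : set 'rV[R]_n) : Lmeas V ->
  (forall r u, unit_sphere u -> 0 < r -> V (r *: u) <-> A u) -> Smeas A.
Proof.
move=> mV VA; apply: le_caratheodory_measurable => X.
rewrite /= /spherical_outer -ge0_muleDr ?outer_measure_ge0//.
apply: lee_wpmul2l; first by rewrite lee_fin.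
set C := cone (X `&` unit_sphere).
have CV : (lebesgue_outer (cone (X `&` A `&` unit_sphere)) <= lebesgue_outer (C `&` V))%E.
  rewrite -[leRHS]adde0 -lebesgue_outer_origin; apply: le_trans (outer_measureU2 _ _ _).
  apply: le_lebesgue_outer => _ [r [u [/andP[r0 r1] [[Xu Au] Su] ->]]].
  (* The origin belongs to every cone and has volume 0. *)
  have [->|rn0] := eqVneq r 0; first by right; rewrite scale0r.
  left; split; first by exists r, u; split=> //; rewrite r0.
  by apply/VA => //; rewrite lt_neqAle eq_sym rn0.
have CnV : (lebesgue_outer (cone (X `&` ~` A `&` unit_sphere)) <= lebesgue_outer (C `&` ~` V))%E.
  rewrite -[leRHS]adde0 -lebesgue_outer_origin; apply: le_trans (outer_measureU2 _ _ _).
  apply: le_lebesgue_outer => _ [r [u [/andP[r0 r1] [[Xu Au] Su] ->]]].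
  have [->|rn0] := eqVneq r 0; first by right; rewrite scale0r.
  left; split; first by exists r, u; split=> //; rewrite r0.
  by move=> /VA h; apply: Au; apply: h => //; rewrite lt_neqAle eq_sym rn0.
by rewrite (mV C); apply: leeD.
Qed.

Lemma measurable_coord (i : 'I_n) :
  measurable_fun setT (fun u : sphere_type => (u : 'rV[R]_n) 0 i).
Proof.
apply: (measurability _ (RGenInftyO.measurableE R)) => _ [_ [c ->] <-].
rewrite setTI; apply: (@Smeas_cone _ [set x : 'rV[R]_n | x 0 i < c * enorm x]).
  have -> : [set x : 'rV[R]_n | x 0 i < c * enorm x] =
      ~` [set x : 'rV[R]_n | c * enorm x - x 0 i <= 0].
    by apply/seteqP; split => x /=; rewrite subr_le0 ltNge => /negP.
  apply/LmeasC/measurable_sublevel; apply: continuous_subr; last exact: coord_continuous.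
  apply: continuous_mulr; first exact: cst_continuous.
  apply: continuous_sqrtr; apply: continuous_sumr => j.
  by apply: continuous_mulr; exact: coord_continuous.
move=> r u u1 r0 /=; rewrite enormZ ?ltW// (u1 : enorm u = 1) mxE mulr1 mulrC in_itv/=.
by rewrite ltr_pM2r.
Qed.

Lemma measurable_dotl (w : 'rV[R]_n) :
  measurable_fun setT (fun u : sphere_type => dot (u : 'rV[R]_n) w).
Proof.
exact: (measurable_sum_mulr measurable_coord (fun i => measurable_cst (w 0 i))).
Qed.

Lemma Smeas_sphere : Smeas (@unit_sphere R n).
Proof.
pose d (u : sphere_type) := dot (u : 'rV[R]_n) u.
have -> : @unit_sphere R n = setT `&` d @^-1` [set 1].
  rewrite setTI; apply/seteqP; split => u; rewrite /unit_sphere/= /d -enorm_sqr.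
    by move=> ->; rewrite expr1n.
  move=> /eqP; rewrite sqrf_eq1 => /orP[/eqP//|/eqP u1].
  by have := enorm_ge0 u; rewrite u1; lra.
have md : measurable_fun setT d.
  exact: (measurable_sum_mulr measurable_coord measurable_coord).
exact: md.
Qed.

Lemma spherical_fin A : (spherical n A < +oo)%E.
Proof.
apply: (@le_lt_trans _ _ (n%:R%:E * lebesgue_outer (@unit_ball R n))%E); last first.
  by rewrite lebesgue_outer_unit_ball -EFinM ltry.
apply: lee_wpmul2l; first by rewrite lee_fin.
apply: le_lebesgue_outer => _ [r [u [/andP[r0 r1] [_ Su] ->]]].
by rewrite /unit_ball/= enormZ// (Su : enorm u = 1) mulr1.
Qed.

Lemma dot_reflection v u x : v != 0 ->
  dot (u *m reflection v) (x *m reflection v) = dot u x.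
Proof.
rewrite -dot_eq0 => v0; rewrite !reflectionE dotBl !dotBr !dotZl !dotZr (dotC v x).
by field.
Qed.

Lemma enorm_reflection v u : v != 0 -> enorm (u *m reflection v) = enorm u.
Proof. by move=> v0; rewrite /enorm dot_reflection. Qed.

Lemma linimg_reflectionE v A : v != 0 ->
  linimg (reflection v) A = (fun u => u *m reflection v) @^-1` A.
Proof.
move=> v0; apply/seteqP; split => [_ [u Au <-]|u Au].
  by rewrite /= -mulmxA reflectionK// mulmx1.
by exists (u *m reflection v) => //; rewrite -mulmxA reflectionK// mulmx1.
Qed.

Lemma spherical_outer_reflection v A : v != 0 ->
  spherical_outer (linimg (reflection v) A) = spherical_outer A.
Proof.
move=> v0; rewrite /spherical_outer; congr (_ * _)%E.
rewrite -[RHS](@lebesgue_outer_reflection _ _ v)//; congr lebesgue_outer.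
apply/seteqP; split => x.
  move=> [r [_ [r01 [[u Au <-] Su] ->]]]; exists (r *: u); last by rewrite -scalemxAl.
  exists r, u; split => //; split => //.
  by move: Su; rewrite /unit_sphere/= enorm_reflection.
move=> [_ [r [u [r01 [Au Su] ->]]] <-].
exists r, (u *m reflection v); rewrite -scalemxAl; split => //; split; first by exists u.
by move: Su; rewrite /unit_sphere/= enorm_reflection.
Qed.

Lemma measurable_reflection v : v != 0 ->
  measurable_fun setT ((fun u => u *m reflection v) : sphere_type -> sphere_type).
Proof.
move=> v0 _ A mA; rewrite setTI -linimg_reflectionE//.
apply: le_caratheodory_measurable => X /=.
pose h (u : 'rV[R]_n) := u *m reflection v.
have hh (B : set 'rV[R]_n) : h @^-1` (h @^-1` B) = B.
  by rewrite -!linimg_reflectionE// -linimg_mul reflectionK// linimg1.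
have hS (B : set 'rV[R]_n) : spherical_outer B = spherical_outer (h @^-1` B).
  by rewrite -linimg_reflectionE// spherical_outer_reflection.
have e1 : spherical_outer (X `&` h @^-1` A) = spherical_outer (h @^-1` X `&` A).
  by rewrite hS preimage_setI hh.
have e2 : spherical_outer (X `&` ~` (h @^-1` A)) = spherical_outer (h @^-1` X `&` ~` A).
  by rewrite hS preimage_setI -preimage_setC hh.
by rewrite linimg_reflectionE// e1 e2 (hS X) (mA (h @^-1` X)).
Qed.

Lemma integral_reflection v (D : set sphere_type) (f : sphere_type -> \bar R) : v != 0 ->
  measurable D -> measurable_fun setT f ->
  (spherical n).-integrable ((fun u => u *m reflection v) @^-1` D)
    (fun u => f (u *m reflection v)) ->
  (\int[spherical n]_(u in (fun u => u *m reflection v) @^-1` D) f (u *m reflection v)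
    = \int[spherical n]_(u in D) f u)%E.
Proof.
move=> v0 mD mf intf.
apply: (integral_preserving (measurable_reflection v0)) => // A _.
by rewrite -linimg_reflectionE//; exact: spherical_outer_reflection.
Qed.

End Spherical.

(** * Powers of the height on a thin equatorial band *)

Lemma le_powR_anti (R : realType) (p x y : R) : p <= 0 -> 0 < x -> x <= y -> y `^ p <= x `^ p.
Proof.
move=> p0 x0 xy; have y0 := lt_le_trans x0 xy.
rewrite -(opprK p) !(powRN _ (- p)) lef_pV2 ?posrE ?powR_gt0//.
by apply: ge0_ler_powR => //; rewrite ?nnegrE ?oppr_ge0 ?(ltW x0) ?(ltW y0).
Qed.

Lemma geometric_nneseries (R : realType) (c r : R) : 0 <= c -> 0 <= r < 1 ->
  (\sum_(0 <= k <oo) (c * r ^+ k)%:E = (c / (1 - r))%:E)%E.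
Proof.
move=> c0 /andP[r0 r1]; apply/cvg_lim => //.
under eq_fun do rewrite sumEFin.
apply: cvg_EFin; first by near=> k.
rewrite (_ : fine \o _ = series (geometric c r)) //.
apply: cvg_geometric_series; by rewrite ger0_norm.
Unshelve. all: by end_near. Qed.

Section ShellIntegral.
Context disp (T : measurableType disp) {R : realType}.
Variables (mu : {measure set T -> \bar R}) (S : set T) (h : T -> R).
Hypotheses (mS : measurable S) (mh : measurable_fun setT h) (mu_fin : (mu S < +oo)%E).
Variable kappa : R.
Hypothesis k0 : 0 <= kappa.

Definition sublevel (t : R) : set T := [set u | S u /\ 0 < h u < t].

Lemma measurable_positive_sublevel t : measurable (sublevel t).
Proof.
have -> : sublevel t = S `&` (setT `&` h @^-1` `]0, t[%classic).
  by rewrite setTI; apply/seteqP; split => u; rewrite /sublevel/= in_itv.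
by apply: measurableI => //; exact: mh.
Qed.

Definition shell (d l : R) (k : nat) : set T := sublevel (d * l ^+ k) `\` sublevel (d * l ^+ k.+1).

Lemma bigcup_shell d l : 0 < d -> 0 < l < 1 -> \bigcup_k shell d l k = sublevel d.
Proof.
move=> d0 /andP[l0 l1]; apply/seteqP; split => [u [k _ [[Su /andP[u0 uk]] _]]|u [Su /andP[u0 ud]]].
  by split => //; rewrite u0 (lt_le_trans uk)// ger_pMr// exprn_ile1 ?ltW.
have [k hk] : exists k, ~~ (h u < d * l ^+ k.+1).
  have /cvgr_lt/(_ (h u)) : d * l ^+ k @[k --> \oo] --> d * 0.
    by apply: cvgMr; apply: cvg_expr; rewrite gtr0_norm.
  rewrite mulr0 => /(_ u0)[k _ /(_ k.+1)] dk; exists k; rewrite -leNgt ltW//; apply: dk => /=.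
  exact: leqnSn.
have [j hj jmin] := ex_minnP (ex_intro (fun k => ~~ (h u < d * l ^+ k.+1)) k hk).
exists j => //; split; last by move=> [_ /andP[_]]; apply/negP.
split => //; rewrite u0/=; case: j hj jmin => [|j] hj jmin; first by rewrite expr0 mulr1.
by rewrite -[_ < _]negbK; apply/negP => /jmin; rewrite ltnn.
Qed.

Lemma trivIset_shell d l : 0 < d -> 0 < l < 1 -> trivIset setT (shell d l).
Proof.
move=> d0 /andP[l0 l1]; apply: ltn_trivIset => j i ij; rewrite -subset0 => u [[[Su /andP[u0 ui]] nu]].
move=> [[_ /andP[_ uj]] _]; apply: nu; split => //; rewrite u0/= (lt_le_trans uj)//.
by rewrite ler_pM2l// ler_wiXn2l ?ltW.
Qed.

Lemma measurable_shell d l k : measurable (shell d l k).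
Proof. by apply: measurableD; exact: measurable_positive_sublevel. Qed.

Lemma measurable_powR_h (p : R) (D : set T) : measurable_fun D (fun u => h u `^ p).
Proof. by apply: measurable_funTS; exact: (measurableT_comp (measurable_powR p) mh). Qed.

Lemma mu_sublevel_fin t : (mu (sublevel t) < +oo)%E.
Proof.
apply: le_lt_trans mu_fin; apply: le_measure; rewrite ?inE//; first exact: measurable_positive_sublevel.
by move=> u [].
Qed.

Definition linear_growth := forall e : R, 0 < e -> exists2 d : R, 0 < d &
  forall t, 0 < t < d -> exists2 g : R, mu (sublevel t) = g%:E &
    (1 - e) * kappa * t <= g <= (1 + e) * kappa * t.

(** On the shell where h lies between d * l ^ (k + 1) and d * l ^ k the
    integrand is pinched between two constants, and the measure of the shell is
    known from the linear growth. The sums over the shells are geometric series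
    of ratio l ^ q, and q * (1 - l) / (1 - l ^ q) is close to 1 uniformly in q
    when l is close to 1. *)
Lemma integral_shells (e : R) : linear_growth -> 0 < e -> exists2 d0 : R, 0 < d0 < 1 & forall d q : R,
  0 < d < d0 -> 0 < q < 1 -> exists2 s : R,
    (\int[mu]_(u in sublevel d) (h u `^ (q - 1))%:E = s%:E)%E &
    (1 - e) * kappa * d `^ q <= q * s <= (1 + e) * kappa * d `^ q.
Proof.
move=> growth e0.
(* The shells are thin enough for both geometric sums to be accurate. *)
have [l [l2 l1 llo lhi]] : exists l : R, [/\ 1 / 2 < l, l < 1, 1 - e <= l * (2 * l - 1) &
    3 - 2 * l <= (1 + e) * l].
  pose g := Num.min (1 / 4) (e / (3 + e)); exists (1 - g).
  have h0 : 0 < g by rewrite lt_min divr_gt0//= divr_gt0//; lra.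
  have h4 : g <= 1 / 4 by rewrite ge_min lexx.
  have he : g * (3 + e) <= e by rewrite -ler_pdivlMr; [rewrite ge_min lexx orbT|lra].
  by split; nra.
have l0 : 0 < l by lra.
pose f : R := (1 - l) ^+ 2; have f0 : 0 < f by rewrite exprn_gt0// subr_gt0.
have [d0 d0_gt0 capd] := growth _ f0.
exists (Num.min d0 (1/2)); first by rewrite lt_min d0_gt0 gt_min; apply/andP; split; [lra|apply/orP; right; lra].
move=> d q /andP[d_gt0]; rewrite lt_min => /andP[dd0 d2] /andP[q0 q1].
pose t k : R := d * l ^+ k.
have t0 k : 0 < t k by rewrite mulr_gt0// exprn_gt0.
have tS k : t k.+1 = l * t k by rewrite /t exprS mulrCA.
have td k : t k <= d by rewrite ger_pMr// exprn_ile1 ?ltW.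
have H k : {g : R | mu (sublevel (t k)) = g%:E &
    (1 - f) * kappa * t k <= g <= (1 + f) * kappa * t k}.
  by apply/cid2; apply: capd; rewrite t0 (le_lt_trans (td k)).
pose g k : R := let: exist2 x _ _ := H k in x.
have gE k : mu (sublevel (t k)) = (g k)%:E by rewrite /g; case: (H k).
have gb k : (1 - f) * kappa * t k <= g k <= (1 + f) * kappa * t k by rewrite /g; case: (H k).
have shE k : mu (shell d l k) = (g k - g k.+1)%:E.
  rewrite /shell measureD; [|exact: measurable_positive_sublevel|exact: measurable_positive_sublevel|exact: mu_sublevel_fin].
  rewrite -/(t k) -/(t k.+1) (_ : sublevel (t k) `&` sublevel (t k.+1) = sublevel (t k.+1)); last first.
    apply/setIidPr => u [Su /andP[u0 ut]]; split => //; rewrite u0 (lt_le_trans ut)// tS.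
    by rewrite ger_pMl// ltW.
  by transitivity ((g k)%:E - (g k.+1)%:E)%E => //; rewrite -!gE.
have dlt k : (1 - l) * (2 * l - 1) * (kappa * t k) <= g k - g k.+1 <=
     (1 - l) * (3 - 2 * l) * (kappa * t k).
  have kt : 0 <= kappa * t k by rewrite mulr_ge0// ltW.
  have assoc (a b : R) : a * kappa * (b * t k) = a * b * (kappa * t k) by ring.
  have := gb k; have := gb k.+1; rewrite tS !assoc -!(mulrA _ kappa) /f.
  move: (kappa * t k) kt (g k) (g k.+1) => X X0 y z.
  by move=> /andP[? ?] /andP[? ?]; apply/andP; split; nra.
have g0 k : 0 <= g k - g k.+1 by rewrite -lee_fin -shE measure_ge0.
pose rho := l `^ q.
have rho0 : 0 < rho by rewrite powR_gt0.
pose ell := - ln l.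
have rhoE : rho = expR (- (q * ell)) by rewrite /rho /powR gt_eqF// /ell mulrN opprK.
have lE : l = expR (- ell) by rewrite /ell opprK lnK.
have ell1 : 1 - l <= ell by have := expR_ge1Dx (- ell); rewrite -lE; lra.
have ell2 : l * ell <= 1 - l.
  have := expR_ge1Dx ell; have : expR ell * l = 1 by rewrite [X in _ * X]lE -expRD subrr expR0.
  by move: (expR ell) => E El E1; nra.
have ell0 : 0 < ell by apply: lt_le_trans ell1; rewrite subr_gt0.
have rho1 : 1 - rho <= q * ell by have := expR_ge1Dx (- (q * ell)); rewrite -rhoE; lra.
have rho2 : rho * (q * ell) <= 1 - rho.
  have := expR_ge1Dx (q * ell); have : expR (q * ell) * rho = 1 by rewrite rhoE -expRD subrr expR0.
  by move: (expR (q * ell)) => E El E1; nra.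
have rholt : rho < 1.
  by rewrite -subr_gt0; apply: lt_le_trans rho2; rewrite !mulr_gt0.
have tq k : t k `^ q = d `^ q * rho ^+ k.
  rewrite /t powRM ?exprn_ge0 ?ltW//; congr (_ * _).
  by rewrite /rho -(@powR_mulrn R l k (ltW l0)) -(@powR_mulrn R (l `^ q) k (powR_ge0 _ _)) powRAC.
have tq1 k : t k * t k `^ (q - 1) = d `^ q * rho ^+ k.
  by rewrite mulr_powRB1 ?ltW// tq.
pose D := d `^ q; have D0 : 0 < D by rewrite powR_gt0.
have m_pow k : measurable_fun (shell d l k) (fun u : T => (h u `^ (q - 1))%:E).
  exact/measurable_EFinP/measurable_powR_h.
have pow_ge0 (u : T) : (0 <= (h u `^ (q - 1))%:E)%E by rewrite lee_fin powR_ge0.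
have intE : (\int[mu]_(u in sublevel d) (h u `^ (q - 1))%:E =
    \sum_(0 <= k <oo) \int[mu]_(u in shell d l k) (h u `^ (q - 1))%:E)%E.
  have l01 : 0 < l < 1 by rewrite l0.
  rewrite -(bigcup_shell d_gt0 l01) ge0_integral_bigcup//.
  - by move=> k; exact: measurable_shell.
  - by apply/measurable_EFinP; exact: measurable_powR_h.
  - exact: trivIset_shell.
have up k : (\int[mu]_(u in shell d l k) (h u `^ (q - 1))%:E <=
    (D * kappa * ((1 - l) * (3 - 2 * l)) / l * rho * rho ^+ k)%:E)%E.
  apply: (@le_trans _ _ (\int[mu]_(u in shell d l k) (cst ((t k.+1) `^ (q - 1))%:E u))%E).
    apply: ge0_le_integral => //; first exact: measurable_shell.
    move=> u [[Su /andP[u0 _]] nu]; rewrite lee_fin le_powR_anti//; first by lra.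
    by rewrite leNgt; apply/negP => ult; apply: nu; split => //; rewrite u0.
  rewrite integral_cst; last exact: measurable_shell.
  rewrite shE -EFinM lee_fin.
  have -> : D * kappa * ((1 - l) * (3 - 2 * l)) / l * rho * rho ^+ k =
     t k.+1 `^ (q - 1) * ((1 - l) * (3 - 2 * l) * (kappa * t k)).
    have := tq1 k.+1; rewrite tS exprS -/D => tqk.
    have -> : D * kappa * ((1 - l) * (3 - 2 * l)) / l * rho * rho ^+ k =
      (D * (rho * rho ^+ k)) * (kappa * ((1 - l) * (3 - 2 * l)) / l) by ring.
    by rewrite -tqk; field; rewrite lt0r_neq0.
  by rewrite ler_wpM2l ?powR_ge0//; case/andP: (dlt k).
have lo k : ((D * kappa * ((1 - l) * (2 * l - 1)) * rho ^+ k)%:E <=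
    \int[mu]_(u in shell d l k) (h u `^ (q - 1))%:E)%E.
  apply: (@le_trans _ _ (\int[mu]_(u in shell d l k) (cst ((t k) `^ (q - 1))%:E u))%E); last first.
    apply: ge0_le_integral => //.
    - exact: measurable_shell.
    - by move=> u _; rewrite lee_fin powR_ge0.
    - move=> u [[Su /andP[u0 ult]] nu]; rewrite lee_fin le_powR_anti//; first by lra.
      exact: ltW.
  rewrite integral_cst; last exact: measurable_shell.
  rewrite shE -EFinM lee_fin.
  have -> : D * kappa * ((1 - l) * (2 * l - 1)) * rho ^+ k =
     t k `^ (q - 1) * ((1 - l) * (2 * l - 1) * (kappa * t k)).
    have -> : D * kappa * ((1 - l) * (2 * l - 1)) * rho ^+ k =
      (D * rho ^+ k) * (kappa * ((1 - l) * (2 * l - 1))) by ring.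
    by rewrite -tq1; ring.
  by rewrite ler_wpM2l ?powR_ge0//; case/andP: (dlt k).
pose u1 := D * kappa * ((1 - l) * (3 - 2 * l)) / l * rho.
pose l1' := D * kappa * ((1 - l) * (2 * l - 1)).
have Dk0 : 0 <= D * kappa by rewrite mulr_ge0// ltW.
have u1_ge0 : 0 <= u1 by rewrite /u1 !mulr_ge0 ?invr_ge0 ?(ltW rho0) ?(ltW l0) ?(ltW D0)//; lra.
have l1_ge0 : 0 <= l1' by rewrite /l1' !mulr_ge0 ?(ltW D0)//; lra.
have rho01 : 0 <= rho < 1 by rewrite ltW.
have int_le : (\int[mu]_(u in sublevel d) (h u `^ (q - 1))%:E <= (u1 / (1 - rho))%:E)%E.
  rewrite intE -geometric_nneseries//; apply: lee_nneseries => [k _ _|k _]; last exact: up.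
  by apply: integral_ge0.
have int_ge : ((l1' / (1 - rho))%:E <= \int[mu]_(u in sublevel d) (h u `^ (q - 1))%:E)%E.
  rewrite intE -geometric_nneseries//; apply: lee_nneseries => [k _ _|k _]; last exact: lo.
  by rewrite lee_fin mulr_ge0// exprn_ge0// ltW.
have := int_le; have := int_ge.
rewrite -[X in (_ <= X)%E -> (X <= _)%E -> _](@fineK R); last first.
  rewrite ge0_fin_numE; first exact: (le_lt_trans int_le (ltry _)).
  exact: integral_ge0.
rewrite !lee_fin; set s := fine _ => sl su; exists s.
  rewrite /s fineK// ge0_fin_numE; first exact: (le_lt_trans int_le (ltry _)).
  exact: integral_ge0.
have r1 : 0 < 1 - rho by rewrite subr_gt0.
rewrite -/D; apply/andP; split.
  apply: (@le_trans _ _ (q * (l1' / (1 - rho)))); last by rewrite ler_pM2l.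
  rewrite mulrA ler_pdivlMr// /l1'.
  have -> : (1 - e) * kappa * D * (1 - rho) = (1 - e) * (1 - rho) * (D * kappa) by ring.
  have -> : q * (D * kappa * ((1 - l) * (2 * l - 1))) = q * (1 - l) * (2 * l - 1) * (D * kappa) by ring.
  rewrite ler_wpM2r//; apply: (@le_trans _ _ (l * (2 * l - 1) * (1 - rho))).
    by rewrite ler_wpM2r// ltW.
  have l21 : 0 <= 2 * l - 1 by lra.
  apply: (@le_trans _ _ (l * (2 * l - 1) * (q * ell))).
    by rewrite ler_wpM2l// mulr_ge0// ltW.
  have -> : l * (2 * l - 1) * (q * ell) = (2 * l - 1) * q * (l * ell) by ring.
  have -> : q * (1 - l) * (2 * l - 1) = (2 * l - 1) * q * (1 - l) by ring.
  by rewrite ler_wpM2l// mulr_ge0// ltW.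
apply: (@le_trans _ _ (q * (u1 / (1 - rho)))); first by rewrite ler_pM2l.
rewrite mulrA ler_pdivrMr// /u1.
have -> : q * (D * kappa * ((1 - l) * (3 - 2 * l)) / l * rho) =
  q * (1 - l) * rho * ((3 - 2 * l) / l) * (D * kappa) by field; rewrite lt0r_neq0.
have -> : (1 + e) * kappa * D * (1 - rho) = (1 + e) * (1 - rho) * (D * kappa) by ring.
rewrite ler_wpM2r//; have lq0 : 0 <= q * (1 - l) * rho by rewrite !mulr_ge0 ?subr_ge0 ?ltW.
apply: (@le_trans _ _ (q * (1 - l) * rho * (1 + e))).
  by rewrite ler_wpM2l// ler_pdivrMr.
rewrite mulrC ler_wpM2l//; first by rewrite addr_ge0// ltW.
apply: le_trans rho2; have -> : q * (1 - l) * rho = rho * (q * (1 - l)) by ring.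
by rewrite ler_pM2l// ler_pM2l.
Qed.

End ShellIntegral.

Section Shells.
Context {R : realType}.
Variable m : nat.
Notation n := m.+1.
Notation T := (@sphere_type R n).
Notation sigma := (spherical n).
Let kappa : R := m%:R * omega m.

Definition band (w : 'rV[R]_n) (t : R) : set T :=
  [set u : 'rV[R]_n | unit_sphere u /\ 0 < dot u w < t].

Definition axis : 'rV[R]_n := delta_mx 0 ord0.

Lemma dot_axis (u : 'rV[R]_n) : dot u axis = u 0 ord0.
Proof.
rewrite /dot (bigD1 ord0)//= mxE !eqxx mulr1 big1 ?addr0// => i i0.
by rewrite mxE (negbTE i0) mulr0.
Qed.

Lemma measurable_band w t : measurable (band w t).
Proof.
have -> : band w t = (@unit_sphere R n : set T) `&`
    (setT `&` (fun u : T => dot (u : 'rV[R]_n) w) @^-1` `]0, t[%classic).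
  by rewrite setTI; apply/seteqP; split => u; rewrite /band/= in_itv.
apply: measurableI; first exact: Smeas_sphere.
exact: (@measurable_dotl R n isT w).
Qed.

Lemma sphere_tail (u : 'rV[R]_n) : unit_sphere u -> u 0 ord0 ^+ 2 + enorm (tail_row u) ^+ 2 = 1.
Proof. by move=> u1; rewrite enorm_sqr -dot_tail -enorm_sqr (u1 : enorm u = 1) expr1n. Qed.

(** The cone over the band lies in the wedge of slope t / (1 - t), because the
    radius of the parallels of the band is at least 1 - t. *)
Lemma band_le t : 0 < t < 1 -> (sigma (band axis t) <= (kappa * (t / (1 - t)))%:E)%E.
Proof.
move=> /andP[t0 t1]; have s0 : 0 < t / (1 - t) by rewrite divr_gt0// subr_gt0.
have -> : kappa * (t / (1 - t)) = n%:R * (t / (1 - t) * (m%:R / n%:R * omega m)).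
  rewrite /kappa; have : n%:R != 0 :> R by rewrite pnatr_eq0.
  move: (n%:R) => a a0; field; rewrite a0/=; lra.
rewrite EFinM -lebesgue_outer_wedge//; apply: lee_wpmul2l; first by rewrite lee_fin.
rewrite -[leRHS]adde0 -(@lebesgue_outer_origin R n isT); apply: le_trans (outer_measureU2 _ _ _).
apply: le_lebesgue_outer => _ [r [u [/andP[r0 r1] [[_ /andP[u0 ut]] Su] ->]]].
have [->|rn0] := eqVneq r 0; first by right; rewrite scale0r.
have {rn0}r0 : 0 < r by rewrite lt_neqAle eq_sym rn0.
left; rewrite dot_axis in u0 ut; have tS := sphere_tail Su.
have te := enorm_ge0 (tail_row u).
have tE : tail_row (r *: u) = r *: tail_row u by apply/rowP => i; rewrite !mxE.
rewrite /wedge/= tE enormZ ?(ltW r0)// mxE.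
have eh : 1 - t <= enorm (tail_row u) by nra.
split; first by nra.
rewrite mulr_gt0//= mulrCA ltr_pM2l// (lt_le_trans ut)//.
by rewrite mulrAC ler_pdivlMr ?subr_gt0// ler_pM2l.
Qed.

(** Points of the wedge of slope t have norm at most 1 + t and direction in the
    band. *)
Lemma band_ge t : 0 < t -> ((kappa * (t / (1 + t) ^+ n))%:E <= sigma (band axis t))%E.
Proof.
move=> t0; have s0 : 0 < 1 + t by rewrite addr_gt0.
have -> : kappa * (t / (1 + t) ^+ n) = n%:R * ((1 + t) ^- n * (t * (m%:R / n%:R * omega m))).
  rewrite /kappa; have : n%:R != 0 :> R by rewrite pnatr_eq0.
  have : (1 + t) ^+ n != 0 by rewrite expf_neq0 ?lt0r_neq0.
  move: (n%:R) ((1 + t) ^+ n) => a b b0 a0; field; by rewrite a0 b0.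
rewrite EFinM EFinM -lebesgue_outer_wedge//; apply: lee_wpmul2l; first by rewrite lee_fin.
rewrite lee_pdivrMl ?exprn_gt0// -lebesgue_outerZ//; apply: le_lebesgue_outer => x [xt /andP[x0 xx]].
have xs := dot_tail x; rewrite -!enorm_sqr in xs.
have te := enorm_ge0 (tail_row x); have xe := enorm_ge0 x.
have e1 : enorm (tail_row x) ^+ 2 <= 1 by rewrite exprn_ile1.
have x02 : x 0 ord0 ^+ 2 <= t ^+ 2.
  by rewrite ler_sqr ?nnegrE ?(ltW x0) ?(ltW t0)// (le_trans (ltW xx))// ger_pMr.
have x1 : enorm x <= 1 + t.
  by rewrite -ler_sqr ?nnegrE ?(ltW s0)// xs; nra.
have xgt : 0 < enorm x.
  by rewrite lt_neqAle xe eq_sym andbT -sqrf_eq0 xs; nra.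
exists ((1 + t)^-1 *: x); last by rewrite scalerA mulfV ?scale1r ?lt0r_neq0.
exists (enorm x / (1 + t)), ((enorm x)^-1 *: x); split.
- by rewrite divr_ge0 ?(ltW s0)//= ler_pdivrMr// mul1r.
- have Su : unit_sphere ((enorm x)^-1 *: x).
    by rewrite /unit_sphere/= enormZ ?invr_ge0// mulVf// lt0r_neq0.
  split=> //; split=> //; rewrite dot_axis mxE mulr_gt0 ?invr_gt0//=.
  by rewrite mulrC ltr_pdivrMr//; nra.
- by rewrite scalerA mulrAC divff ?mul1r// lt0r_neq0.
Qed.

(** The limit of the quotient by t is the measure of the equator. *)
Lemma band_asymptotics (e : R) : 0 < e -> exists2 d : R, 0 < d & forall t, 0 < t < d ->
  exists2 g : R, sigma (band axis t) = g%:E & (1 - e) * kappa * t <= g <= (1 + e) * kappa * t.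
Proof.
move=> e0.
have k0 : 0 <= kappa by rewrite mulr_ge0// ltW// omega_gt0.
have [d [d0 d1 d2 d3]] : exists d : R, [/\ 0 < d, d < 1, 1 <= (1 + e) * (1 - d) &
    (1 - e) * (1 + d) ^+ n <= 1].
  have : (1 - e) * (1 + d) ^+ n @[d --> 0^'+] --> (1 - e) * (1 + 0) ^+ n.
    apply: cvgMr; apply: (@cvg_comp _ _ _ (fun d : R => 1 + d) (fun y => y ^+ n)); last exact: exprn_continuous.
    by apply: cvgD; [exact: cvg_cst | exact: cvg_at_right_filter].
  rewrite addr0 expr1n mulr1 => /cvgr_lt/(_ 1) h.
  have {}h : \forall d \near 0^'+, (1 - e) * (1 + d) ^+ n < 1 by apply: h; lra.
  near (0 : R)^'+ => d; exists d; split.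
  - by near: d; exact: nbhs_right_gt.
  - by near: d; apply: nbhs_right_lt.
  - have : d < e / (1 + e) by near: d; apply: nbhs_right_lt; rewrite divr_gt0//; lra.
    rewrite ltr_pdivlMr; [nra|lra].
  - by apply/ltW; near: d.
exists d => // t /andP[t0 td].
have t1 : 0 < t < 1 by rewrite t0 (lt_trans td).
have := band_ge t0; have := band_le t1.
rewrite -[sigma _](@fineK R); last first.
  rewrite ge0_fin_numE ?measure_ge0//; exact: (@spherical_fin R n).
rewrite !lee_fin => h1 h2; exists (fine (sigma (band axis t))) => //; apply/andP; split.
  apply: le_trans h2; rewrite -mulrA mulrCA ler_wpM2l// [leLHS]mulrC ler_pM2l//.
  rewrite -[_^-1]mul1r ler_pdivlMr ?exprn_gt0 ?addr_gt0//.
  have [e1|e1] := leP 1 e; first by rewrite (le_trans _ ler01)// mulr_le0_ge0 ?subr_le0// exprn_ge0// addr_ge0// ltW.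
  apply: le_trans d3; rewrite ler_pM2l ?subr_gt0//.
  by rewrite lerXn2r// ?nnegrE ?addr_ge0 ?ltW// ltrD2l.
have -> : (1 + e) * kappa * t = kappa * ((1 + e) * t) by ring.
apply: (le_trans h1); rewrite ler_wpM2l// [leRHS]mulrC ler_pM2l//.
rewrite -[leLHS]mul1r ler_pdivrMr ?subr_gt0 ?(lt_trans td)//.
by nra.
Unshelve. all: by end_near. Qed.

End Shells.

(** * Quadratic moments of a thin equatorial band *)

Lemma integral_lincomb d (T : measurableType d) (R : realType)
    (mu : {measure set T -> \bar R}) (D : set T) (I : finType) (c : I -> R) (g : I -> T -> R) :
  measurable D -> (forall i, mu.-integrable D (EFin \o g i)) ->
  (\int[mu]_(x in D) (\sum_i c i * g i x)%:E =
   (\sum_i c i * fine (\int[mu]_(x in D) (g i x)%:E))%:E)%E.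
Proof.
move=> mD ig.
under eq_integral => x _ do rewrite -sumEFin.
rewrite (integral_sum mD (f := fun i x => (c i * g i x)%:E)); last first.
  move=> i; have := integrableZl mD (c i) (ig i).
  by apply: eq_integrable => // x _; rewrite /= EFinM.
rewrite -sumEFin; apply: eq_bigr => i _.
under eq_integral do rewrite EFinM.
rewrite (integralZl mD (ig i)) EFinM fineK//.
by apply: integrable_fin_num => //; exact: ig.
Qed.

Lemma integrable_lincomb d (T : measurableType d) (R : realType)
    (mu : {measure set T -> \bar R}) (D : set T) (I : finType) (c : I -> R) (g : I -> T -> R) :
  measurable D -> (forall i, mu.-integrable D (EFin \o g i)) ->
  mu.-integrable D (fun x => (\sum_i c i * g i x)%:E).
Proof.
move=> mD ig.
have : mu.-integrable D (fun x => (\sum_i (c i)%:E * (EFin \o g i) x)%E).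
  by apply: integrable_sum => // i _; apply: integrableZl => //; exact: ig.
by apply: eq_integrable => // x _; rewrite -sumEFin; apply: eq_bigr => i _; rewrite EFinM.
Qed.

Lemma integral_oppr d (T : measurableType d) (R : realType)
    (mu : {measure set T -> \bar R}) (D : set T) (f : T -> R) :
  measurable D -> mu.-integrable D (EFin \o f) ->
  (\int[mu]_(x in D) (- f x)%:E = (- fine (\int[mu]_(x in D) (f x)%:E))%:E)%E.
Proof.
move=> mD fi; have := @integral_lincomb _ _ _ mu D unit (fun=> -1) (fun=> f) mD (fun=> fi).
have unit1 (F : unit -> R) : \sum_i F i = F tt.
  by rewrite (bigD1 tt)//= big1 ?addr0// => -[].
rewrite unit1 mulN1r => <-.
by apply: eq_integral => x _; rewrite unit1 mulN1r.
Qed.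

Lemma ge0_integral_le_scale d (T : measurableType d) (R : realType)
    (mu : {measure set T -> \bar R}) (D : set T) (f g : T -> R) (c : R) :
  measurable D -> measurable_fun D f -> measurable_fun D g -> 0 <= c ->
  (forall x, D x -> 0 <= f x <= c * g x) -> (forall x, D x -> 0 <= g x) ->
  (\int[mu]_(x in D) (f x)%:E <= c%:E * \int[mu]_(x in D) (g x)%:E)%E.
Proof.
move=> mD mf mg c0 fg g0; rewrite -ge0_integralZl//; last exact/measurable_EFinP.
apply: ge0_le_integral => //.
- by move=> x /fg/andP[]; rewrite lee_fin.
- exact/measurable_EFinP.
- by apply/measurable_EFinP; exact: measurable_funM.
- by move=> x /fg/andP[_]; rewrite -EFinM lee_fin.
Qed.

Section QuadraticMoments.
Context {R : realType}.
Variable m : nat.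
Notation n := m.+1.
Notation T := (@sphere_type R n).
Notation sigma := (spherical n).
Notation axis := (@axis R m).
Implicit Types (u v w : 'rV[R]_n).

Definition quad (C : 'M[R]_n) (u : 'rV[R]_n) : R := dot (u *m C) u.

Lemma quadE C u : quad C u = \sum_(p : 'I_n * 'I_n) C p.1 p.2 * (u 0 p.1 * u 0 p.2).
Proof.
rewrite /quad /dot; under eq_bigr do rewrite mxE mulr_suml.
rewrite exchange_big/= pair_big/=; apply: eq_bigr => p _; ring.
Qed.

Lemma linear_growth_band :
  linear_growth sigma (@unit_sphere R n : set T) (fun u : T => dot (u : 'rV[R]_n) axis) (m%:R * omega m).
Proof. exact: band_asymptotics. Qed.

Lemma integral_axis_band (e : R) : 0 < e -> exists2 d0 : R, 0 < d0 < 1 & forall d q : R,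
  0 < d < d0 -> 0 < q < 1 -> exists2 s : R,
    (\int[sigma]_(u in band axis d) (dot (u : 'rV[R]_n) axis `^ (q - 1))%:E = s%:E)%E &
    (1 - e) * (m%:R * omega m) * d `^ q <= q * s <= (1 + e) * (m%:R * omega m) * d `^ q.
Proof.
move=> e0; have k0 : 0 <= m%:R * @omega R m by rewrite mulr_ge0// ltW// omega_gt0.
exact: (integral_shells (@Smeas_sphere R n isT) (@measurable_dotl R n isT axis)
  (@spherical_fin R n _) k0 linear_growth_band e0).
Qed.

Lemma band_reflection v w (t : R) : v != 0 ->
  (fun u => u *m reflection v) @^-1` (band w t) = band (w *m reflection v) t.
Proof.
move=> v0; apply/seteqP; split => u; rewrite /band/= /unit_sphere/= enorm_reflection//;
  by rewrite -(dot_reflection (u *m reflection v) w v0) -mulmxA reflectionK// mulmx1.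
Qed.

Lemma reflection_tr v : (reflection v : 'M[R]_n)^T = reflection v.
Proof. by rewrite /reflection raddfB/= trmx1 linearZ/= trmx_mul trmxK. Qed.

Lemma quad_reflection C v u : quad C (u *m reflection v) = quad (reflection v *m C *m reflection v) u.
Proof.
rewrite /quad !mulmxA; move: (u *m reflection v *m C) => y.
have dotE (a b : 'rV[R]_n) : dot a b = (a *m b^T) 0 0.
  by rewrite mxE; apply: eq_bigr => i _; rewrite mxE.
by rewrite !dotE trmx_mul reflection_tr mulmxA.
Qed.

Section OnBand.
Variables d q : R.
Hypotheses (d0 : 0 < d) (d1 : d <= 1) (q1 : q < 1).
Let D := band axis d.
Let s := fine (\int[sigma]_(u in D) (dot (u : 'rV[R]_n) axis `^ (q - 1))%:E)%E.
Hypothesis s_fin : (\int[sigma]_(u in D) (dot (u : 'rV[R]_n) axis `^ (q - 1))%:E = s%:E)%E.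

Definition moment_fun (i j : 'I_n) (u : T) : R :=
  dot (u : 'rV[R]_n) axis `^ (q - 1) * ((u : 'rV[R]_n) 0 i * (u : 'rV[R]_n) 0 j).

Definition moment i j : R := fine (\int[sigma]_(u in D) (moment_fun i j u)%:E)%E.

Lemma measurable_moment i j : measurable_fun setT (moment_fun i j).
Proof.
have mp : measurable_fun setT (fun u : T => dot (u : 'rV[R]_n) axis `^ (q - 1)).
  exact: (measurableT_comp (measurable_powR (q - 1)) (@measurable_dotl R n isT axis)).
apply: (measurable_funM mp).
exact: (measurable_funM (@measurable_coord R n isT i) (@measurable_coord R n isT j)).
Qed.

Lemma measurable_axis_band : measurable D.
Proof. exact: measurable_band. Qed.

Lemma integrable_pow : sigma.-integrable D (EFin \o (fun u : T => dot (u : 'rV[R]_n) axis `^ (q - 1))).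
Proof.
apply/integrableP; split.
  apply/measurable_EFinP; apply: measurable_funTS.
  exact: (measurableT_comp (measurable_powR (q - 1)) (@measurable_dotl R n isT axis)).
under eq_integral => u _ do rewrite /= ger0_norm ?powR_ge0//.
by rewrite s_fin ltry.
Qed.

Lemma integrable_moment i j : sigma.-integrable D (EFin \o moment_fun i j).
Proof.
apply: (le_integrable measurable_axis_band _ _ integrable_pow).
  by apply/measurable_EFinP; apply: measurable_funTS; exact: measurable_moment.
move=> u [Su _]; rewrite lee_fin /moment_fun normrM -[leRHS]mulr1 ler_wpM2l//.
have c1 k : `|(u : 'rV[R]_n) 0 k| <= 1 by rewrite -(Su : enorm u = 1) coord_le_enorm.
by rewrite normrM mulr_ile1.
Qed.

Lemma moment_fin i j : (\int[sigma]_(u in D) (moment_fun i j u)%:E = (moment i j)%:E)%E.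
Proof. by rewrite /moment fineK//; apply: integrable_fin_num => //; [exact: measurable_axis_band|exact: integrable_moment]. Qed.

Lemma moment_reflection v i j (f : T -> R) : v != 0 -> axis *m reflection v = axis ->
  (forall u, moment_fun i j (u *m reflection v) = f u) ->
  sigma.-integrable D (EFin \o f) ->
  (\int[sigma]_(u in D) (f u)%:E = (moment i j)%:E)%E.
Proof.
move=> v0 va fE fint; have capE := band_reflection axis d v0; rewrite va -/D in capE.
have mmom : measurable_fun (setT : set T) (EFin \o moment_fun i j).
  by apply/measurable_EFinP; exact: measurable_moment.
have h := @integral_reflection R n v D (EFin \o moment_fun i j) v0 measurable_axis_band mmom.
rewrite capE in h; rewrite -moment_fin -[RHS]h.
  by apply: eq_integral => u _; congr EFin; rewrite -fE.
by apply: eq_integrable fint => [|u _]; [exact: measurable_axis_band | rewrite /= fE].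
Qed.

(** The reflection in a coordinate hyperplane that contains the axis preserves
    the band and changes the sign of the integrand. *)
Lemma moment_offdiag i j : i != j -> moment i j = 0.
Proof.
wlog i0 : i j / i != ord0 => [hwlog ij|ij].
  have [i0|] := eqVneq i ord0; last by move=> i0; exact: hwlog.
  have -> : moment i j = moment j i.
    by congr fine; apply: eq_integral => u _; rewrite /moment_fun [X in _ * X]mulrC.
  by apply: hwlog; rewrite eq_sym// -i0.
pose v : 'rV[R]_n := delta_mx 0 i.
have vE (u : 'rV[R]_n) : dot u v = u 0 i.
  rewrite /dot (bigD1 i)//= mxE !eqxx mulr1 big1 ?addr0// => k ki.
  by rewrite mxE (negbTE ki) mulr0.
have vv : dot v v = 1 by rewrite vE mxE !eqxx.
have v0 : v != 0 by rewrite -dot_eq0 vv oner_eq0.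
have rE (u : 'rV[R]_n) k : (u *m reflection v) 0 k = if k == i then - u 0 k else u 0 k.
  rewrite reflectionE vv vE !mxE eqxx/=; case: eqVneq => [->|_]; last by rewrite mulr0 subr0.
  by have -> : true%:R = 1 :> R by []; field.
have va : axis *m reflection v = axis.
  apply/rowP => k; rewrite rE mxE/=; case: eqVneq => [->|//].
  by rewrite (negbTE i0) oppr0.
have h := @moment_reflection v i j (fun u => - moment_fun i j u) v0 va.
have : (\int[sigma]_(u in D) (- moment_fun i j u)%:E = (moment i j)%:E)%E.
  apply: h => [u|].
    rewrite /moment_fun !dot_axis !rE eqxx eq_sym (negbTE i0) (eq_sym j) (negbTE ij).
    by rewrite mulNr mulrN.
  have := integrableN (integrable_moment i j).
  by apply: eq_integrable => //; exact: measurable_axis_band.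
rewrite (integral_oppr measurable_axis_band (integrable_moment i j)) -/(moment i j) => -[]; lra.
Qed.

(** The reflection that exchanges two coordinates different from the axis
    preserves the band. *)
Lemma moment_diag i j : i != ord0 -> j != ord0 -> moment i i = moment j j.
Proof.
move=> i0 j0; have [->//|ij] := eqVneq i j.
pose v : 'rV[R]_n := delta_mx 0 i - delta_mx 0 j.
have dE k (u : 'rV[R]_n) : dot u (delta_mx 0 k) = u 0 k.
  rewrite /dot (bigD1 k)//= mxE !eqxx mulr1 big1 ?addr0// => l lk.
  by rewrite mxE (negbTE lk) mulr0.
have vE (u : 'rV[R]_n) : dot u v = u 0 i - u 0 j by rewrite dotBr !dE.
have vv : dot v v = 2.
  by rewrite vE !mxE !eqxx/= (negbTE ij) eq_sym (negbTE ij)/=; ring.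
have v0 : v != 0 by rewrite -dot_eq0 vv pnatr_eq0.
have rE (u : 'rV[R]_n) : u *m reflection v = u - (u 0 i - u 0 j) *: v.
  by rewrite reflectionE vv vE; congr (_ - _ *: _); field.
have va : axis *m reflection v = axis.
  by rewrite rE !mxE (negbTE i0) (negbTE j0) !andbF subrr scale0r subr0.
rewrite -[RHS]/(fine (moment j j)%:E) -(@moment_reflection v j j (moment_fun i i) v0 va)//.
  move=> u; rewrite /moment_fun !dot_axis rE !mxE eqxx /= !eqxx (eq_sym ord0 i) (negbTE i0).
  rewrite (eq_sym ord0 j) (negbTE j0) (eq_sym j) (negbTE ij) /=.
  by rewrite subrr mulr0 subr0 sub0r mulrN1 opprK addrCA subrr addr0.
exact: integrable_moment.
Qed.

(** The coordinates of a unit vector have squares of sum 1. *)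
Lemma moment_sum : \sum_i moment i i = s.
Proof.
have := @integral_lincomb _ _ _ sigma D 'I_n (fun=> 1) (fun i u => moment_fun i i u) measurable_axis_band
  (fun i => integrable_moment i i).
have -> : (\int[sigma]_(x in D) (\sum_i 1 * moment_fun i i x)%:E =
   \int[sigma]_(u in D) (dot (u : 'rV[R]_n) axis `^ (q - 1))%:E)%E.
  apply: eq_integral => u /set_mem[Su _]; congr EFin.
  under eq_bigr do rewrite mul1r /moment_fun.
  by rewrite -mulr_sumr (_ : \sum_i _ = dot u u)// -enorm_sqr (Su : enorm u = 1) expr1n mulr1.
rewrite s_fin => -[->]; by apply: eq_bigr => i _; rewrite mul1r.
Qed.

Lemma moment0_bounds : 0 <= moment ord0 ord0 <= d ^+ 2 * s.
Proof.
have pow_ge0 (u : T) : D u -> 0 <= dot (u : 'rV[R]_n) axis `^ (q - 1) by rewrite powR_ge0.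
have mom_le (u : T) : D u -> 0 <= moment_fun ord0 ord0 u <=
    d ^+ 2 * (dot (u : 'rV[R]_n) axis `^ (q - 1)).
  move=> [_ /andP[u0 ud]]; rewrite /moment_fun -expr2 mulr_ge0 ?powR_ge0 ?sqr_ge0//=.
  rewrite mulrC ler_wpM2r ?powR_ge0// -dot_axis.
  by rewrite ler_sqr ?nnegrE ?(ltW u0) ?(ltW d0)// ltW.
rewrite -!lee_fin -moment_fin EFinM -s_fin; apply/andP; split.
  by apply: integral_ge0 => u Du; rewrite lee_fin; case/andP: (mom_le u Du).
apply: (@ge0_integral_le_scale _ _ _ sigma D (moment_fun ord0 ord0)
  (fun u : T => dot (u : 'rV[R]_n) axis `^ (q - 1)) (d ^+ 2) measurable_axis_band _ _ _ mom_le pow_ge0).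
- by apply: measurable_funTS; exact: measurable_moment.
- by apply: measurable_funTS; exact: (measurableT_comp (measurable_powR (q - 1)) (@measurable_dotl R n isT axis)).
- by rewrite sqr_ge0.
Qed.

(** By symmetry the matrix of the moments is diagonal, with the same entry for
    all the directions orthogonal to the axis; the trace determines this entry. *)
Lemma integral_quad_axis C :
  (\int[sigma]_(u in D) (dot (u : 'rV[R]_n) axis `^ (q - 1) * quad C u)%:E =
   ((\tr C - quad C axis) * ((s - moment ord0 ord0) / m%:R) + quad C axis * moment ord0 ord0)%:E)%E.
Proof.
have -> : (\int[sigma]_(u in D) (dot (u : 'rV[R]_n) axis `^ (q - 1) * quad C u)%:E =
  \int[sigma]_(u in D) (\sum_(p : 'I_n * 'I_n) C p.1 p.2 * moment_fun p.1 p.2 u)%:E)%E.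
  apply: eq_integral => u _; congr EFin; rewrite quadE mulr_sumr.
  by apply: eq_bigr => p _; rewrite /moment_fun mulrCA.
rewrite (integral_lincomb _ measurable_axis_band (fun p => integrable_moment p.1 p.2)); congr EFin.
rewrite -(pair_big xpredT xpredT (fun i j => C i j * moment i j))/=.
have -> : quad C axis = C ord0 ord0.
  rewrite quadE (bigD1 (ord0, ord0))//= !mxE !eqxx !mulr1 big1 ?addr0// => -[i j] ij.
  rewrite !mxE/=; move: ij; rewrite xpair_eqE negb_and => /orP[|] /negbTE ->;
  by rewrite ?(mul0r, mulr0).
have -> : \sum_i \sum_j C i j * moment i j = \sum_i C i i * moment i i.
  apply: eq_bigr => i _; rewrite (bigD1 i)//= big1 ?addr0// => j ji.
  by rewrite moment_offdiag ?mulr0// eq_sym.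
have := moment_sum; rewrite /mxtrace (bigD1 ord0)//= [\sum_i C i i](bigD1 ord0)//=.
rewrite [\sum_i C i i * _](bigD1 ord0)//= => <-.
have [k k0|noi] := pickP (fun k : 'I_n => k != ord0); last first.
  by rewrite !(eq_bigl _ _ noi) !big_pred0_eq !addr0 subrr mul0r add0r.
have diagE i : i != ord0 -> moment i i = moment k k by move=> i0; exact: moment_diag.
have -> : \sum_(i < n | i != ord0) moment i i = m%:R * moment k k.
  rewrite (eq_bigr (fun=> moment k k) diagE) sumr_const mulr_natl; congr (_ *+ _).
  by rewrite cardC1 card_ord.
have -> : \sum_(i < n | i != ord0) C i i * moment i i = (\sum_(i < n | i != ord0) C i i) * moment k k.
  by rewrite mulr_suml; apply: eq_bigr => i /diagE ->.
have m0 : m%:R != 0 :> R.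
  have k_gt0 : (0 < k)%N by rewrite lt0n.
  by rewrite pnatr_eq0 -lt0n (leq_trans k_gt0)// -ltnS.
move: (moment k k) (moment ord0 ord0) => x y; move: (\sum_(_ | _) _) (C _ _) => z t.
by field.
Qed.

(** Transport of the case of the axis by the reflection that exchanges w and the
    axis. *)
Lemma integral_quad_band w C : unit_sphere w ->
  (\int[sigma]_(u in band w d) (dot (u : 'rV[R]_n) w `^ (q - 1) * quad C u)%:E =
   ((\tr C - quad C w) * ((s - moment ord0 ord0) / m%:R) + quad C w * moment ord0 ord0)%:E)%E.
Proof.
move=> Sw; have [->|wa] := eqVneq w axis; first exact: integral_quad_axis.
pose v := w - axis; have v0 : v != 0 by rewrite subr_eq0.
have ww : dot w w = 1 by rewrite -enorm_sqr (Sw : enorm w = 1) expr1n.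
have aa : dot axis axis = 1 by rewrite dot_axis mxE !eqxx.
have vv : dot v v = 2 * (1 - dot w axis).
  by rewrite dotBl !dotBr ww aa (dotC axis); ring.
have v20 : 1 - dot w axis != 0.
  by move: v0; rewrite -dot_eq0 vv mulf_eq0 pnatr_eq0.
have wv : w *m reflection v = axis.
  rewrite reflectionE vv dotBr ww (_ : 2 * _ / _ = 1) ?scale1r; last by field.
  by rewrite /v opprB addrCA subrr addr0.
have av : axis *m reflection v = w by rewrite -wv -mulmxA reflectionK// mulmx1.
pose C' := reflection v *m C *m reflection v.
have -> : \tr C = \tr C' by rewrite /C' mxtrace_mulC mulmxA reflectionK// mul1mx.
have -> : quad C w = quad C' axis by rewrite -quad_reflection av.
rewrite -integral_quad_axis.
pose f (u : T) : R := dot (u : 'rV[R]_n) w `^ (q - 1) * quad C u.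
have mf : measurable_fun setT f.
  apply: measurable_funM.
    exact: (measurableT_comp (measurable_powR (q - 1)) (@measurable_dotl R n isT w)).
  apply: measurable_sum => i; apply: (measurable_funM _ (@measurable_coord R n isT i)).
  rewrite (_ : (fun u : T => _) = (fun u : T => \sum_j (u : 'rV[R]_n) 0 j * C j i)).
    exact: (measurable_sum_mulr (@measurable_coord R n isT) (fun j => measurable_cst (C j i))).
  by apply/funext => u; rewrite mxE.
have h := @integral_reflection R n v (band w d) (EFin \o f) v0 (measurable_band w d).
rewrite band_reflection// wv in h.
have fE (u : T) : f (u *m reflection v) = dot (u : 'rV[R]_n) axis `^ (q - 1) * quad C' u.
  rewrite /f -quad_reflection; congr (_ `^ _ * _).
  by rewrite -av dot_reflection// -{2}av.
rewrite -[LHS]h.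
- by apply: eq_integral => u _; congr EFin; rewrite -fE.
- by apply/measurable_EFinP.
have := @integrable_lincomb _ _ _ sigma D _ (fun p => C' p.1 p.2)
  (fun p => moment_fun p.1 p.2) measurable_axis_band (fun p => integrable_moment p.1 p.2).
apply: eq_integrable => [|u _]; first exact: measurable_axis_band.
congr EFin; rewrite fE quadE mulr_sumr.
by apply: eq_bigr => p _; rewrite /moment_fun mulrCA.
Qed.

End OnBand.

Hypothesis m_gt0 : (0 < m)%N.

(** The component along w of a point of the band is at most d, so that its
    moment b is negligible, and the total mass is shared equally by the m other
    directions. As q tends to 0 the singular integral of a quadratic form thus
    only sees its trace on the hyperplane orthogonal to w: this is where the
    mean curvature comes from. *)
Lemma integral_quad_asymptotics (e : R) : 0 < e -> exists2 d0 : R, 0 < d0 < 1 & forall d q : R,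
  0 < d < d0 -> 0 < q < 1 -> exists a b : R,
    [/\ (1 - e) * omega m * d `^ q <= q * a <= (1 + e) * omega m * d `^ q,
        0 <= q * b <= e * d `^ q &
        forall w C, unit_sphere w ->
        (\int[sigma]_(u in band w d) (dot (u : 'rV[R]_n) w `^ (q - 1) * quad C u)%:E =
         ((\tr C - quad C w) * a + quad C w * b)%:E)%E].
Proof.
move=> e0; have w0 := @omega_gt0 R m; have m0 : 0 < m%:R :> R by rewrite ltr0n.
pose f := Num.min (e / 4) 1; have f0 : 0 < f by rewrite lt_min ltr01 andbT divr_gt0.
have f1 : f <= 1 by rewrite ge_min lexx orbT.
have fe : f <= e / 4 by rewrite ge_min lexx.
have [d1 /andP[d1_gt0 d1_lt1] H] := integral_axis_band f0.
pose kap := m%:R * @omega R m; have kap0 : 0 < kap by rewrite mulr_gt0.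
pose d2 := Num.min (e / (2 * kap)) (f / 2).
have d20 : 0 < d2 by rewrite lt_min !divr_gt0// mulr_gt0.
exists (Num.min d1 d2).
  by rewrite lt_min d1_gt0 d20/= gt_min d1_lt1.
move=> d q /andP[d0]; rewrite lt_min => /andP[dd1 dd2] /andP[q0 q1].
have dd1' : 0 < d < d1 by rewrite d0.
have q01 : 0 < q < 1 by rewrite q0.
have [s sE /andP[slo shi]] := H d q dd1' q01.
have d_le1 : d <= 1 by rewrite ltW// (lt_trans dd1).
have sE' : (\int[sigma]_(u in band axis d) (dot (u : 'rV[R]_n) axis `^ (q - 1))%:E =
  (fine (\int[sigma]_(u in band axis d) (dot (u : 'rV[R]_n) axis `^ (q - 1))%:E))%:E)%E.
  by rewrite sE.
have mb := moment0_bounds d0 sE'.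
have quadE' w C := @integral_quad_band d q sE' w C.
rewrite sE /= in mb quadE'; move: mb quadE'; set b := moment _ _ _ _ => /andP[b0 bs] quadE'.
exists ((s - b) / m%:R), b.
pose D := d `^ q; have D0 : 0 < D by rewrite powR_gt0.
rewrite -/D in slo shi *.
have dk : d ^+ 2 * kap * 2 <= e.
  have dk1 : d * (2 * kap) <= e.
    by rewrite -ler_pdivlMr ?mulr_gt0// (le_trans (ltW dd2))// ge_min lexx.
  by rewrite expr2; nra.
have qs : q * s <= 2 * kap * D.
  by apply: le_trans shi _; rewrite -/kap ler_pM2r// ler_pM2r//; lra.
have qb0 : 0 <= q * b by rewrite mulr_ge0// ltW.
have qbs : q * b <= d ^+ 2 * (q * s) by rewrite mulrCA ler_pM2l.
have d2f : d ^+ 2 <= f / 2.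
  have : d <= f / 2 by rewrite (le_trans (ltW dd2))// ge_min lexx orbT.
  by rewrite expr2; nra.
have qb : q * b <= e * D.
  apply: (le_trans qbs); apply: (@le_trans _ _ (d ^+ 2 * (2 * kap * D))).
    by rewrite ler_wpM2l// sqr_ge0.
  by rewrite (_ : d ^+ 2 * (2 * kap * D) = d ^+ 2 * kap * 2 * D) ?ler_pM2r//; ring.
have qbf : q * b <= 2 * f * kap * D.
  apply: (le_trans qbs); apply: (@le_trans _ _ (d ^+ 2 * (2 * kap * D))).
    by rewrite ler_wpM2l// sqr_ge0.
  have : 0 <= 2 * kap * D by rewrite !mulr_ge0// ltW.
  nra.
split; [|by rewrite qb0 qb|by move=> w C; exact: quadE'].
rewrite mulrA mulrBr; apply/andP; split.
  rewrite ler_pdivlMr//; apply: (@le_trans _ _ ((1 - f) * kap * D - 2 * f * kap * D)); last first.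
    by apply: lerB.
  have -> : (1 - e) * omega m * D * m%:R = (1 - e) * (kap * D) by rewrite /kap; ring.
  have -> : (1 - f) * kap * D - 2 * f * kap * D = (1 - 3 * f) * (kap * D) by ring.
  by rewrite ler_pM2r ?mulr_gt0//; lra.
rewrite ler_pdivrMr//; apply: (@le_trans _ _ ((1 + f) * kap * D)).
  by rewrite lerBlDr (le_trans shi)// lerDl.
have -> : (1 + e) * omega m * D * m%:R = (1 + e) * kap * D by rewrite /kap; ring.
by rewrite ler_pM2r// ler_pM2r//; lra.
Qed.

End QuadraticMoments.

(** * Strict differentiability and second derivatives *)

Section LineDerivatives.
Context {R : realType}.
Variable n : nat.
Implicit Types (g : 'rV[R]_n -> R^o) (x y z u v : 'rV[R]_n).

Lemma is_derive_line g x v (t : R) : derivable g (x + t *: v) v ->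
  is_derive t 1 ((fun s : R => g (x + s *: v)) : R -> R^o) ('D_v g (x + t *: v)).
Proof.
move=> dg.
have E : (fun h : R => h^-1 *: (((fun s : R => g (x + s *: v)) \o shift t) (h *: (1 : R)) -
     g (x + t *: v))) = (fun h : R => h^-1 *: ((g \o shift (x + t *: v)) (h *: v) - g (x + t *: v))).
  apply/funext => h /=; congr (_ *: (g _ - _)).
  by rewrite (_ : (h *: (1 : R) : R) = h) ?scalerDl 1?addrCA// /GRing.scale/= mulr1.
by split; [rewrite /derivable E|rewrite /derive E].
Qed.

Lemma mean_value_bound (f : R -> R^o) (df : R -> R) (a b c e : R) :
  (forall t, Num.min a b <= t <= Num.max a b -> is_derive t 1 f (df t)) ->
  (forall t, Num.min a b <= t <= Num.max a b -> `|df t - c| <= e) ->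
  `|f b - f a - c * (b - a)| <= e * `|b - a|.
Proof.
wlog ab : a b / a <= b => [hwlog|].
  case/orP: (le_total a b) => [ab|ba]; first exact: hwlog.
  rewrite minC maxC => h1 h2.
  have -> : f b - f a - c * (b - a) = - (f a - f b - c * (a - b)) by ring.
  rewrite normrN [`|b - a|]distrC; exact: hwlog.
move=> h1 h2; have itvE t : t \in `[a, b] -> Num.min a b <= t <= Num.max a b.
  by rewrite (min_idPl ab) (max_idPr ab) in_itv.
have [||t tab ->] := @MVT_segment R f df a b ab.
- by move=> t /subset_itv_oo_cc; move/itvE/h1.
- apply: derivable_within_continuous => t /itvE/h1[]//.
- by rewrite -mulrBl normrM ler_wpM2r// h2// itvE.
Qed.

Definition grad g x : 'rV[R]_n := \row_i 'D_(delta_mx 0 i) g x.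

(** Uniform in the two points, as opposed to differentiability: C^1 functions
    have this property, and it gives directly the increments between two points
    that both vary. *)
Definition strict_diff g x (c : 'rV[R]_n) := forall e : R, 0 < e ->
  \forall d \near 0^'+, forall y z, ball x d y -> ball x d z ->
    `|g y - g z - dot (y - z) c| <= e * `|y - z|.

Lemma row_norm_le (x : 'rV[R]_n) i : `|x 0 i| <= `|x|.
Proof.
rewrite [`|x|]mx_normrE; exact: (le_bigmax _ (fun p : 'I_1 * 'I_n => `|x p.1 p.2|) (0, i)).
Qed.

Lemma row_norm_leP (x : 'rV[R]_n) (c : R) : 0 <= c -> (forall i, `|x 0 i| <= c) -> `|x| <= c.
Proof.
move=> c0 xc; rewrite [`|x|]mx_normrE; apply: bigmax_le => // -[i j] _ /=.
by rewrite (ord1 i).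
Qed.

(** The increment is a sum of increments along the coordinate axes, to which the
    mean value theorem applies. *)
Lemma C1_strict_diff (U : set 'rV[R]_n) g x : open U -> U x ->
  (forall i y, U y -> derivable g y (delta_mx 0 i)) ->
  (forall i, {for x, continuous ('D_(delta_mx 0 i) g)}) ->
  strict_diff g x (grad g x).
Proof.
move=> oU Ux dg cg e e0.
pose e' := e / n.+1%:R; have e'0 : 0 < e' by rewrite divr_gt0.
have [r /= r0 rU] : exists2 r : R, 0 < r & ball x r `<=` U.
  by have /nbhs_ballP[r r0 rU] := open_nbhs_nbhs (conj oU Ux); exists r.
have cont : \forall y \near x, forall i : 'I_n, `|'D_(delta_mx 0 i) g y - grad g x 0 i| <= e'.
  have contI (i : 'I_n) : \forall y \near x, `|'D_(delta_mx 0 i) g y - grad g x 0 i| <= e'.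
    have /cvgrPdist_le/(_ _ e'0) := cg i.
    by apply: filterS => y; rewrite distrC mxE.
  exact: (@filter_forall _ _ _ _ (nbhs_filter x) contI).
have /nbhs_ballP[s /= s0 sP] := cont.
near=> d => y z xy xz.
have dr : d < r by near: d; exact: nbhs_right_lt.
have ds : d < s by near: d; exact: nbhs_right_lt.
pose p k : 'rV[R]_n := \row_i if (i < k)%N then y 0 i else z 0 i.
have p0 : p 0%N = z by apply/rowP => i; rewrite mxE.
have pn : p n = y by apply/rowP => i; rewrite mxE ltn_ord.
have step k (kn : (k < n)%N) : `|g (p k.+1) - g (p k) - (y - z) 0 (Ordinal kn) * grad g x 0 (Ordinal kn)|
    <= e' * `|y - z|.
  set i := Ordinal kn.
  pose q : 'rV[R]_n := \row_j if j == i then 0 else p k 0 j.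
  have pE (t : R) : q + t *: delta_mx 0 i = \row_j if j == i then t else p k 0 j.
    apply/rowP => j; rewrite !mxE /=; case: eqVneq => _; first by rewrite mulr1 add0r.
    by rewrite mulr0 addr0.
  have pS : p k.+1 = q + y 0 i *: delta_mx 0 i.
    rewrite pE; apply/rowP => j; rewrite !mxE; case: eqVneq => [->|ji]; first by rewrite ltnSn.
    by rewrite ltnS leq_eqVlt (_ : (j == k :> nat) = false)//; apply/negbTE.
  have pk : p k = q + z 0 i *: delta_mx 0 i.
    by rewrite pE; apply/rowP => j; rewrite !mxE; case: eqVneq => [->|//]; rewrite ltnn.
  rewrite pS pk [_ * grad g x 0 i]mulrC !mxE.
  have inb t : Num.min (z 0 i) (y 0 i) <= t <= Num.max (z 0 i) (y 0 i) ->
      ball x d (q + t *: delta_mx 0 i).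
    move=> tb; have /ball_rowP[d0 hy] := xy; have /ball_rowP[_ hz] := xz.
    rewrite pE; apply/ball_rowP; split => // j; rewrite mxE; case: eqVneq => [->|_].
      move: tb (hy i) (hz i); rewrite ge_min le_max !ltr_distlC.
      move=> /andP[/orP[h1|h1] /orP[h2|h2]] /andP[h3 h4] /andP[h5 h6]; apply/andP; split; lra.
    by rewrite mxE; case: ifP.
  apply: (le_trans (@mean_value_bound (fun t => g (q + t *: delta_mx 0 i))
    (fun t => 'D_(delta_mx 0 i) g (q + t *: delta_mx 0 i)) _ _ _ e' _ _)) => [t /inb tb|t /inb tb|].
  - by apply: is_derive_line; apply: dg; apply: rU; exact: le_ball (ltW dr) _ tb.
  - have /(_ i) := sP _ (le_ball (ltW ds) tb); by rewrite mxE.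
  - rewrite ler_wpM2l ?(ltW e'0)//; have := row_norm_le (y - z) i; by rewrite !mxE.
have main k : (k <= n)%N -> `|g (p k) - g (p 0%N) - \sum_(i < n | (i < k)%N) (y - z) 0 i * grad g x 0 i| <=
    k%:R * e' * `|y - z|.
  elim: k => [_|k IH kn]; first by rewrite big_pred0// !subrr normr0 !mul0r.
  have -> : \sum_(i < n | (i < k.+1)%N) (y - z) 0 i * grad g x 0 i =
      (y - z) 0 (Ordinal kn) * grad g x 0 (Ordinal kn) +
      \sum_(i < n | (i < k)%N) (y - z) 0 i * grad g x 0 i.
    rewrite (bigD1 (Ordinal kn))//=; congr (_ + _); apply: eq_bigl => i.
    by rewrite -(inj_eq val_inj)/= [RHS]ltn_neqAle ltnS andbC.
  have -> : g (p k.+1) - g (p 0%N) - ((y - z) 0 (Ordinal kn) * grad g x 0 (Ordinal kn) +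
      \sum_(i < n | (i < k)%N) (y - z) 0 i * grad g x 0 i) =
    (g (p k.+1) - g (p k) - (y - z) 0 (Ordinal kn) * grad g x 0 (Ordinal kn)) +
    (g (p k) - g (p 0%N) - \sum_(i < n | (i < k)%N) (y - z) 0 i * grad g x 0 i) by ring.
  rewrite -natr1 !mulrDl mul1r addrC (le_trans (ler_normD _ _))// lerD//.
  exact/IH/ltnW.
have := main n (leqnn n); rewrite p0 pn.
have -> : \sum_(i < n | (i < n)%N) (y - z) 0 i * grad g x 0 i = dot (y - z) (grad g x).
  by apply: eq_bigl => i; rewrite ltn_ord.
move=> /le_trans; apply; rewrite ler_wpM2r//.
by rewrite /e' mulrCA ger_pMr// ler_pdivrMr// mul1r ler_nat.
Unshelve. all: by end_near. Qed.

Lemma strict_diff_line g x u (t : R) c : strict_diff g (x + t *: u) c ->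
  is_derive t 1 ((fun s : R => g (x + s *: u)) : R -> R^o) (dot u c).
Proof.
move=> sg.
have cv : h^-1 *: (((fun s : R => g (x + s *: u)) \o shift t) (h *: (1 : R)) - g (x + t *: u)) @[h --> 0^']
   --> (dot u c : R^o).
  apply/cvgrPdist_le => e e0; pose M := 1 + `|u|.
  have M0 : 0 < M by rewrite ltr_pwDl.
  have := sg _ (divr_gt0 e0 M0) => H.
  near (0 : R)^'+ => d.
  have d0 : 0 < d by near: d; exact: nbhs_right_gt.
  have Hd : forall y z, ball (x + t *: u) d y -> ball (x + t *: u) d z ->
    `|g y - g z - dot (y - z) c| <= e / M * `|y - z| by near: d.
  near=> h; have h0 : h != 0 by near: h; exact: nbhs_dnbhs_neq.
  have hd : `|h| < d / M.
    near: h; apply: dnbhs0_lt; exact: divr_gt0.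
  have -> : (h *: (1 : R) : R) = h by rewrite /GRing.scale/= mulr1.
  rewrite /=; have E : x + (h + t) *: u - (x + t *: u) = h *: u.
    by rewrite opprD addrACA subrr add0r scalerDl addrK.
  have := Hd (x + (h + t) *: u) (x + t *: u); rewrite E dotZl => /(_ _ _).
  have b0 : ball (x + t *: u) d (x + t *: u) by exact: ballxx.
  have b1 : ball (x + t *: u) d (x + (h + t) *: u).
    rewrite -ball_normE /= distrC E normrZ.
    apply: (@le_lt_trans _ _ (`|h| * M)); first by rewrite ler_wpM2l// lerDr.
    by rewrite -ltr_pdivlMr.
  move=> /(_ b1 b0); rewrite normrZ => HH.
  rewrite distrC /GRing.scale/=.
  have -> : h^-1 * (g (x + (h + t) *: u) - g (x + t *: u)) - dot u c =
     h^-1 * (g (x + (h + t) *: u) - g (x + t *: u) - h * dot u c) by field.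
  rewrite normrM normfV ler_pdivrMl ?normr_gt0// (le_trans HH)//.
  rewrite mulrCA [leRHS]mulrC [leRHS]mulrC ler_wpM2l//.
  by rewrite mulrAC ler_pdivrMr// ler_wpM2l ?(ltW e0)// lerDr.
split; first by apply/cvg_ex; exists (dot u c).
exact: cvg_lim cv.
Unshelve. all: by end_near. Qed.

Lemma taylor2_lower (f f1 f2 : R -> R) (b r : R) : 0 <= r ->
  (forall t, 0 <= t <= r -> is_derive t 1 (f : R -> R^o) (f1 t)) ->
  (forall t, 0 <= t <= r -> is_derive t 1 (f1 : R -> R^o) (f2 t)) ->
  (forall t, 0 <= t <= r -> b <= f2 t) ->
  f1 0 + b * r <= f1 r /\ f 0 + r * f1 0 + b * r ^+ 2 / 2 <= f r.
Proof.
move=> r0 df df1 bf2.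
have main t : 0 <= t <= r -> f1 0 + b * t <= f1 t.
  move=> /andP[t0 tr].
  have [||s + E] := @MVT_segment R f1 f2 0 t t0.
  - by move=> s; rewrite in_itv/= => /andP[s0 st]; apply: df1; rewrite ltW//= ltW// (lt_le_trans st).
  - by apply: derivable_within_continuous => s; rewrite in_itv/= => /andP[s0 st]; have [] := df1 s _; rewrite // s0 (le_trans st).
  - rewrite in_itv/= => /andP[s0 st]; rewrite -lerBrDl E subr0 ler_wpM2r// bf2// s0 (le_trans st)//.
split; first by apply: main; rewrite r0 lexx.
pose p (t : R) := f t - b / 2 * t ^+ 2.
have dp t : 0 <= t <= r -> is_derive t 1 (p : R -> R^o) (f1 t - b * t).
  move=> tr; have h2 := is_deriveZ (b / 2) (@is_deriveX R _ id 2 t 1 1 (is_derive_id _ _)).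
  have := is_deriveB (df t tr) h2.
  rewrite (_ : _ - _ = p); last by apply/funext => y; rewrite /p !fctE.
  move=> /is_derive_eq; apply; rewrite /= /GRing.scale/=; by field.
have [||s + E] := @MVT_segment R p (fun t => f1 t - b * t) 0 r r0.
- by move=> s; rewrite in_itv/= => /andP[s0 sr]; apply: dp; rewrite !ltW.
- by apply: derivable_within_continuous => s; rewrite in_itv/= => sr; have [] := dp s sr.
rewrite in_itv/= => sr; move: E; rewrite /p subr0 expr0n/= mulr0 subr0 => E.
have := main s sr; have := ler_wpM2r r0 (lexx (f1 0)); nra.
Qed.

(** The mixed second difference is the increment of a difference of values of g
    at two points that move in the direction i. *)
Lemma schwarz_mixed_difference (U : set 'rV[R]_n) g x i j (e : R) : open U -> U x -> 0 < e ->
  (forall y, U y -> derivable g y (delta_mx 0 i)) ->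
  strict_diff ('D_(delta_mx 0 i) g) x (grad ('D_(delta_mx 0 i) g) x) ->
  \forall s \near 0^'+,
    `|g (x + s *: delta_mx 0 j + s *: delta_mx 0 i) - g (x + s *: delta_mx 0 i)
      - g (x + s *: delta_mx 0 j) + g x - s ^+ 2 * grad ('D_(delta_mx 0 i) g) x 0 j| <= e * s ^+ 2.
Proof.
move=> oU Ux e0 dg sG.
have [r /= r0 rU] : exists2 r : R, 0 < r & ball x r `<=` U.
  by have /nbhs_ballP[r r0 rU] := open_nbhs_nbhs (conj oU Ux); exists r.
have H := sG e e0.
near (0 : R)^'+ => d.
have d0 : 0 < d by near: d; exact: nbhs_right_gt.
have dr : d < r by near: d; exact: nbhs_right_lt.
have Hd : forall y z, ball x d y -> ball x d z ->
    `|'D_(delta_mx 0 i) g y - 'D_(delta_mx 0 i) g z - dot (y - z) (grad ('D_(delta_mx 0 i) g) x)|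
    <= e * `|y - z| by near: d.
near=> s.
have s0 : 0 < s by near: s; exact: nbhs_right_gt.
have sd : s < d / 2 by near: s; apply: nbhs_right_lt; rewrite divr_gt0.
have nd k : `|delta_mx 0 k : 'rV[R]_n| <= 1.
  by apply: row_norm_leP => // l; rewrite mxE/= ger0_norm ?ler0n// lern1 leq_b1.
have inb (a b : R) : 0 <= a <= s -> 0 <= b <= s ->
    ball x d (x + a *: delta_mx 0 j + b *: delta_mx 0 i).
  move=> /andP[a0 as_] /andP[b0 bs]; rewrite -ball_normE /= -addrA opprD addrA subrr add0r normrN.
  apply: (le_lt_trans (ler_normD _ _)); rewrite !normrZ !ger0_norm//.
  apply: (@le_lt_trans _ _ (s + s)); last by lra.
  by apply: lerD; rewrite -[leRHS]mulr1 ler_pM.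
pose psi (t : R) := g (x + s *: delta_mx 0 j + t *: delta_mx 0 i) - g (x + t *: delta_mx 0 i).
pose G := 'D_(delta_mx 0 i) g.
pose dpsi (t : R) := G (x + s *: delta_mx 0 j + t *: delta_mx 0 i) - G (x + t *: delta_mx 0 i).
have s_in : 0 <= s <= s by rewrite lexx ltW.
have z_in : 0 <= (0 : R) <= s by rewrite lexx ltW.
have inb0 t : 0 <= t <= s -> ball x d (x + t *: delta_mx 0 i).
  by move=> /(inb 0 t z_in); rewrite scale0r addr0.
have itvE t : Num.min 0 s <= t <= Num.max 0 s -> 0 <= t <= s.
  by rewrite (min_idPl (ltW s0)) (max_idPr (ltW s0)).
have := @mean_value_bound psi dpsi 0 s (s * grad G x 0 j) (e * s) _ _.
rewrite subr0 (ger0_norm (ltW s0)).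
have -> : psi s - psi 0 - s * grad G x 0 j * s =
  g (x + s *: delta_mx 0 j + s *: delta_mx 0 i) - g (x + s *: delta_mx 0 i)
      - g (x + s *: delta_mx 0 j) + g x - s ^+ 2 * grad G x 0 j.
  by rewrite /psi !scale0r !addr0; ring.
rewrite (_ : e * s * s = e * s ^+ 2); last by ring.
apply => t /itvE tin.
  have Uin k : 0 <= k <= s -> U (x + k *: delta_mx 0 j + t *: delta_mx 0 i).
    by move=> hk; apply/rU/(le_ball (ltW dr))/inb.
  apply: is_deriveB; apply: is_derive_line; apply: dg; first exact: Uin.
  by have := Uin 0 z_in; rewrite scale0r addr0.
have := Hd _ _ (inb s t s_in tin) (inb0 t tin).
have -> : x + s *: delta_mx 0 j + t *: delta_mx 0 i - (x + t *: delta_mx 0 i) = s *: delta_mx 0 j.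
  by rewrite opprD addrACA subrr addr0 addrC addKr.
have -> : dot (s *: delta_mx 0 j) (grad G x) = s * grad G x 0 j.
  rewrite dotZl; congr (_ * _); rewrite /dot (bigD1 j)//= mxE !eqxx mul1r big1 ?addr0// => k kj.
  by rewrite mxE (negbTE kj) mul0r.
move=> /le_trans; apply; rewrite ler_pM2l// normrZ gtr0_norm// ger_pMr//.
Unshelve. all: by end_near. Qed.

Lemma mixed_difference_dist (p p1 p2 p3 a b s e : R) : 0 < s ->
  `|p - p1 - p2 + p3 - s ^+ 2 * a| <= e / 2 * s ^+ 2 ->
  `|p - p2 - p1 + p3 - s ^+ 2 * b| <= e / 2 * s ^+ 2 -> `|a - b| <= e.
Proof.
move=> s0 h1 h2; have s2 : 0 < s ^+ 2 by rewrite exprn_gt0.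
rewrite -(ler_pM2l s2) -{1}(gtr0_norm s2) -normrM.
have -> : s ^+ 2 * (a - b) = (p - p2 - p1 + p3 - s ^+ 2 * b) - (p - p1 - p2 + p3 - s ^+ 2 * a) by ring.
by apply: (le_trans (ler_normB _ _)); lra.
Qed.

(** The mixed second difference is symmetric in the two directions. *)
Lemma schwarz_symmetric (U : set 'rV[R]_n) g x i j : open U -> U x ->
  (forall k y, U y -> derivable g y (delta_mx 0 k)) ->
  (forall k, strict_diff ('D_(delta_mx 0 k) g) x (grad ('D_(delta_mx 0 k) g) x)) ->
  grad ('D_(delta_mx 0 i) g) x 0 j = grad ('D_(delta_mx 0 j) g) x 0 i.
Proof.
move=> oU Ux dg sG.
have main (e : R) : 0 < e -> `|grad ('D_(delta_mx 0 i) g) x 0 j - grad ('D_(delta_mx 0 j) g) x 0 i| <= e.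
  move=> e0; have e20 : 0 < e / 2 by rewrite divr_gt0.
  have Hi := @schwarz_mixed_difference U g x i j (e / 2) oU Ux e20 (dg i) (sG i).
  have Hj := @schwarz_mixed_difference U g x j i (e / 2) oU Ux e20 (dg j) (sG j).
  have [s [[/= s0 hi] hj]] := filter_ex (filterI (filterI (nbhs_right_gt (0 : R)) Hi) Hj).
  rewrite [X in g X]addrAC in hj.
  exact: mixed_difference_dist s0 hi hj.
by apply/eqP; rewrite -subr_eq0 -normr_le0; apply/ler_addgt0Pr => e /main; rewrite add0r.
Qed.

End LineDerivatives.

(** * Corank and characteristic polynomial *)

Section CharPolyRank.
Variable F : fieldType.

(** Multiplying the characteristic matrix by the invertible constant matrix of
    the Gaussian elimination of A turns all but \rank A of its rows into
    multiples of the indeterminate. *)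
Lemma dvdp_char_poly_corank n (A : 'M[F]_n) : 'X^(n - \rank A) %| char_poly A.
Proof.
pose L := invmx (col_ebase A); set r := \rank A.
have uL : L \in unitmx by rewrite unitmx_inv col_ebase_unit.
have LA : L *m A = pid_mx r *m row_ebase A.
  by rewrite -{1}[A]mulmx_ebase /L !mulmxA mulVmx ?col_ebase_unit// mul1mx.
pose d : 'rV[{poly F}]_n := \row_i if (i < r)%N then 1 else 'X.
pose D : 'M[{poly F}]_n := \matrix_(i, j)
  if (i < r)%N then (map_mx polyC L *m char_poly_mx A) i j else (L i j)%:P.
have fac : map_mx polyC L *m char_poly_mx A = diag_mx d *m D.
  apply/matrixP => i j; rewrite mul_diag_mx [RHS]mxE [d 0 i]mxE [D i j]mxE; case: ifPn => ir.
    by rewrite mul1r.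
  have -> : map_mx polyC L *m char_poly_mx A =
      'X *: map_mx polyC L - map_mx polyC (pid_mx r *m row_ebase A).
    by rewrite /char_poly_mx mulmxBr mul_mx_scalar -map_mxM LA.
  have e0 : (pid_mx r *m row_ebase A) i j = 0.
    rewrite mxE big1// => k _; rewrite mxE; have -> : ((i : nat) < r)%N = false by exact: negbTE.
    by rewrite andbF mul0r.
  have subE (B C : 'M[{poly F}]_n) : (B - C) i j = B i j - C i j by rewrite !mxE.
  have scE (c : {poly F}) (B : 'M[{poly F}]_n) : (c *: B) i j = c * B i j by rewrite mxE.
  have mapE (B : 'M[F]_n) : map_mx (polyC : F -> {poly F}) B i j = (B i j)%:P by rewrite mxE.
  by rewrite subE scE !mapE e0 polyC0 subr0.
have dd : \det (diag_mx d) = 'X^(n - r).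
  rewrite det_diag (bigID (fun i : 'I_n => (i < r)%N))/= big1 ?mul1r => [|i ir]; last first.
    by rewrite mxE ir.
  rewrite (eq_bigr (fun=> 'X)) => [|i ir]; last by rewrite mxE (negbTE ir).
  rewrite prodr_const; congr (_ ^+ _).
  have -> : #|[pred i : 'I_n | ~~ (i < r)%N]| = (n - #|[pred i : 'I_n | (i < r)%N]|)%N.
    have := cardC [pred i : 'I_n | (i < r)%N]; rewrite card_ord => E.
    by rewrite -[X in (X - _)%N]E addKn; apply: eq_card.
  have E : (\sum_(i < n | (i < r)%N) 1 = r)%N.
    by rewrite -(big_ord_widen n (fun=> 1%N)) ?rank_leq_row// sum1_card card_ord.
  by rewrite -sum1_card -[in RHS]E.
have := congr1 determinant fac; rewrite !det_mulmx dd det_map_mx/= => E.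
have dL : \det L != 0 by rewrite -unitfE -unitmxE.
by rewrite -(dvdpZr _ _ dL) -mul_polyC E dvdp_mulr.
Qed.

Lemma two_null_vectors_char_poly n (A : 'M[F]_n) (u v : 'rV[F]_n) :
  u *m A = 0 -> v *m A = 0 -> (forall c, v != c *: u) -> u != 0 -> 'X^2 %| char_poly A.
Proof.
move=> uA vA vu u0; apply: dvdp_trans (dvdp_char_poly_corank A).
apply: dvdp_exp2l; rewrite -mxrank_ker.
have <- : \rank (col_mx u v) = 2%N.
  apply/eqP; rewrite -[_ == _]/(row_free (col_mx u v)) -kermx_eq0.
  apply/rowV0P => w; rewrite -[w]hsubmxK; move/sub_kermxP; rewrite mul_row_col.
  set a := lsubmx w; set b := rsubmx w; rewrite [a]mx11_scalar [b]mx11_scalar !mul_scalar_mx => E.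
  have b0 : b 0 0 = 0.
    apply/eqP; apply: contraT => b0; have := vu (- (a 0 0 / b 0 0)).
    rewrite scaleNr mulrC -scalerA; move/eqP: E; rewrite addr_eq0 => /eqP ->.
    by rewrite scalerN opprK scalerA mulVf// scale1r eqxx.
  move: E; rewrite b0 scale0r addr0 => /eqP; rewrite scaler_eq0 (negbTE u0) orbF => /eqP ->.
  have -> : 0%:M = 0 :> 'M[F]_1 by apply/matrixP => i j; rewrite !mxE mul0rn.
  by rewrite row_mx0.
apply: mxrankS; rewrite col_mx_sub; apply/andP; split; exact/sub_kermxP.
Qed.

End CharPolyRank.

(** * Segments and radial functions of convex bodies *)

Section ConvexBodyBasics.
Context {R : realType}.
Variable n : nat.
Implicit Types (K : set 'rV[R]_n) (x y z u v : 'rV[R]_n).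

Lemma dot_le_norm x y : `|dot x y| <= n%:R * (`|x| * `|y|).
Proof.
rewrite (le_trans (ler_norm_sum _ _ _))// -[n in n%:R]card_ord mulr_natl -sumr_const.
by apply: ler_sum => i _; rewrite normrM ler_pM// row_norm_le.
Qed.

Lemma row_norm_le_enorm x : `|x| <= enorm x.
Proof. by apply: row_norm_leP (enorm_ge0 _) _ => i; exact: coord_le_enorm. Qed.

Lemma convex_setP K x y (t : R) : convex_set (K : set (convex_lmodType 'rV[R]_n)) ->
  K x -> K y -> 0 <= t <= 1 -> K (x + t *: (y - x)).
Proof.
move=> cK Kx Ky /andP[t0 t1].
have := cK y x (Itv01 t0 t1); rewrite !inE => /(_ Ky Kx).
rewrite /conv/=.
have -> : x + t *: (y - x) = t *: y + (1 - t) *: x.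
  by apply/rowP => i; rewrite !mxE; ring.
by [].
Qed.

Lemma closure_pointP (A : set 'rV[R]_n) x : (forall e : R, 0 < e -> exists2 y, A y & `|x - y| < e) -> closure A x.
Proof.
move=> h B /nbhs_ballP[e /= e0 eB]; have [y Ay xy] := h e e0; exists y; split => //.
by apply: eB; rewrite -ball_normE.
Qed.

(** The boundary point is the last point of the segment in K. *)
Lemma segment_bdry K a v : closed K -> K a -> ~ K (a + v) ->
  exists t : R, [/\ 0 <= t <= 1, bdry K (a + t *: v) &
    forall t', t' <= 1 -> K (a + t' *: v) -> t' <= t].
Proof.
move=> cK Ka Kb; pose A := [set t : R | 0 <= t <= 1 /\ K (a + t *: v)].
have A0 : A 0 by split; [rewrite lexx ler01|rewrite scale0r addr0].
have ubA : has_ubound A by exists 1 => t [/andP[]].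
have sA : has_sup A by split => //; exists 0.
pose s := sup A; have s0 : 0 <= s by exact: ub_le_sup.
have s1 : s <= 1 by apply: ge_sup; [exists 0|move=> t [/andP[]]].
have sub t' : t' <= 1 -> K (a + t' *: v) -> t' <= s.
  move=> t'1 Kt'; have [t'0|t'0] := leP 0 t'; last exact: le_trans (ltW t'0) s0.
  by apply: ub_le_sup => //; split => //; rewrite t'0.
exists s; split=> //; first by rewrite s0.
pose M := 1 + `|v|; have M0 : 0 < M by rewrite ltr_pwDl.
have clK : closure K (a + s *: v).
  apply: closure_pointP => e e0.
  have [t At st] := sup_adherent (divr_gt0 e0 M0) sA.
  exists (a + t *: v); first by case: At.
  have ts : t <= s by exact: ub_le_sup.
  rewrite opprD addrACA subrr add0r -scalerBl normrZ ger0_norm ?subr_ge0//.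
  apply: (@le_lt_trans _ _ ((s - t) * M)); first by rewrite ler_wpM2l ?subr_ge0// lerDr.
  by rewrite -ltr_pdivlMr//; rewrite /s in st *; lra.
have Ks : K (a + s *: v) by exact: cK.
split => // /nbhs_ballP[e /= e0 eK].
have s1' : s < 1 by rewrite lt_neqAle s1 andbT; apply: contra_notN Kb => /eqP s1'; rewrite -[v]scale1r -s1'.
pose h := Num.min (1 - s) (e / 2 / M).
have h0 : 0 < h by rewrite lt_min subr_gt0 s1' !divr_gt0.
suff : A (s + h) by move=> /(ub_le_sup ubA); rewrite -/s; lra.
split; first by rewrite addr_ge0 ?(ltW h0)//= -lerBrDl ge_min lexx.
apply: eK; rewrite -ball_normE /= opprD addrACA subrr add0r -scalerBl opprD addrA subrr add0r.
rewrite normrZ normrN (gtr0_norm h0); apply: (@le_lt_trans _ _ (h * M)).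
  by rewrite ler_wpM2l ?(ltW h0)// lerDr.
by rewrite -ltr_pdivlMr// (@le_lt_trans _ _ (e / 2 / M))// ?ge_min ?lexx ?orbT// ltr_pM2r ?invr_gt0//; lra.
Qed.

Section Radial.
Variables (K : set 'rV[R]_n) (z u : 'rV[R]_n).
Hypotheses (cK : compact K) (Kz : K z) (u0 : u != 0).
Let A := [set t : R | K (z + t *: u)].

Lemma radial_has_sup : has_sup A.
Proof.
split; first by exists 0; rewrite /A/= scale0r addr0.
have [M [_ HM]] := compact_bounded cK; have {}HM := HM (`|M| + 1).
exists ((`|M| + 1 + `|z|) / `|u|) => t /= Kt; rewrite ler_pdivlMr ?normr_gt0//.
have tn : t * `|u| <= `|t *: u| by rewrite normrZ ler_wpM2r// ler_norm.
apply: (le_trans tn).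
have -> : t *: u = (z + t *: u) - z by rewrite addrC addKr.
rewrite (le_trans (ler_normB _ _))// lerD2r; apply: HM => //.
by rewrite (le_lt_trans (ler_norm M))// ltrDl.
Qed.

Lemma radial_ub t : K (z + t *: u) -> t <= radial K z u.
Proof. by move=> Kt; apply: ub_le_sup => //; have [] := radial_has_sup. Qed.

Lemma radial_ge0 : 0 <= radial K z u.
Proof. by apply: radial_ub; rewrite scale0r addr0. Qed.

Lemma closedK : closed K.
Proof. by apply: compact_closed => //; exact: norm_hausdorff. Qed.

Lemma radial_bdry : bdry K (z + radial K z u *: u).
Proof.
pose s := radial K z u.
have Kn : ~ K (z + (s + 1) *: u) by move=> /radial_ub; rewrite -/s; lra.
have s0 : 0 <= s by exact: radial_ge0.
have s1 : 0 < s + 1 by lra.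
have [t [/andP[t0 t1] bt tmax]] := segment_bdry closedK Kz Kn.
rewrite scalerA in bt.
suff -> : radial K z u = t * (s + 1) by [].
apply/eqP; rewrite eq_le; apply/andP; split; last first.
  by apply: radial_ub; have [/closedK] := bt.
apply: ge_sup => [|r /= Kr]; first by case: radial_has_sup.
rewrite -ler_pdivrMr//; apply: tmax; last by rewrite scalerA divfK ?lt0r_neq0.
by rewrite ler_pdivrMr// mul1r (le_trans (radial_ub Kr))// lerDl.
Qed.

End Radial.
End ConvexBodyBasics.

(** * Zero sets of smooth functions and outer normals *)

Section NormHelpers.
Context {R : realType}.
Variable n : nat.
Implicit Types (K U : set 'rV[R]_n) (x y z u v w : 'rV[R]_n).

Lemma near_norm_ball x (P : set 'rV[R]_n) : (\forall y \near x, P y) ->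
  exists2 r : R, 0 < r & forall y, `|y - x| < r -> P y.
Proof.
move=> /nbhs_ballP[r /= r0 rP]; exists r => // y xy; apply: rP.
by rewrite -ball_normE /= distrC.
Qed.

Lemma open_norm U x : open U -> U x -> exists2 r : R, 0 < r & forall y, `|y - x| < r -> U y.
Proof. by move=> oU Ux; apply: near_norm_ball; exact: open_nbhs_nbhs. Qed.

Lemma strict_diff_norm (g : 'rV[R]_n -> R^o) x c : strict_diff g x c -> forall e : R, 0 < e ->
  exists2 d : R, 0 < d & forall y z, `|y - x| < d -> `|z - x| < d ->
    `|g y - g z - dot (y - z) c| <= e * `|y - z|.
Proof.
move=> sg e e0; have [d [d0 Hd]] := filter_ex (filterI (nbhs_right_gt (0 : R)) (sg e e0)).
by exists d => // y z yd zd; apply: Hd; rewrite -ball_normE /= distrC.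
Qed.

Lemma strict_diffZ (g : 'rV[R]_n -> R^o) x c (k : R) : strict_diff g x c ->
  strict_diff (fun y => k * g y : R^o) x (k *: c).
Proof.
move=> sg e e0; have M0 : 0 < 1 + `|k| by rewrite ltr_pwDl.
apply: filterS (sg _ (divr_gt0 e0 M0)) => d Hd y z xy xz.
have -> : k * g y - k * g z - dot (y - z) (k *: c) = k * (g y - g z - dot (y - z) c).
  by rewrite dotZr; ring.
rewrite normrM (le_trans (ler_wpM2l (normr_ge0 k) (Hd y z xy xz)))//.
rewrite mulrA ler_wpM2r// mulrCA ger_pMr// ler_pdivrMr// mul1r.
by rewrite lerDr.
Qed.

Lemma mulmx_norm_le (w : 'rV[R]_n) (A : 'M[R]_n) : `|w *m A| <= n%:R * (`|w| * `|A|).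
Proof.
apply: row_norm_leP => [|i]; first by rewrite !mulr_ge0.
rewrite mxE (le_trans (ler_norm_sum _ _ _))// -[n in n%:R]card_ord mulr_natl -sumr_const.
apply: ler_sum => j _; rewrite normrM ler_pM// ?row_norm_le//.
rewrite [leRHS]mx_normrE; exact: (le_bigmax _ (fun p : 'I_n * 'I_n => `|A p.1 p.2|) (j, i)).
Qed.

Lemma strict_diff_line_zero (g : 'rV[R]_n -> R^o) (G : 'rV[R]_n -> 'rV[R]_n) p v (a b : R) :
  (forall s, a <= s <= b -> strict_diff g (p + s *: v) (G (p + s *: v))) ->
  a <= b -> g (p + a *: v) <= 0 -> 0 <= g (p + b *: v) ->
  exists2 s, a <= s <= b & g (p + s *: v) = 0.
Proof.
move=> sg ab ga gb.
have := @IVT R (fun s => g (p + s *: v)) a b 0 ab.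
case.
- apply: derivable_within_continuous => s; rewrite in_itv => /= /sg sgs.
  by have [] := strict_diff_line sgs.
- by rewrite ge_min ga le_max gb orbT.
- by move=> c; rewrite in_itv => /= cab <-; exists c.
Qed.

(** Moving in the direction w does not change g to first order, while a move of
    eta * t along the gradient gives g the sign of the move: there is a zero in
    between. *)
Lemma tangent_zero U (g : 'rV[R]_n -> R^o) (G : 'rV[R]_n -> 'rV[R]_n) x w (eta : R) : open U -> U x ->
  (forall y, U y -> strict_diff g y (G y)) -> G x != 0 -> dot w (G x) = 0 -> g x = 0 -> 0 < eta ->
  exists2 t0 : R, 0 < t0 & forall t, 0 < t < t0 -> exists s,
    [/\ `|s| <= eta * t, U (x + t *: w + s *: G x) & g (x + t *: w + s *: G x) = 0].
Proof.
move=> oU Ux sg G0 wG gx eta0.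
have [r r0 rU] := open_norm oU Ux.
have GG : 0 < dot (G x) (G x) by rewrite dot_gt0.
pose L := 1 + `|w| + eta * `|G x|.
have L0 : 0 < L by rewrite /L -addrA ltr_pwDl// addr_ge0// mulr_ge0// ltW.
have e0 : 0 < eta * dot (G x) (G x) / L by rewrite !(divr_gt0, mulr_gt0).
have [d d0 Hd] := strict_diff_norm (sg x Ux) e0.
exists (Num.min d r / L); first by rewrite divr_gt0// lt_min d0.
move=> t /andP[t0]; rewrite ltr_pdivlMr// lt_min => /andP[td tr].
have hn s : `|s| <= eta * t -> `|x + t *: w + s *: G x - x| <= t * L.
  move=> st; rewrite addrAC -[x + _ - x]addrA [x + _]addrC subrK.
  rewrite (le_trans (ler_normD _ _))// !normrZ (gtr0_norm t0).
  have h1 : `|s| * `|G x| <= eta * t * `|G x| by rewrite ler_wpM2r.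
  have h2 : `|w| <= 1 + `|w| by rewrite lerDr.
  have h3 := ler_wpM2l (ltW t0) h2; rewrite /L; move: h1 h3; move: `|s| `|G x| `|w| => p q l; lra.
have near s : `|s| <= eta * t -> U (x + t *: w + s *: G x).
  by move=> st; apply: rU; exact: le_lt_trans (hn _ st) _.
have est s : `|s| <= eta * t -> `|g (x + t *: w + s *: G x) - s * dot (G x) (G x)| <=
    eta * dot (G x) (G x) * t.
  move=> st; have := Hd (x + t *: w + s *: G x) x.
  rewrite gx subr0 subrr normr0 => /(_ (le_lt_trans (hn _ st) td) d0).
  have E : dot (x + t *: w + s *: G x - x) (G x) = s * dot (G x) (G x).
    by rewrite addrAC -[x + _ - x]addrA [x + _]addrC subrK dotDl !dotZl wG mulr0 add0r.
  rewrite E => /le_trans; apply; apply: (le_trans (ler_wpM2l (ltW e0) (hn _ st))).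
  by rewrite [t * L]mulrC mulrA divfK ?lt0r_neq0.
have a0 : 0 <= eta * t by rewrite mulr_ge0 ?ltW.
have [||||s sab gs] := @strict_diff_line_zero g G (x + t *: w) (G x) (- (eta * t)) (eta * t).
- by move=> s; rewrite -ler_norml => st; apply: sg; exact: near.
- by rewrite ge0_cp.
- have := est (- (eta * t)); rewrite normrN ger0_norm// => /(_ (lexx _)).
  by rewrite ler_norml => /andP[_]; move: (g _) => a; lra.
- have := est (eta * t); rewrite ger0_norm// => /(_ (lexx _)).
  by rewrite ler_norml => /andP[+ _]; move: (g _) => a; lra.
by exists s; split => //; [rewrite ler_norml|apply: near; rewrite ler_norml].
Qed.

(** Otherwise the part w of the normal that is orthogonal to the gradient would
    give boundary points z + t * w + o(t), beyond the supporting hyperplane. *)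
Lemma outer_normal_parallel K U (g : 'rV[R]_n -> R^o) (G : 'rV[R]_n -> 'rV[R]_n) z nu : closed K ->
  open U -> U z -> bdry K z ->
  (forall y, U y -> strict_diff g y (G y)) -> (forall y, U y -> (bdry K y <-> g y = 0)) ->
  G z != 0 -> outer_normal K z nu -> G z = dot (G z) nu *: nu.
Proof.
move=> cK oU Uz bz sg bg G0 [nu1 Knu].
have GG : 0 < dot (G z) (G z) by rewrite dot_gt0.
have nunu : dot nu nu = 1 by rewrite -enorm_sqr (nu1 : enorm nu = 1) expr1n.
pose k := dot nu (G z) / dot (G z) (G z); pose w := nu - k *: G z.
have wG : dot w (G z) = 0 by rewrite dotBl dotZl divfK ?lt0r_neq0// subrr.
have ww : dot w w = dot w nu by rewrite {2}/w dotBr dotZr wG mulr0 subr0.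
have w0 : w = 0.
  apply/eqP; apply: contraT => w0; have wp : 0 < dot w nu by rewrite -ww dot_gt0.
  pose M := 1 + `|dot (G z) nu|; have M0 : 0 < M by rewrite ltr_pwDl.
  have [t0 t00 Ht] := tangent_zero oU Uz sg G0 wG (proj1 (bg z Uz) bz) (divr_gt0 wp M0).
  have [|s [st Us gs]] := Ht (t0 / 2); first by rewrite divr_gt0//= ltr_pdivrMr// ltr_pMr// ltr1n.
  have /bg[] := Us => _ /(_ gs) [/cK Ks _].
  have := Knu _ Ks; rewrite addrAC -[z + _ - z]addrA [z + _]addrC subrK dotDl !dotZl.
  set t := t0 / 2 in st *; have tp : 0 < t by rewrite divr_gt0.
  have : `|s * dot (G z) nu| < dot w nu * t.
    rewrite normrM; apply: (@lt_le_trans _ _ (dot w nu / M * t * M)).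
      apply: (@le_lt_trans _ _ (dot w nu / M * t * `|dot (G z) nu|)).
        by rewrite ler_wpM2r.
      have X : 0 < dot w nu / M * t by rewrite mulr_gt0// divr_gt0.
      by rewrite (ltr_pM2l X) /M ltrDr.
    by rewrite mulrAC divfK// lt0r_neq0.
  by rewrite ltr_norml => /andP[]; lra.
have nuE : nu = k *: G z by apply/eqP; rewrite -subr_eq0 -/w w0.
have k0 : k * k * dot (G z) (G z) = 1 by rewrite -nunu nuE dotZl dotZr mulrA.
by rewrite [in RHS]nuE dotZr scalerA mulrAC k0 scale1r.
Qed.

End NormHelpers.

(** * Cones at boundary points *)

Section ConeInside.
Context {R : realType}.
Variable n : nat.
Implicit Types (K : set 'rV[R]_n) (p z u nu h : 'rV[R]_n).

(** Otherwise the segment to z + k * u from a point of K on the way from z to p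
    would leave K at a boundary point of the cone. *)
Lemma cone_inside K z p nu u (d k : R) : closed K ->
  convex_set (K : set (convex_lmodType 'rV[R]_n)) -> K z -> K p -> 0 < d -> 0 < k -> p != z ->
  dot (p - z) nu <= - (d * `|p - z|) ->
  (forall h, 0 < `|h| <= k -> dot h nu <= - (d * `|h|) -> ~ bdry K (z + h)) ->
  u != 0 -> `|u| <= 1 -> dot u nu <= - (d * `|u|) -> K (z + k *: u).
Proof.
move=> cK vK Kz Kp d0 k0 pz pnu nob u0 u1 unu; apply: contrapT => Ku.
have pn : 0 < `|p - z| by rewrite normr_gt0 subr_eq0.
have un : 0 < `|u| by rewrite normr_gt0.
pose tau := Num.min 1 (k / `|p - z|).
have tau0 : 0 < tau by rewrite lt_min ltr01 divr_gt0.
have tau1 : tau <= 1 by rewrite ge_min lexx.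
have tauk : tau * `|p - z| <= k by rewrite -ler_pdivlMr// ge_min lexx orbT.
have Kq : K (z + tau *: (p - z)) by apply: convex_setP => //; rewrite (ltW tau0).
pose v := k *: u - tau *: (p - z).
have [|t [/andP[t0 t1] bt _]] := @segment_bdry _ _ K (z + tau *: (p - z)) v cK Kq.
  by rewrite /v addrA addrAC addrK.
pose h := (1 - t) *: (tau *: (p - z)) + t *: (k *: u).
have hE : z + tau *: (p - z) + t *: v = z + h.
  by rewrite /h /v; move: (p - z) => a; apply/rowP => i; rewrite !mxE; ring.
rewrite hE in bt; have t1' : 0 <= 1 - t by rewrite subr_ge0.
pose l := (1 - t) * (tau * `|p - z|) + t * (k * `|u|).
have hl : `|h| <= l.
  by rewrite (le_trans (ler_normD _ _))// !normrZ !ger0_norm// ltW.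
have hnu : dot h nu <= - (d * l).
  have aux (c1 c2 x y : R) : 0 <= c1 -> 0 <= c2 -> x <= - (d * y) -> c1 * (c2 * x) <= - (d * (c1 * (c2 * y))).
    move=> c10 c20 xy; have -> : - (d * (c1 * (c2 * y))) = c1 * (c2 * - (d * y)) by ring.
    by rewrite !ler_wpM2l.
  by rewrite dotDl !dotZl /l mulrDr opprD lerD// aux// ltW.
have l0 : 0 < l.
  have h1 : 0 < tau * `|p - z| by rewrite mulr_gt0.
  have h2 : 0 < k * `|u| by rewrite mulr_gt0.
  rewrite /l; move: h1 h2; move: (tau * _) (k * _) => a b a0 b0.
  have [tt|tt] := ltP t 1; last first.
    have -> : t = 1 by lra.
    by rewrite subrr mul0r add0r mul1r.
  by rewrite ltr_wpDr// ?mulr_ge0 ?(ltW b0)// mulr_gt0// subr_gt0.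
have h0 : 0 < `|h|.
  rewrite normr_gt0; apply: contraTneq hnu => ->; rewrite dot0l -ltNge oppr_lt0.
  exact: mulr_gt0.
apply: (nob h) bt; first rewrite h0 /=.
  rewrite (le_trans hl)// /l; apply: (@le_trans _ _ ((1 - t) * k + t * k)); last by lra.
  by rewrite lerD// ler_wpM2l// -[leRHS]mulr1 ler_wpM2l// ltW.
by rewrite (le_trans hnu)// lerN2 ler_wpM2l// ltW.
Qed.

(** A ball around an interior point p lies below all the supporting hyperplanes,
    and the distances to p are bounded. *)
Lemma normal_depth K : convex_body K -> exists p, K p /\ exists2 d : R, 0 < d &
  forall z nu, K z -> outer_normal K z nu -> p != z /\ dot (p - z) nu <= - (d * `|p - z|).
Proof.
move=> [cK _ [p pint]]; have Kp : K p by exact: (interior_subset pint).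
exists p; split => //; have [r1 r10 rK] := near_norm_ball pint.
have [M [_ HM]] := compact_bounded cK; have {}HM := HM (`|M| + 1).
have Mb x : K x -> `|x| <= `|M| + 1.
  by move=> Kx; apply: HM => //; rewrite (le_lt_trans (ler_norm M))// ltrDl.
pose D := `|p| + (`|M| + 1); have D0 : 0 < D by rewrite ltr_wpDl// ltr_wpDl.
have r0 : 0 < r1 / 2 by rewrite divr_gt0.
exists (r1 / 2 / D) => [|z nu Kz [nu1 nuK]]; first by rewrite divr_gt0.
have nun : dot nu nu = 1 by rewrite -enorm_sqr (nu1 : enorm nu = 1) expr1n.
have : dot (p - z) nu <= - (r1 / 2).
  have : K (p + (r1 / 2) *: nu).
    apply: rK; rewrite [p + _]addrC addrK normrZ (gtr0_norm r0).
    apply: (@le_lt_trans _ _ (r1 / 2)); last by rewrite ltr_pdivrMr// ltr_pMr// ltr1n.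
    by rewrite ger_pMr// (le_trans (row_norm_le_enorm _))// (nu1 : enorm nu = 1).
  have -> : p + (r1 / 2) *: nu = (p - z) + (r1 / 2) *: nu + z by rewrite addrAC subrK.
  by move/nuK; rewrite addrK dotDl dotZl nun; lra.
move=> h; split.
  by apply: contraTneq h => ->; rewrite subrr dot0l -ltNge oppr_lt0.
rewrite (le_trans h)// lerN2 mulrAC ler_pdivrMr// ler_wpM2l// ?(ltW r0)//.
by rewrite (le_trans (ler_normB _ _))// lerD2l Mb.
Qed.

End ConeInside.

(** * Chords *)

Section ChordArithmetic.
Context {R : realType}.
Implicit Types (q e k a r s d m x y h f : R).

Lemma coercive_margin q e m v : e < m / 4 -> m <= q + v -> v <= e -> 2 * (m / 4) <= q - e.
Proof. lra. Qed.

Lemma chord_endpoint_gt0 q m k a s f : 0 < s -> 2 * m <= q -> 2 * k * a < 2 * m * s ->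
  q * s ^+ 2 / 2 <= f + s * k * a -> 0 < f.
Proof.
move=> s0 mq ks h.
have h1 : 2 * m * s * s <= q * s * s by rewrite !ler_pM2r.
have h2 : 2 * k * a * s < 2 * m * s * s by rewrite ltr_pM2r.
lra.
Qed.

Lemma chord_length_bounds q e k a r : 0 < r -> 0 < a -> 1 - e <= k -> k <= 1 + e ->
  (q - e) * r ^+ 2 / 2 <= r * k * a -> r * k * a <= (q + e) * r ^+ 2 / 2 ->
  (q - e) * r <= 2 * (1 + e) * a /\ 2 * (1 - e) * a <= (q + e) * r.
Proof.
move=> r0 a0 k1 k2 h1 h2.
have h1' : (q - e) * r <= 2 * (k * a) by rewrite -(ler_pM2r r0); lra.
have h2' : 2 * (k * a) <= (q + e) * r by rewrite -(ler_pM2r r0); lra.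
have k3 : k * a <= (1 + e) * a by rewrite ler_pM2r.
have k4 : (1 - e) * a <= k * a by rewrite ler_pM2r.
by split; lra.
Qed.

Lemma descent_lt0 k a x h f : 0 < k -> 0 < a -> 0 < h -> x <= - (a * h) ->
  f - k * x <= k * a / 2 * h -> f < 0.
Proof.
move=> k0 a0 h0 xa fx; have := ler_wpM2l (ltW k0) xa.
have : 0 < k * a * h by rewrite !mulr_gt0.
lra.
Qed.

Lemma perturbed_descent_lt0 d x y h f : 0 < d -> 0 < h -> x <= - (d * h) ->
  y - x <= d / 4 * h -> f - y <= d / 4 * h -> f < 0.
Proof. move=> d0 h0; have : 0 < d * h by rewrite mulr_gt0. lra. Qed.

Lemma slow_start k e a d m s : 0 < a -> k <= 1 + e -> e < 1 -> a < d -> d < m * s / 4 ->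
  2 * k * a < 2 * m * s.
Proof.
move=> a0 k1 e1 ad ds; have : k * a <= 2 * a by rewrite ler_pM2r//; lra.
lra.
Qed.

End ChordArithmetic.

Section RadialProfile.
Context {R : realType}.
Variable m : nat.

(** To second order, at all the boundary points z near z0, the body is the
    region under a paraboloid: with a the sine of the angle between u and the
    tangent hyperplane, the chord has length 2 * a / quad M u up to the relative
    error e when a is small, and is bounded from below otherwise. All the
    constants are uniform in z. *)
Definition radial_profile (K : set 'rV[R]_m.+1) (z0 : 'rV[R]_m.+1) (M : 'M[R]_m.+1) : Prop :=
  exists2 m0 : R, 0 < m0 & forall e : R, 0 < e < m0 -> e < 1 ->
  exists2 d0 : R, 0 < d0 & forall d : R, 0 < d < d0 -> exists c r : R, [/\ 0 < c, 0 < r &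
  forall z, `|z - z0| < r -> bdry K z -> [/\ outer_normal K z (gauss_map K z), 0 <= quad M (gauss_map K z) <= e &
    forall u, unit_sphere u ->
    [/\ 0 <= dot u (gauss_map K z) -> radial K z u <= 0,
        0 < - dot u (gauss_map K z) < d -> [/\ 0 < radial K z u,
          (quad M u - e) * radial K z u <= 2 * (1 + e) * (- dot u (gauss_map K z)),
          2 * (1 - e) * (- dot u (gauss_map K z)) <= (quad M u + e) * radial K z u &
          2 * m0 <= quad M u] &
        d <= - dot u (gauss_map K z) -> c <= radial K z u]]].

End RadialProfile.

(** * The second fundamental form at a boundary point *)

Section LocalChart.
Context {R : realType}.
Variable m : nat.
Local Notation n := m.+1.
Implicit Types (x y z u v w : 'rV[R]_n).
(* f is a defining function of the boundary near z0, F its gradient, normalized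
   at z0, and H its Hessian; A is the differential of the Gauss map, with 0 as a
   simple eigenvalue. *)
Variables (K U : set 'rV[R]_n) (z0 : 'rV[R]_n) (f : 'rV[R]_n -> R^o)
  (F : 'rV[R]_n -> 'rV[R]_n) (H : 'rV[R]_n -> 'M[R]_n) (A : 'M[R]_n) (Q : {poly R}).
Local Notation G := (gauss_map K).
Local Notation nu0 := (gauss_map K z0).
Local Notation B := (H z0).
Hypotheses (cK : closed K) (oU : open U) (Uz0 : U z0)
  (fF : forall x, U x -> strict_diff f x (F x))
  (FH : forall x, U x -> forall i, strict_diff (fun y => F y 0 i : R^o) x (row i (H x)^T))
  (cH : forall e : R, 0 < e -> \forall x \near z0, `|H x - B| <= e)
  (sB : B^T = B)
  (bf : forall x, U x -> (bdry K x <-> f x = 0))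
  (F0 : F z0 = nu0) (bz0 : bdry K z0) (nu0P : outer_normal K z0 nu0)
  (WA : weingarten K z0 A) (cpA : char_poly A = 'X * Q) (Q0 : Q.[0] != 0).

Lemma unit_norm_le u : unit_sphere u -> `|u| <= 1.
Proof. by move=> u1; rewrite -(u1 : enorm u = 1) row_norm_le_enorm. Qed.

Lemma unit_dot u : unit_sphere u -> dot u u = 1.
Proof. by move=> u1; rewrite -enorm_sqr (u1 : enorm u = 1) expr1n. Qed.

Lemma nu0_norm : `|nu0| <= 1.
Proof. by apply: unit_norm_le; case: nu0P. Qed.

Lemma nu0_dot : dot nu0 nu0 = 1.
Proof. by apply: unit_dot; case: nu0P. Qed.

Lemma nu0_neq0 : nu0 != 0.
Proof. by rewrite -dot_gt0 nu0_dot. Qed.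

Lemma weingarten_norm (e : R) : 0 < e -> exists2 r : R, 0 < r & forall y, `|y - z0| < r ->
  bdry K y -> `|G y - nu0 - (y - z0) *m A| <= e * `|y - z0|.
Proof. by move=> e0; have [_ /(_ e e0) HW] := WA; apply: near_norm_ball; exact: HW. Qed.

Lemma F_expansion (e : R) : 0 < e -> exists2 r : R, 0 < r & forall y, `|y - z0| < r ->
  `|F y - nu0 - (y - z0) *m B| <= e * `|y - z0|.
Proof.
move=> e0; have Hi (i : 'I_n) : \forall y \near z0,
    `|F y 0 i - nu0 0 i - ((y - z0) *m B) 0 i| <= e * `|y - z0|.
  have [d d0 Hd] := strict_diff_norm (FH Uz0 i) e0.
  apply/nbhs_ballP; exists d => //= y; rewrite -ball_normE /= distrC => yd.
  have := Hd y z0 yd; rewrite subrr normr0 => /(_ d0); rewrite F0.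
  have -> // : dot (y - z0) (row i B^T) = ((y - z0) *m B) 0 i.
  by rewrite mxE; apply: eq_bigr => j _; rewrite !mxE.
have [r r0 rH] := near_norm_ball (@filter_forall _ _ _ _ (nbhs_filter z0) Hi).
exists r => // y yr; apply: row_norm_leP => [|i]; first by rewrite mulr_ge0// (ltW e0).
have := rH y yr i; by rewrite !mxE.
Qed.

(** The Weingarten expansion makes the Gauss map continuous at z0 along the
    boundary; hence its value near z0 is not the default value 0, and is an
    outer normal. *)
Lemma gauss_near (e : R) : 0 < e -> exists2 r : R, 0 < r & forall y, `|y - z0| < r ->
  bdry K y -> outer_normal K y (G y) /\ `|G y - nu0| <= e.
Proof.
move=> e0; have [r r0 Hr] := weingarten_norm ltr01.
pose L := 1 + n%:R * `|A|; have L0 : 0 < L by rewrite ltr_pwDl// mulr_ge0.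
pose e1 := Num.min e (`|nu0| / 2); have n0 : 0 < `|nu0| by rewrite normr_gt0 nu0_neq0.
have e10 : 0 < e1 by rewrite lt_min e0 divr_gt0.
exists (Num.min r (e1 / L)) => [|y]; first by rewrite lt_min r0 divr_gt0.
rewrite lt_min ltr_pdivlMr// => /andP[yr ye] by_.
have hy : `|G y - nu0| <= e1.
  apply: le_trans (ltW ye); rewrite -[G y - nu0](subrK ((y - z0) *m A)).
  rewrite (le_trans (ler_normD _ _))// mulrDr mulr1 lerD//.
    by rewrite -[leRHS]mul1r Hr.
  by rewrite (le_trans (mulmx_norm_le _ _))// mulrCA.
split; last by rewrite (le_trans hy)// ge_min lexx.
apply: xgetPex; apply: contrapT => nex.
have E : G y = 0 by rewrite /gauss_map xgetPN// => u hu; apply: nex; exists u.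
move: hy; rewrite E sub0r normrN le_min => /andP[_].
by move=> h; have := n0; lra.
Qed.

Lemma F_near (e : R) : 0 < e -> exists2 r : R, 0 < r & forall y, `|y - z0| < r -> `|F y - nu0| <= e.
Proof.
move=> e0; have [r r0 Hr] := F_expansion ltr01.
pose L := 1 + n%:R * `|B|; have L0 : 0 < L by rewrite ltr_pwDl// mulr_ge0.
exists (Num.min r (e / L)) => [|y]; first by rewrite lt_min r0 divr_gt0.
rewrite lt_min ltr_pdivlMr// => /andP[yr ye].
apply: le_trans (ltW ye); rewrite -[F y - nu0](subrK ((y - z0) *m B)).
rewrite (le_trans (ler_normD _ _))// mulrDr mulr1 lerD//.
  by rewrite -[leRHS]mul1r Hr.
by rewrite (le_trans (mulmx_norm_le _ _))// mulrCA.
Qed.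

(** Gradient and normal are parallel and both tend to nu0, so that their quotient
    c tends to 1. *)
Lemma chart_near (e : R) : 0 < e -> exists2 r : R, 0 < r & forall y, `|y - z0| < r ->
  [/\ U y, `|F y - nu0| <= e, `|H y - B| <= e & bdry K y ->
    [/\ outer_normal K y (G y), `|G y - nu0| <= e & exists2 c : R, `|c - 1| <= e & F y = c *: G y]].
Proof.
move=> e0; pose e1 := Num.min e (Num.min (`|nu0| / 2) (e / (n%:R * 2))).
have n0 : 0 < `|nu0| by rewrite normr_gt0 nu0_neq0.
have e10 : 0 < e1 by rewrite !lt_min e0 !divr_gt0// mulr_gt0.
have e1e : e1 <= e by rewrite ge_min lexx.
have [r1 r10 H1] := gauss_near e10.
have [r2 r20 H2] := F_near e10.
have [r3 r30 H3] := open_norm oU Uz0.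
have [r4 r40 H4] := near_norm_ball (cH e0).
exists (Num.min (Num.min r1 r2) (Num.min r3 r4)) => [|y]; first by rewrite !lt_min r10 r20 r30 r40.
rewrite !lt_min => /andP[/andP[y1 y2] /andP[y3 y4]].
have Uy := H3 y y3; have Fy := H2 y y2; split => //; [exact: le_trans Fy e1e|exact: H4|].
move=> by_; have [ony Gy] := H1 y y1 by_; split => //; first exact: le_trans Gy e1e.
have Fy0 : F y != 0.
  apply: contraTneq Fy => ->; rewrite sub0r normrN -ltNge !gt_min.
  by rewrite ltr_pdivrMr// ltr_pMr// ltr1n orbT.
exists (dot (F y) (G y)); last exact: (outer_normal_parallel cK oU Uy by_ fF bf Fy0 ony).
have -> : dot (F y) (G y) - 1 = dot (F y - nu0) (G y) + dot nu0 (G y - nu0).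
  by rewrite dotBl dotBr nu0_dot; ring.
have e2 : n%:R * (e1 * 2) <= e.
  have : e1 <= e / (n%:R * 2) by rewrite !ge_min lexx !orbT.
  by rewrite ler_pdivlMr ?mulr_gt0// mulrCA.
rewrite (le_trans (ler_normD _ _))//; apply: le_trans e2; rewrite mulrDr mulr1 mulrDr.
rewrite lerD// (le_trans (dot_le_norm _ _))// ler_wpM2l//.
  rewrite -[leRHS]mulr1 ler_pM// unit_norm_le//; by case: ony.
by rewrite -[leRHS]mul1r ler_pM// nu0_norm.
Qed.

(** All the first-order expansions at the same boundary point. *)
Lemma tangent_point w (e : R) : dot w nu0 = 0 -> 0 < e -> exists t y,
  [/\ 0 < t <= e, bdry K y /\ outer_normal K y (G y),
      `|y - z0 - t *: w| <= e * t,
      `|F y - nu0 - t *: (w *m B)| <= e * t /\ `|G y - nu0 - t *: (w *m A)| <= e * t &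
      exists2 c : R, `|c - 1| <= e & F y = c *: G y].
Proof.
move=> w0 e0; pose L := 1 + n%:R * `|A| + n%:R * `|B|.
have L1 : 1 <= L by rewrite /L -addrA lerDl addr_ge0// mulr_ge0.
have L0 : 0 < L by lra.
pose eta := e / (2 * L); have eta0 : 0 < eta by rewrite divr_gt0// mulr_gt0.
have etaL : eta * L = e / 2 by rewrite /eta; field; rewrite lt0r_neq0.
have etae : eta <= e by rewrite (@le_trans _ _ (eta * L))// ?ler_peMr// ?(ltW eta0)// etaL; lra.
pose W := `|w| + eta; have W0 : 0 < W by rewrite ltr_wpDl.
pose e1 := e / (2 * W); have e10 : 0 < e1 by rewrite divr_gt0// mulr_gt0.
have e1W : e1 * W = e / 2 by rewrite /e1; field; rewrite lt0r_neq0.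
have [r1 r10 H1] := chart_near e0.
have [r2 r20 H2] := F_expansion e10.
have [r3 r30 H3] := weingarten_norm e10.
have Fz0 : F z0 != 0 by rewrite F0 nu0_neq0.
have wF : dot w (F z0) = 0 by rewrite F0.
have [t0 t00 Ht] := tangent_zero oU Uz0 fF Fz0 wF (proj1 (bf Uz0) bz0) eta0.
pose r := Num.min r1 (Num.min r2 r3); have r0 : 0 < r by rewrite !lt_min r10 r20 r30.
pose t := Num.min (t0 / 2) (Num.min e (r / W / 2)).
have tp : 0 < t by rewrite !lt_min e0 !divr_gt0.
have te : t <= e by rewrite !ge_min lexx orbT.
have tr : t * W < r.
  rewrite -ltr_pdivlMr//; apply: (@le_lt_trans _ _ (r / W / 2)); first by rewrite !ge_min lexx !orbT.
  by rewrite ltr_pdivrMr// ltr_pMr ?ltr1n// divr_gt0.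
have [|s [st Us fs]] := Ht t.
  rewrite tp /=; apply: (@le_lt_trans _ _ (t0 / 2)); first by rewrite !ge_min lexx.
  by rewrite ltr_pdivrMr// ltr_pMr ?ltr1n.
rewrite F0 in Us fs; set y := z0 + t *: w + s *: nu0 in Us fs *.
have yE : y - z0 - t *: w = s *: nu0.
  by rewrite /y; apply/rowP => i; rewrite !mxE; ring.
have p1 : `|y - z0 - t *: w| <= eta * t.
  rewrite yE normrZ -[leRHS]mulr1; apply: ler_pM => //; exact: nu0_norm.
have p2 : `|y - z0| <= t * W.
  rewrite -[y - z0](subrK (t *: w)) (le_trans (ler_normD _ _))//.
  by rewrite normrZ (gtr0_norm tp) /W; move: p1; lra.
have yr := le_lt_trans p2 tr; move: yr; rewrite !lt_min => /and3P[y1 y2 y3].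
have by_ : bdry K y by apply/bf.
have [Uy _ _ /(_ by_)[ony Gy cy]] := H1 y y1.
have aux (C : 'M[R]_n) v : n%:R * `|C| <= L -> `|v - (y - z0) *m C| <= e1 * `|y - z0| ->
    `|v - t *: (w *m C)| <= e * t.
  move=> CL h.
  have -> : v - t *: (w *m C) = (v - (y - z0) *m C) + (y - z0 - t *: w) *m C.
    rewrite [(_ - t *: w) *m C]mulmxBl -scalemxAl; move: ((y - z0) *m C) => a.
    by rewrite addrA subrK.
  rewrite (le_trans (ler_normD _ _))//.
  have q1 : `|v - (y - z0) *m C| <= e / 2 * t.
    by rewrite (le_trans h)// -e1W -mulrA [W * t]mulrC ler_wpM2l// ltW.
  have q2 : `|(y - z0 - t *: w) *m C| <= e / 2 * t.
    rewrite (le_trans (mulmx_norm_le _ _))// -etaL mulrCA [eta * L * t]mulrAC.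
    by rewrite ler_pM// mulr_ge0.
  by lra.
exists t, y; split => //; first by rewrite tp.
- by rewrite (le_trans p1)// ler_wpM2r// ltW.
- split; apply: aux; [|exact: H2| |exact: H3].
  + by rewrite /L lerDr addr_ge0// mulr_ge0.
  + by rewrite /L -addrA [1 + _]addrC -addrA lerDl addr_ge0// mulr_ge0.
Qed.

Lemma le0_of_small (a C : R) : 0 <= C -> (forall e, 0 < e <= 1 -> a <= C * e) -> a <= 0.
Proof.
move=> C0 h; rewrite leNgt; apply/negP => a0.
pose e := Num.min 1 (a / (C + 1) / 2).
have e0 : 0 < e by rewrite lt_min ltr01 !divr_gt0// ltr_wpDl.
have := h e; rewrite e0 ge_min lexx => /(_ isT).
have : e <= a / (C + 1) / 2 by rewrite ge_min lexx orbT.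
rewrite -mulrA -invfM ler_pdivlMr ?mulr_gt0 ?ltr_wpDl// => h1 h2.
have : 0 <= C * e by rewrite mulr_ge0// ltW.
lra.
Qed.

(** The gradient is c times the normal with c close to 1; since x is orthogonal
    to nu0, the components of both along x are of first order, and they agree to
    this order. *)
Lemma tangent_hessian w x : dot w nu0 = 0 -> dot x nu0 = 0 -> dot (w *m B) x = dot (w *m A) x.
Proof.
move=> w0 x0; apply/eqP; rewrite -subr_eq0 -normr_le0.
set b := dot (w *m B) x; set a := dot (w *m A) x.
have X0 : 0 <= n%:R * `|x| by rewrite mulr_ge0.
apply: (@le0_of_small _ (3 * (n%:R * `|x|) + `|a|)) => [|e /andP[e0 e1]].
  by rewrite addr_ge0// mulr_ge0.
have [t [y [/andP[t0 te] _ _ [hF hG] [c c1 Fc]]]] := tangent_point w0 e0.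
have nx : dot nu0 x = 0 by rewrite dotC.
have dE (v : 'rV[R]_n) (C : 'M[R]_n) : dot (v - nu0 - t *: (w *m C)) x = dot v x - t * dot (w *m C) x.
  by rewrite !dotBl dotZl nx subr0.
have bnd (v : 'rV[R]_n) : `|v| <= e * t -> `|dot v x| <= n%:R * `|x| * (e * t).
  move=> h; rewrite (le_trans (dot_le_norm _ _))// -mulrA ler_wpM2l// mulrC.
  by rewrite ler_wpM2l.
have := bnd _ hF; rewrite dE -/b Fc dotZl; have := bnd _ hG; rewrite dE -/a.
move: (dot (G y) x) => p; set X := n%:R * `|x| in X0 *.
move=> h1 h2; rewrite -(ler_pM2l t0) -{1}(gtr0_norm t0) -normrM.
have -> : t * (b - a) = - (c * p - t * b) + (c - 1) * (p - t * a) + (c - 1) * (t * a) + (p - t * a) by ring.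
have h3 : `|(c - 1) * (p - t * a)| <= X * (e * t).
  rewrite normrM -[leRHS]mul1r ler_pM//; exact: le_trans c1 e1.
have h4 : `|(c - 1) * (t * a)| <= e * (t * `|a|).
  by rewrite normrM ler_pM// normrM (gtr0_norm t0).
rewrite (le_trans (ler_normD _ _))//.
rewrite (le_trans (lerD (ler_normD _ _) (lexx _)))//.
rewrite (le_trans (lerD (lerD (ler_normD _ _) (lexx _)) (lexx _)))// normrN.
lra.
Qed.

(** Adding the support inequalities at z0 and at y shows that the Gauss map is
    monotone. *)
Lemma tangent_psd w : dot w nu0 = 0 -> 0 <= dot (w *m A) w.
Proof.
move=> w0; rewrite -oppr_le0; set a := dot (w *m A) w.
pose N : R := n%:R; have N0 : 0 <= N by [].
apply: (@le0_of_small _ (N * (`|w| + `|w *m A| + 1))) => [|e /andP[e0 e1]].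
  by rewrite mulr_ge0// !addr_ge0.
have [t [y [/andP[t0 te] [by_ [_ ony]] hy [_ hG] _]]] := tangent_point w0 e0.
have Ky : K y by case: by_ => /cK.
have Kz : K z0 by case: bz0 => /cK.
have [_ onz] := nu0P.
have := onz y Ky; have := ony z0 Kz; move: hy hG.
set p := y - z0 - t *: w; set q := G y - nu0 - t *: (w *m A) => hp hq.
have yE : y - z0 = t *: w + p by rewrite /p [t *: w + _]addrC subrK.
have GE : G y = nu0 + (t *: (w *m A) + q) by rewrite /q [t *: _ + _]addrC subrK [nu0 + _]addrC subrK.
have -> : z0 - y = - (t *: w + p) by rewrite -yE opprB.
rewrite yE GE dotNl dotDr; clearbody p q => h1 h2.
have : 0 <= dot (t *: w + p) (t *: (w *m A) + q) by lra.
rewrite !dotDl !dotDr !dotZl !dotZr.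
have -> : dot w (w *m A) = a by rewrite dotC.
have k1 : `|dot w q| <= N * (`|w| * (e * t)).
  by rewrite (le_trans (dot_le_norm _ _))// ler_wpM2l// ler_wpM2l.
have k2 : `|dot p (w *m A)| <= N * (`|w *m A| * (e * t)).
  by rewrite (le_trans (dot_le_norm _ _))// ler_wpM2l// [leRHS]mulrC ler_wpM2r.
have k3 : `|dot p q| <= N * ((e * t) * (e * t)).
  by rewrite (le_trans (dot_le_norm _ _))// ler_wpM2l// ler_pM.
have k4 : N * ((e * t) * (e * t)) <= N * (e * t * t).
  have et : 0 <= e * t by rewrite mulr_ge0// ltW.
  by rewrite ler_wpM2l// ler_wpM2l// ger_pMl.
move: k1 k2 k3; rewrite !ler_norml => /andP[_ k1] /andP[_ k2] /andP[_ k3] k5.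
have k1' := ler_wpM2l (ltW t0) k1; have k2' := ler_wpM2l (ltW t0) k2.
have t2 : 0 < t * t by rewrite mulr_gt0.
rewrite -(ler_pM2l t2); lra.
Qed.


Let P : 'M[R]_n := 1%:M - nu0^T *m nu0.

(** The projection makes the form symmetric without a proof that the differential
    of the Gauss map has tangent values. *)
Definition second_form : 'M[R]_n := A *m P.
Local Notation M := second_form.

Lemma projE x : x *m P = x - dot x nu0 *: nu0.
Proof.
rewrite /P mulmxBr mulmx1 mulmxA; congr (_ - _).
have -> : x *m nu0^T = (dot x nu0)%:M.
  by rewrite [LHS]mx11_scalar; congr (_%:M); rewrite mxE; apply: eq_bigr => i _; rewrite mxE.
by rewrite mul_scalar_mx.
Qed.

Lemma proj_tangent x : dot (x *m P) nu0 = 0.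
Proof. by rewrite projE dotBl dotZl nu0_dot mulr1 subrr. Qed.

Lemma dot_proj x y : dot (x *m P) y = dot x (y *m P).
Proof. by rewrite !projE dotBl dotBr dotZl dotZr [dot nu0 y]dotC mulrC. Qed.

Lemma nu0A : nu0 *m A = 0. Proof. by case: WA. Qed.

Lemma projA x : x *m P *m A = x *m A.
Proof. by rewrite projE mulmxBl -scalemxAl nu0A scaler0 subr0. Qed.

Lemma second_formE x y : dot (x *m M) y = dot (x *m P *m A) (y *m P).
Proof. by rewrite projA /second_form mulmxA dot_proj. Qed.

Lemma second_form_hessian x y : dot (x *m M) y = dot (x *m P *m B) (y *m P).
Proof. by rewrite second_formE tangent_hessian ?proj_tangent. Qed.

Lemma dot_mulmx_sym x y : dot (x *m B) y = dot (y *m B) x.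
Proof.
have dotE a b : dot a b = (a *m b^T) 0 0 :> R.
  by rewrite mxE; apply: eq_bigr => i _; rewrite mxE.
have tr1 (C : 'M[R]_1) : C 0 0 = C^T 0 0 by rewrite mxE.
by rewrite !dotE tr1 trmx_mul trmxK trmx_mul sB mulmxA.
Qed.

Lemma second_form_sym x y : dot (x *m M) y = dot (y *m M) x.
Proof. by rewrite !second_form_hessian dot_mulmx_sym. Qed.

Lemma second_form_psd x : 0 <= quad M x.
Proof. by rewrite /quad second_formE tangent_psd// proj_tangent. Qed.

Lemma trace_second_form : \tr M = \tr A.
Proof.
rewrite /second_form /P mulmxBr mulmx1 raddfB/= mulmxA mxtrace_mulC mulmxA nu0A mul0mx.
by rewrite raddf0 subr0.
Qed.

(** A semidefinite form vanishing at x has a minimum at x, where its derivative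
    vanishes. *)
Lemma second_form_ker x : quad M x = 0 -> x *m M = 0.
Proof.
move=> x0; apply/eqP; rewrite -dot_eq0 -[_ == 0]negbK; apply/negP => a0.
set y := x *m M in a0; pose a := dot y y; pose b := quad M y.
have ap : 0 < a by rewrite lt_neqAle dot_ge0 eq_sym a0.
have b0 : 0 <= b by exact: second_form_psd.
pose s := - (a / (b + 1)); have b1 : 0 < b + 1 by rewrite ltr_wpDl.
have := second_form_psd (x + s *: y).
have -> : quad M (x + s *: y) = s * (2 * a + s * b).
  rewrite /quad mulmxDl -scalemxAl !dotDl !dotDr !dotZl !dotZr -/(quad M x) x0.
  by rewrite [dot (y *m M) x]second_form_sym -/y -/a -/(quad M y) -/b; ring.
have -> : s * (2 * a + s * b) = - (a ^+ 2 * (b + 2) / (b + 1) ^+ 2).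
  by rewrite /s; field; rewrite lt0r_neq0.
by rewrite oppr_ge0 leNgt divr_gt0// ?exprn_gt0// mulr_gt0 ?exprn_gt0// ltr_wpDl.
Qed.

(** If the form degenerated, the Cayley-Hamilton identity would provide a second
    null vector of the differential of the Gauss map, hence a second factor of
    its characteristic polynomial that vanishes at 0. *)
Lemma second_form_definite x : dot x nu0 = 0 -> quad M x = 0 -> x = 0.
Proof.
move=> x0 /second_form_ker xM.
have xA : x *m A = dot (x *m A) nu0 *: nu0.
  by apply/eqP; rewrite -subr_eq0 -projE -mulmxA; apply/eqP.
have xAA : x *m A *m A = 0 by rewrite xA -scalemxAl nu0A scaler0.
(* A Q(A) = 0 and x A A = 0 give Q(0) x A = 0. *)
have [Q1 QE] : exists Q1, Q = Q1 * 'X + Q.[0]%:P.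
  have /factor_theorem[Q1] : root (Q - Q.[0]%:P) 0.
    by rewrite /root hornerD hornerN hornerC subrr.
  by rewrite polyC0 subr0 => E; exists Q1; rewrite -E subrK.
have xA0 : x *m A = 0.
  have E : char_poly A = 'X * 'X * Q1 + 'X * Q.[0]%:P.
    by rewrite cpA {1}QE mulrDr; congr (_ + _); rewrite -mulrA ['X * Q1]mulrC.
  have := Cayley_Hamilton A; rewrite E rmorphD !rmorphM/= horner_mx_X horner_mx_C.
  move=> /(congr1 (mulmx x)); rewrite mulmx0 mulmxDr.
  rewrite -[A * A * _]/(A *m A *m horner_mx A Q1) !mulmxA xAA mul0mx add0r.
  rewrite mul_mx_scalar => /eqP.
  by rewrite scaler_eq0 (negbTE Q0) => /eqP.
apply: contrapT => /eqP xn0.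
have : 'X^2 %| char_poly A.
  apply: (two_null_vectors_char_poly nu0A xA0) => [c|]; last exact: nu0_neq0.
  apply: contraNneq xn0 => xc; move: x0; rewrite xc dotZl nu0_dot mulr1 => ->.
  by rewrite scale0r.
rewrite cpA expr2 dvdp_mul2l ?polyX_eq0// => /dvdpP[q Qq].
by move: Q0; rewrite Qq hornerM hornerX mulr0 eqxx.
Qed.

Lemma continuous_quad (C : 'M[R]_n) : continuous (quad C : 'rV[R]_n -> R).
Proof.
have -> : quad C = fun u => \sum_(p <- index_enum ('I_n * 'I_n)%type) C p.1 p.2 * (u 0 p.1 * u 0 p.2).
  by apply/funext => u; rewrite quadE.
apply: continuous_sumr => p; apply: continuous_mulr; first exact: cst_continuous.
by apply: continuous_mulr; exact: coord_continuous.
Qed.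

Lemma continuous_dotl w : continuous (fun u : 'rV[R]_n => dot u w : R).
Proof.
apply: continuous_sumr => i; apply: continuous_mulr; last exact: cst_continuous.
exact: coord_continuous.
Qed.

Lemma continuous_dot : continuous (fun u : 'rV[R]_n => dot u u : R).
Proof. by apply: continuous_sumr => i; apply: continuous_mulr; exact: coord_continuous. Qed.

Lemma compact_unit_sphere : compact (@unit_sphere R n).
Proof.
apply: bounded_closed_compact.
  exists 1; split; first exact: num_real.
  by move=> c c1 u /= u1; rewrite (le_trans (unit_norm_le u1))// ltW.
have -> : @unit_sphere R n = (fun x => dot x x) @^-1` [set 1].
  apply/seteqP; split => x /= h; first exact: unit_dot.
  by rewrite /unit_sphere/= /enorm h sqrtr1.
apply: preimage_closed; first by move=> x _; exact: continuous_dot.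
exact: closed_eq.
Qed.

(** The square of the normal component makes the form positive on the whole
    sphere, which is compact. *)
Lemma second_form_coercive : exists2 m0 : R, 0 < m0 & forall u, unit_sphere u ->
  m0 <= quad M u + dot u nu0 ^+ 2.
Proof.
pose N u := quad M u + dot u nu0 ^+ 2.
have cN : continuous N.
  apply: continuous_addr; first exact: continuous_quad.
  by apply: continuous_mulr; exact: continuous_dotl.
have S0 : (@unit_sphere R n) !=set0 by exists nu0; case: nu0P.
have [c cS cmin] := EVT_min_rV S0 compact_unit_sphere (continuous_subspaceT cN).
exists (N c) => [|u uS]; last by apply: cmin; rewrite inE.
rewrite lt_neqAle addr_ge0 ?second_form_psd ?sqr_ge0// andbT.
apply/negP => /eqP/esym/eqP; rewrite paddr_eq0 ?second_form_psd ?sqr_ge0// sqrf_eq0.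
move=> /andP[/eqP c1 /eqP c2]; have := second_form_definite c2 c1 => c0.
move: cS; rewrite inE c0 => /unit_dot; rewrite dot0l => /eqP.
by rewrite eq_sym oner_eq0.
Qed.

(** * Radial functions near a boundary point *)

Lemma derive_line x u (s : R) : U (x + s *: u) ->
  is_derive s 1 ((fun t : R => f (x + t *: u)) : R -> R^o) (dot u (F (x + s *: u))) /\
  is_derive s 1 ((fun t : R => dot u (F (x + t *: u))) : R -> R^o) (quad (H (x + s *: u)) u).
Proof.
move=> Us; split; first exact: (strict_diff_line (fF Us)).
have Hi (i : 'I_n) := @is_deriveZ _ _ _ _ (u 0 i) _ _ _ (strict_diff_line (u := u) (FH Us i)).
have := is_derive_sum (fun i => Hi i).
have -> : (\sum_(i < n) u 0 i \*: (fun t : R => F (x + t *: u) 0 i : R^o))%R =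
   ((fun t : R => dot u (F (x + t *: u))) : R -> R^o).
  by apply/funext => t; rewrite fct_sumE.
have -> // : \sum_(i < n) u 0 i *: (dot u (row i (H (x + s *: u))^T) : R^o) = quad (H (x + s *: u)) u.
rewrite /quad dotC; apply: eq_bigr => i _; congr (_ * _).
by rewrite mxE; apply: eq_bigr => j _; rewrite !mxE.
Qed.

Lemma line_taylor x u (r b c : R) : 0 <= r -> (forall s, 0 <= s <= r -> U (x + s *: u)) ->
  (forall s, 0 <= s <= r -> b <= quad (H (x + s *: u)) u <= c) ->
  b * r ^+ 2 / 2 <= f (x + r *: u) - f x - r * dot u (F x) <= c * r ^+ 2 / 2.
Proof.
move=> r0 Us bc; have x0 : x + 0 *: u = x by rewrite scale0r addr0.
apply/andP; split.
  have [||| _] := @taylor2_lower R (fun t => f (x + t *: u)) (fun t => dot u (F (x + t *: u)))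
    (fun t => quad (H (x + t *: u)) u) b r r0.
  - by move=> t /Us/derive_line[].
  - by move=> t /Us/derive_line[].
  - by move=> t /bc/andP[].
  - by rewrite x0; lra.
have [||| _] := @taylor2_lower R (fun t => - f (x + t *: u)) (fun t => - dot u (F (x + t *: u)))
    (fun t => - quad (H (x + t *: u)) u) (- c) r r0.
- move=> t /Us/derive_line[h _]; exact: (is_deriveN h).
- move=> t /Us/derive_line[_ h]; exact: (is_deriveN h).
- by move=> t /bc/andP[_]; rewrite lerN2.
- by rewrite x0; lra.
Qed.

(** A point x of K with f x positive could be lowered along nu0 to a boundary
    point, whose outer normal, close to nu0, would separate x from K. *)
Lemma body_below : exists2 r : R, 0 < r & forall x, `|x - z0| < r -> K x -> f x <= 0.
Proof.
pose N : R := n%:R; have N0 : 0 < N by rewrite /N ltr0n.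
have e0 : 0 < (2 * N)^-1 by rewrite invr_gt0 mulr_gt0.
have [r1 r10 H1] := chart_near e0.
have h0 : 0 < 2^-1 :> R by rewrite invr_gt0.
have [r2 r20 H2] := strict_diff_norm (fF Uz0) h0.
(* Descending by C * |x - z0| compensates the height of x over the tangent plane. *)
pose C : R := 2 * N + 2; have C0 : 0 < C by rewrite addr_gt0// mulr_gt0.
have C1 : 0 < 1 + C by rewrite ltr_pwDl// ltW.
exists (Num.min r1 r2 / (1 + C)) => [|x]; first by rewrite divr_gt0// lt_min r10.
rewrite (ltr_pdivlMr _ _ C1) => xr Kx; rewrite leNgt; apply/negP => fx.
set X := `|x - z0| in xr; have X0 : 0 <= X := normr_ge0 _.
have near s : - (C * X) <= s <= 0 -> `|x + s *: nu0 - z0| < Num.min r1 r2.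
  move=> /andP[s1 s2]; apply: le_lt_trans xr.
  rewrite addrAC (le_trans (ler_normD _ _))// normrZ mulrDr mulr1 lerD//.
  rewrite ler0_norm//; apply: (@le_trans _ _ (- s)); last by lra.
  by rewrite ler_piMr// ?nu0_norm// oppr_ge0.
have nearU s : - (C * X) <= s <= 0 -> U (x + s *: nu0).
  by move=> /near; rewrite lt_min => /andP[/H1[]].
have CX : 0 <= C * X by rewrite mulr_ge0// ltW.
have fz0 : f z0 = 0 by apply/bf.
have low : f (x + (- (C * X)) *: nu0) <= 0.
  have := near (- (C * X)); rewrite lexx oppr_le0 => /(_ CX); rewrite lt_min => /andP[_ xr2].
  have := H2 _ z0 xr2; rewrite subrr normr0 => /(_ r20).
  rewrite fz0 subr0 F0; set y := x + _ => hy.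
  have yE : y - z0 = (x - z0) + (- (C * X)) *: nu0 by rewrite /y addrAC.
  have yn : `|y - z0| <= X + C * X.
    rewrite yE (le_trans (ler_normD _ _))// lerD// normrZ normrN ger0_norm//.
    by rewrite ler_piMr// nu0_norm.
  have yd : dot (y - z0) nu0 <= N * X - C * X.
    rewrite yE dotDl dotZl nu0_dot mulr1 lerD2r.
    rewrite (le_trans (ler_norm _))// (le_trans (dot_le_norm _ _))// ler_wpM2l//.
    by rewrite ler_piMr// nu0_norm.
  move: hy; rewrite ler_norml => /andP[_]; move: yn yd X0; rewrite /C.
  move: (f y) (dot (y - z0) nu0) (`|y - z0|) => a b c; lra.
have [||||s sC fs] := @strict_diff_line_zero _ _ f F x nu0 (- (C * X)) 0.
- by move=> s /nearU/fF.
- by rewrite oppr_le0.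
- exact: low.
- by rewrite scale0r addr0 ltW.
have [s1 s2] := andP sC; have := near s sC; rewrite lt_min => /andP[/H1[Uy _ _ Hy] _].
have by_ : bdry K (x + s *: nu0) by apply/bf.
have [[_ /(_ x Kx) Kxy] Gy _] := Hy by_; move: Kxy.
have -> : x - (x + s *: nu0) = (- s) *: nu0 by rewrite opprD addrA subrr add0r scaleNr.
have s0 : s < 0.
  rewrite lt_neqAle s2 andbT; apply: contraTneq fx => s0; move: fs.
  by rewrite s0 scale0r addr0 => ->; rewrite ltxx.
rewrite dotZl pmulr_rle0 ?oppr_gt0// => h.
have : `|dot nu0 (G (x + s *: nu0) - nu0)| <= 2^-1.
  rewrite (le_trans (dot_le_norm _ _))// -/N.
  have -> : 2^-1 = N * (1 * (2 * N)^-1) by field; rewrite lt0r_neq0.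
  by rewrite ler_wpM2l ?(ltW N0)// ler_pM// nu0_norm.
by rewrite dotBr nu0_dot ler_norml => /andP[]; lra.
Qed.

Lemma quad_unit_bound (C : 'M[R]_n) u : unit_sphere u -> `|quad C u| <= n%:R ^+ 2 * `|C|.
Proof.
move=> /unit_norm_le u1; rewrite (le_trans (dot_le_norm _ _))// expr2 -mulrA ler_wpM2l//.
rewrite -[leRHS]mulr1 ler_pM// (le_trans (mulmx_norm_le _ _))// ler_wpM2l//.
by rewrite ler_piMl.
Qed.

(** The Hessian and the second fundamental form agree on tangent vectors, and u is
    nearly tangent. *)
Lemma hessian_near (e : R) : 0 < e -> exists d r : R, [/\ 0 < d, 0 < r &
  forall z u, `|z - z0| < r -> bdry K z -> unit_sphere u -> `|dot u (G z)| < d ->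
    dot u nu0 ^+ 2 <= e /\ forall x, `|x - z0| < r -> `|quad (H x) u - quad M u| <= e].
Proof.
move=> e0; pose N : R := n%:R; have N0 : 0 < N by rewrite /N ltr0n.
pose L := 1 + 2 * (3 * (N ^+ 2 * `|B|)); have L0 : 0 < L by rewrite ltr_pwDl// !mulr_ge0// ltW.
pose al := Num.min 1 (Num.min e (e / L)).
have al0 : 0 < al by rewrite !lt_min ltr01 e0 divr_gt0.
have al1 : al <= 1 by rewrite ge_min lexx.
have ale : al <= e by rewrite !ge_min lexx orbT.
have alL : al * L <= e by rewrite -ler_pdivlMr// !ge_min lexx !orbT.
pose e1 := Num.min (al / (2 * N)) (e / (2 * N ^+ 2)).
have e10 : 0 < e1 by rewrite lt_min !divr_gt0// ?mulr_gt0// exprn_gt0.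
have [r r0 Hr] := chart_near e10.
exists (al / 2), r; split => //; first by rewrite divr_gt0.
move=> z u zr bz uS ud; have [_ _ _ /(_ bz)[_ Gz _]] := Hr z zr.
have u1 := unit_norm_le uS; set a := dot u nu0.
have aal : `|a| <= al.
  have -> : a = dot u (G z) + dot u (nu0 - G z) by rewrite dotBr addrC subrK.
  rewrite (le_trans (ler_normD _ _))//.
  have : `|dot u (nu0 - G z)| <= al / 2.
    rewrite (le_trans (dot_le_norm _ _))// -/N.
    have -> : al / 2 = N * (1 * (al / (2 * N))) by field; rewrite lt0r_neq0.
    rewrite ler_wpM2l ?(ltW N0)// ler_pM// distrC (le_trans Gz)// ge_min lexx//.
  by move: ud; lra.
have a1 := le_trans aal al1.
have bnd (x y : 'rV[R]_n) : `|x| <= 1 -> `|y| <= 1 -> `|dot (x *m B) y| <= N ^+ 2 * `|B|.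
  move=> x1 y1; rewrite (le_trans (dot_le_norm _ _))// expr2 -mulrA ler_wpM2l//.
  rewrite -[leRHS]mulr1 ler_pM// (le_trans (mulmx_norm_le _ _))// ler_wpM2l//.
  by rewrite ler_piMl.
split.
  rewrite -[a ^+ 2]ger0_norm ?sqr_ge0// normrX expr2 (le_trans _ ale)//.
  by rewrite (le_trans _ aal)// ler_piMl.
move=> x xr; have [_ _ Hx _] := Hr x xr.
have p1 : `|quad (H x) u - quad B u| <= e / 2.
  have -> : quad (H x) u - quad B u = quad (H x - B) u by rewrite /quad mulmxBr dotBl.
  rewrite (le_trans (quad_unit_bound _ uS))// -/N.
  have -> : e / 2 = N ^+ 2 * (e / (2 * N ^+ 2)) by field; rewrite lt0r_neq0.
  by rewrite ler_wpM2l ?exprn_ge0 ?(ltW N0)// (le_trans Hx)// ge_min lexx orbT.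
have p2 : `|quad B u - quad M u| <= e / 2.
  rewrite {2}/quad second_form_hessian projE -/a mulmxBl -scalemxAl dotBl !dotBr !dotZl !dotZr.
  rewrite -/(quad B u); set b1 := dot (u *m B) nu0; set b2 := dot (nu0 *m B) u; set b3 := dot (nu0 *m B) nu0.
  have -> : quad B u - (quad B u - a * b1 - (a * b2 - a * (a * b3))) = a * b1 + a * b2 + (- (a * (a * b3))) by ring.
  set T := N ^+ 2 * `|B|.
  have h1 : `|a * b1| <= al * T by rewrite normrM ler_pM// bnd// nu0_norm.
  have h2 : `|a * b2| <= al * T by rewrite normrM ler_pM// bnd// nu0_norm.
  have h3 : `|- (a * (a * b3))| <= al * T.
    rewrite normrN normrM ler_pM// normrM -[leRHS]mul1r ler_pM// bnd// nu0_norm//.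
  rewrite (le_trans (ler_normD _ _))// (le_trans (lerD (ler_normD _ _) (lexx _)))//.
  by move: alL; rewrite /L -/T; move: h1 h2 h3; move: `|_| `|_| `|_| (al0) => q1 q2 q3; lra.
have -> : quad (H x) u - quad M u = (quad (H x) u - quad B u) + (quad B u - quad M u) by ring.
by rewrite (le_trans (ler_normD _ _))//; lra.
Qed.


Hypotheses (KK : convex_body K).

Let vK : convex_set (K : set (convex_lmodType 'rV[R]_n)). Proof. by case: KK. Qed.

Let kK : compact K. Proof. by case: KK. Qed.

Lemma second_form_normal (e : R) : 0 < e -> exists2 r : R, 0 < r & forall z, `|z - z0| < r ->
  bdry K z -> quad M (G z) <= e.
Proof.
move=> e0; pose N : R := n%:R; have N0 : 0 < N by rewrite /N ltr0n.
pose L := N ^+ 2 * `|M| + 1; have L0 : 0 < L by rewrite ltr_wpDl// mulr_ge0// exprn_ge0// ltW.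
pose e1 := Num.min 1 (e / L); have e10 : 0 < e1 by rewrite lt_min ltr01 divr_gt0.
have [r r0 Hr] := chart_near e10; exists r => // z zr bz.
have [_ _ _ /(_ bz)[_ Gz _]] := Hr z zr.
pose v := G z - nu0; have GE : G z = nu0 + v by rewrite /v addrC subrK.
have nuM : nu0 *m M = 0 by rewrite /second_form mulmxA nu0A mul0mx.
have -> : quad M (G z) = quad M v.
  rewrite GE /quad mulmxDl nuM add0r dotDr [dot (v *m M) nu0]second_form_sym nuM dot0l.
  by rewrite add0r.
rewrite (le_trans (ler_norm _))// (le_trans (dot_le_norm _ _))//.
have e1L : e1 * L <= e by rewrite -ler_pdivlMr// ge_min lexx orbT.
have v1 : `|v| <= 1 by rewrite (le_trans Gz)// ge_min lexx.
apply: le_trans e1L; rewrite (@le_trans _ _ (N * (N * (1 * `|M|) * e1)))//.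
  rewrite ler_wpM2l ?(ltW N0)// ler_pM// (le_trans (mulmx_norm_le _ _))//.
  by rewrite ler_wpM2l// ler_wpM2r.
by rewrite /L; move: `|M| e10 => c; lra.
Qed.

(** Along a chord close to the tangent hyperplane, f is pinched between two
    parabolas, whose second zeros bound the length of the chord as soon as the
    chord stays in the chart. It does so because f would otherwise be positive
    at a point of K. The steep directions enter K by cone_inside: f is negative
    in a cone of fixed size at all the boundary points near z0. *)
Lemma radial_estimates : radial_profile K z0 M.
Proof.
have [m1 m10 Hm] := second_form_coercive; pose m0 := m1 / 4.
have m00 : 0 < m0 by rewrite divr_gt0.
exists m0 => // e /andP[e0 em] e1; pose N : R := n%:R; have N0 : 0 < N by rewrite /N ltr0n.
have [dH [rH [dH0 rH0 HH]]] := hessian_near e0.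
have [rK rK0 HK] := body_below.
have [rC rC0 HC] := chart_near e0.
have [rN rN0 HN] := second_form_normal e0.
have [p [Kp [dp dp0 Hp]]] := normal_depth KK.
pose S := Num.min (Num.min rH rK) (Num.min rC rN) / 2.
have S0 : 0 < S by rewrite divr_gt0// !lt_min rH0 rK0 rC0 rN0.
pose d0 := Num.min (Num.min dH dp) (m0 * S / 4).
exists d0; first by rewrite !lt_min dH0 dp0 !divr_gt0// mulr_gt0.
move=> d /andP[dpos]; rewrite !lt_min => /andP[/andP[ddH ddp] ddS].
have e20 : 0 < d / (4 * N) by rewrite divr_gt0// mulr_gt0.
have [r2 r20 H2] := chart_near e20.
have e30 : 0 < d / 4 by rewrite divr_gt0.
have [r3 r30 H3] := strict_diff_norm (fF Uz0) e30.
pose c := Num.min r2 r3 / 2; have c0 : 0 < c by rewrite divr_gt0// lt_min r20.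
exists c, (Num.min S c); split => //; first by rewrite lt_min S0.
move=> z; rewrite lt_min => /andP[zS zc] bz.
have S2 : S + S = Num.min (Num.min rH rK) (Num.min rC rN) by rewrite /S; field.
have c2 : c + c = Num.min r2 r3 by rewrite /c; field.
have inS x : `|x - z0| < S + S -> [/\ `|x - z0| < rH, `|x - z0| < rK, `|x - z0| < rC & `|x - z0| < rN].
  by rewrite S2 !lt_min => /andP[/andP[-> ->] /andP[-> ->]].
have inc x : `|x - z0| < c + c -> `|x - z0| < r2 /\ `|x - z0| < r3.
  by rewrite c2 lt_min => /andP[-> ->].
have [zH zK zC zN] : [/\ `|z - z0| < rH, `|z - z0| < rK, `|z - z0| < rC & `|z - z0| < rN].
  by apply: inS; rewrite (lt_trans zS)// ltrDl.
have [z2 z3] : `|z - z0| < r2 /\ `|z - z0| < r3 by apply: inc; rewrite (lt_trans zc)// ltrDl.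
have [Uz _ _ /(_ bz)[onz Gz [k k1 Fz]]] := HC z zC.
have Kz : K z by case: bz => /cK.
have fz : f z = 0 by apply/bf.
have [pz pdz] := Hp z _ Kz onz.
have [nu1 nuK] := onz.
split => //; first by rewrite second_form_psd HN.
move=> u uS; have u1 := unit_norm_le uS.
have u0 : u != 0 by rewrite -dot_gt0 unit_dot.
have un : 0 < `|u| by rewrite normr_gt0.
set a := - dot u (G z); have aE : dot u (G z) = - a by rewrite opprK.
set rho := radial K z u.
have Krho : K (z + rho *: u) by have [/cK] := radial_bdry kK Kz u0.
have inner (q : R) d1 : 0 < q -> 0 < d1 <= dp -> d1 <= a ->
    (forall h, 0 < `|h| <= q -> dot h (G z) <= - (d1 * `|h|) -> f (z + h) < 0 /\ U (z + h)) -> q <= rho.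
  move=> q0 /andP[d10 d1p] d1a hh; apply: radial_ub => //.
  apply: (@cone_inside _ _ K z p (G z) u d1 q cK vK Kz Kp d10 q0 pz _ _ u0 u1).
  - by rewrite (le_trans pdz)// lerN2 ler_wpM2r.
  - move=> h h0 hd; have [fh Uh] := hh h h0 hd; move=> /bf -/(_ Uh) fh0.
    by rewrite fh0 ltxx in fh.
  - by rewrite aE lerN2 (le_trans _ d1a)// ler_piMr// ltW.
have lineS s : 0 <= s <= S -> `|z + s *: u - z0| < S + S.
  move=> /andP[s0 sS]; rewrite addrAC (le_lt_trans (ler_normD _ _))// ltr_leD//.
  by rewrite normrZ ger0_norm// (le_trans _ sS)// ler_piMr.
have near_tangent : `|dot u (G z)| < d -> [/\ 2 * m0 <= quad M u - e &
    forall s, 0 <= s <= S -> (quad M u - e) * s ^+ 2 / 2 <= f (z + s *: u) + s * k * a <= (quad M u + e) * s ^+ 2 / 2].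
  move=> ud; have [unu Hx] := HH z u zH bz uS (lt_trans ud ddH).
  have qm : 2 * m0 <= quad M u - e by exact: coercive_margin em (Hm u uS) unu.
  split=> // s /andP[s0 sS].
  have := @line_taylor z u s (quad M u - e) (quad M u + e) s0.
  rewrite fz Fz dotZr aE =>  Hl; have {Hl}[||] := andP (Hl _ _).
  - by move=> t /andP[t0 ts]; have [|_ _ /HC[]] := inS (z + t *: u); first by rewrite lineS// t0 (le_trans ts).
  - move=> t /andP[t0 ts]; have [|/Hx + _ _ _] := inS (z + t *: u); first by rewrite lineS// t0 (le_trans ts).
    by rewrite ler_distl.
  - by rewrite subr0 !mulrN opprK mulrA => -> ->.
have far s : `|dot u (G z)| < d -> 0 < s <= S -> 2 * k * a < 2 * m0 * s -> K (z + s *: u) -> False.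
  move=> ud /andP[s0 sS] ks Ks; have [qm Ht] := near_tangent ud.
  have sI : 0 <= s <= S by rewrite sS ltW.
  have [_ /HK/(_ Ks) fs _ _] := inS _ (lineS s sI).
  have := Ht s sI => /andP[h _].
  by have := chord_endpoint_gt0 s0 qm ks h; rewrite ltNge fs.
split.
- rewrite aE oppr_ge0 => a0; apply: ge_sup => [|t /= Kt].
    by have [] := radial_has_sup kK Kz u0.
  rewrite leNgt; apply/negP => t0.
  have := nuK _ Kt; rewrite [z + _]addrC addrK dotZl pmulr_rle0// aE oppr_le0 => a0'.
  have a00 : a = 0 by apply/eqP; rewrite eq_le a0 a0'.
  pose s := Num.min t S; have s0 : 0 < s by rewrite lt_min t0.
  apply: (far s); rewrite ?aE ?a00 ?oppr0 ?normr0 ?s0 ?ge_min ?lexx ?orbT ?mulr0 ?mulr_gt0//.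
  have -> : z + s *: u = z + (s / t) *: ((z + t *: u) - z).
    by rewrite [z + t *: u]addrC addrK scalerA divfK// lt0r_neq0.
  apply: convex_setP => //; rewrite divr_ge0 ?(ltW s0) ?(ltW t0)//= ler_pdivrMr// mul1r.
  by rewrite ge_min lexx.
- move=> /andP[a0 ad]; have ud : `|dot u (G z)| < d by rewrite aE normrN gtr0_norm.
  have [qm Ht] := near_tangent ud.
  move: k1; rewrite ler_distl => /andP[k1 k2]; have k0 : 0 < k by rewrite (lt_le_trans _ k1)// subr_gt0.
  have rho0 : 0 < rho.
    have ka0 : 0 < k * a / 2 by rewrite divr_gt0// mulr_gt0.
    have [r4 r40 H4] := strict_diff_norm (fF Uz) ka0.
    have [r5 r50 H5] := open_norm oU Uz.
    pose q := Num.min r4 r5 / 2; have q0 : 0 < q by rewrite divr_gt0// lt_min r40.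
    apply: (lt_le_trans q0); apply: (inner q a) => //.
      by rewrite a0 ltW// (lt_trans ad).
    move=> h /andP[h0 hq] ha.
    have : `|z + h - z| < Num.min r4 r5.
      rewrite [z + h]addrC addrK (le_lt_trans hq)// /q ltr_pdivrMr// ltr_pMr ?ltr1n//.
      by rewrite lt_min r40.
    rewrite lt_min => /andP[h4 h5]; split; last exact: H5.
    have := H4 (z + h) z h4; rewrite subrr normr0 => /(_ r40).
    rewrite fz subr0 [z + h - z]addrAC subrr add0r Fz dotZr ler_norml => /andP[_].
    exact: descent_lt0 k0 a0 h0 ha.
  have rhoS : rho <= S.
    rewrite leNgt; apply/negP => Srho; apply: (far S ud); rewrite ?S0 ?lexx//.
      exact: slow_start a0 k2 e1 ad ddS.
    have -> : z + S *: u = z + (S / rho) *: ((z + rho *: u) - z).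
      by rewrite [z + rho *: u]addrC addrK scalerA divfK// lt0r_neq0.
    apply: convex_setP => //; rewrite divr_ge0 ?(ltW S0) ?(ltW rho0)//= ler_pdivrMr// mul1r.
    exact: ltW.
  have rhoI : 0 <= rho <= S by rewrite (ltW rho0).
  have frho : f (z + rho *: u) = 0.
    have [_ _ /HC[Ur _ _ _] _] := inS _ (lineS _ rhoI).
    by apply/bf => //; exact: radial_bdry.
  have := Ht rho rhoI; rewrite frho add0r => /andP[h1 h2].
  have [l1 l2] := chord_length_bounds rho0 a0 k1 k2 h1 h2.
  by split => //; rewrite (le_trans qm)// gerBl ltW.
- move=> da; apply: (inner c d) => //; first by rewrite dpos ltW.
  move=> h /andP[h0 hc] hd.
  have [zh2 zh3] : `|z + h - z0| < r2 /\ `|z + h - z0| < r3.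
    by apply: inc; rewrite addrAC (le_lt_trans (ler_normD _ _))// ltr_leD.
  have [Uh _ _ _] := H2 _ zh2; split => //.
  have [_ _ _ /(_ bz)[_ Gz2 _]] := H2 z z2.
  have := H3 _ _ zh3 z3; rewrite fz subr0 [z + h - z]addrAC subrr add0r F0 ler_norml => /andP[_].
  have : `|dot h (nu0 - G z)| <= d / 4 * `|h|.
    rewrite (le_trans (dot_le_norm _ _))// -/N.
    have -> : d / 4 * `|h| = N * (`|h| * (d / (4 * N))) by field; rewrite lt0r_neq0.
    by rewrite ler_wpM2l ?(ltW N0)// ler_wpM2l// distrC.
  rewrite dotBr ler_norml => /andP[_].
  exact: perturbed_descent_lt0 dpos h0 hd.
Qed.

End LocalChart.

(** * From charts to curvatures *)

Section CurvatureTrace.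
Context {R : realType}.
Variable m : nat.
Local Notation n := m.+1.
Implicit Types (K U : set 'rV[R]_n) (z : 'rV[R]_n).

Lemma continuous_near_le (h : 'rV[R]_n -> R^o) z (e : R) : 0 < e -> {for z, continuous h} ->
  \forall x \near z, `|h x - h z| <= e.
Proof.
move=> e0 ch; have X : \forall t \near z, `|h z - h t| <= e.
  by move: (ch) => /cvgrPdist_le; apply.
by apply: filterS X => y; rewrite (distrC (h z) (h y)).
Qed.

Lemma trace_of_roots (A : 'M[R]_n) (k : 'I_m -> R) : (0 < m)%N ->
  char_poly A = 'X * \prod_(i < m) ('X - (k i)%:P) -> \tr A = \sum_i k i.
Proof.
move=> m0 cA; have := char_poly_trace A (ltn0Sn m); rewrite cA coefXM /= (gtn_eqF m0).
pose ps := [seq k i | i <- enum 'I_m].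
have sps : size ps = m by rewrite size_map size_enum_ord.
have -> : \prod_(i < m) ('X - (k i)%:P) = \prod_(p <- ps) ('X - p%:P).
  by rewrite /ps big_map big_enum.
have -> : m.-1 = (size ps).-1 by rewrite sps.
rewrite coefPn_prod_XsubC ?sps ?gtn_eqF// => /oppr_inj <-.
by rewrite /ps big_map big_enum.
Qed.

(** Division by the normal derivative, which also fixes the sign. *)
Lemma normalized_chart K U (g : 'rV[R]_n -> R^o) z0 nu : closed K -> open U -> U z0 -> Ck 2 U g ->
  (forall x, U x -> (bdry K x <-> g x = 0)) ->
  (exists i, 'D_(delta_mx 0 i) g z0 != 0) -> bdry K z0 -> outer_normal K z0 nu ->
  exists (f : 'rV[R]_n -> R^o) (F : 'rV[R]_n -> 'rV[R]_n) (H : 'rV[R]_n -> 'M[R]_n),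
  [/\ (forall x, U x -> strict_diff f x (F x)) /\ (forall x, U x -> (bdry K x <-> f x = 0)),
      forall x, U x -> forall i, strict_diff (fun y => F y 0 i : R^o) x (row i (H x)^T),
      forall e : R, 0 < e -> \forall x \near z0, `|H x - H z0| <= e,
      (H z0)^T = H z0 & F z0 = nu].
Proof.
move=> cK oU Uz0 [cg C1] bg [i0 gi0] bz0 onu.
have dg i y : U y -> derivable g y (delta_mx 0 i) by have [+ _] := C1 i; exact.
have cDg i y : U y -> {for y, continuous ('D_(delta_mx 0 i) g)} by have [_ [+ _]] := C1 i; exact.
have dDg i j y : U y -> derivable ('D_(delta_mx 0 i) g : 'rV[R]_n -> R^o) y (delta_mx 0 j).
  by have [_ [_ /(_ j)[+ _]]] := C1 i; exact.
have cDDg i j y : U y -> {for y, continuous ('D_(delta_mx 0 j) ('D_(delta_mx 0 i) g : 'rV[R]_n -> R^o))}.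
  by have [_ [_ /(_ j)[_ [+ _]]]] := C1 i; exact.
have sg x : U x -> strict_diff g x (grad g x).
  by move=> Ux; apply: (C1_strict_diff oU Ux) => i; [exact: dg|exact: cDg].
have sDg i x : U x -> strict_diff ('D_(delta_mx 0 i) g : 'rV[R]_n -> R^o) x
    (grad ('D_(delta_mx 0 i) g : 'rV[R]_n -> R^o) x).
  by move=> Ux; apply: (C1_strict_diff oU Ux) => j; [exact: dDg|exact: cDDg].
have g0 : grad g z0 != 0.
  by apply: contra_neq gi0 => /rowP/(_ i0); rewrite !mxE.
have gE := outer_normal_parallel cK oU Uz0 bz0 sg bg g0 onu.
pose c := dot (grad g z0) nu.
have c0 : c != 0 by apply: contra_neq g0 => c0; rewrite gE -/c c0 scale0r.
have ci0 : c^-1 != 0 by rewrite invr_eq0.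
exists (fun y => c^-1 * g y), (fun y => c^-1 *: grad g y),
  (fun y => \matrix_(j, i) (c^-1 * 'D_(delta_mx 0 j) ('D_(delta_mx 0 i) g : 'rV[R]_n -> R^o) y)).
split.
- split=> x Ux; first exact/strict_diffZ/sg.
  rewrite bg//; split => [->|/eqP]; first by rewrite mulr0.
  by rewrite mulf_eq0 (negbTE ci0) => /eqP.
- move=> x Ux i; have := strict_diffZ c^-1 (sDg i x Ux).
  have -> : (fun y => c^-1 * ('D_(delta_mx 0 i) g : 'rV[R]_n -> R^o) y : R^o) =
    (fun y => (c^-1 *: grad g y) 0 i : R^o) by apply/funext => y; rewrite !mxE.
  by have -> // : c^-1 *: grad ('D_(delta_mx 0 i) g : 'rV[R]_n -> R^o) x =
    row i (\matrix_(j, i) (c^-1 * 'D_(delta_mx 0 j) ('D_(delta_mx 0 i) g : 'rV[R]_n -> R^o) x))^T;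
    apply/rowP => j; rewrite !mxE.
- move=> e e0; pose e1 := e * `|c|; have e10 : 0 < e1 by rewrite mulr_gt0// normr_gt0.
  have cI (p : 'I_n * 'I_n) : \forall x \near z0,
    `|'D_(delta_mx 0 p.1) ('D_(delta_mx 0 p.2) g : 'rV[R]_n -> R^o) x -
      'D_(delta_mx 0 p.1) ('D_(delta_mx 0 p.2) g : 'rV[R]_n -> R^o) z0| <= e1.
    exact: (continuous_near_le e10 (cDDg p.2 p.1 z0 Uz0)).
  have := @filter_forall _ _ _ _ (nbhs_filter z0) cI; apply: filterS => x hx.
  rewrite [X in X <= _]mx_normrE; apply: bigmax_le; first exact: ltW.
  move=> [j i] _; rewrite !mxE /= -mulrBr normrM normfV ler_pdivrMl ?normr_gt0//.
  by rewrite mulrC; exact: (hx (j, i)).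
- have S i j : 'D_(delta_mx 0 j) ('D_(delta_mx 0 i) g : 'rV[R]_n -> R^o) z0 =
      'D_(delta_mx 0 i) ('D_(delta_mx 0 j) g : 'rV[R]_n -> R^o) z0.
    have := schwarz_symmetric (U := U) (g := g) i j oU Uz0 dg (fun k => sDg k z0 Uz0).
    by rewrite [LHS]mxE [RHS]mxE.
  apply/matrixP => i j; rewrite [LHS]mxE [LHS]mxE [RHS]mxE.
  exact: (congr1 ( *%R c^-1) (S _ _)).
- by rewrite gE scalerA mulVf// scale1r.
Qed.

(** The curvatures selected by mean_curvature and the positive ones may come from
    two matrices, which have the same second fundamental form because it is
    determined by the Hessian, hence the same trace. *)
Lemma local_geometry K z0 : (0 < m)%N -> convex_body K -> C2_bdry K -> positive_curvature K ->
  bdry K z0 -> outer_normal K z0 (gauss_map K z0) -> exists M : 'M[R]_n,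
  [/\ \tr M = m%:R * mean_curvature K z0, 0 < \tr M & radial_profile K z0 M].
Proof.
move=> m0 bK C2 pK bz0 onu; have [kK _ _] := bK.
have cK : closed K by exact: closedK kK.
have [U [g [oU Uz0 Cg bg gg]]] := C2 z0 bz0.
have [f [F [H [[fF bf] FH cH sH F0]]]] := normalized_chart cK oU Uz0 Cg bg (gg z0 Uz0 bz0) bz0 onu.
have [k [A WA cA] k0] := pK z0 bz0.
have [A' WA' cA'] : are_principal_curvatures K z0 (xget 0 (are_principal_curvatures K z0)).
  by apply: xgetPex; exists k, A.
have MA := second_form_hessian cK oU Uz0 fF FH cH bf F0 bz0 onu WA.
have MA' := second_form_hessian cK oU Uz0 fF FH cH bf F0 bz0 onu WA'.
have MM : second_form K z0 A = second_form K z0 A'.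
  apply/row_matrixP => i; apply/eqP; rewrite -subr_eq0 -dot_eq0.
  by rewrite !rowE -{1}mulmxBr {1}mulmxBr dotBl MA MA' subrr.
have trA := trace_second_form WA; have trA' := trace_second_form WA'.
exists (second_form K z0 A); split.
- rewrite MM trA' (trace_of_roots m0 cA') /mean_curvature mulrCA mulfV ?mulr1//.
  by rewrite pnatr_eq0 -lt0n.
- rewrite trA (trace_of_roots m0 cA); case: m m0 k k0 {cA A WA MA MM trA} => // p _ k k0.
  by rewrite big_ord_recl ltr_wpDr ?sumr_ge0// => i _; exact/ltW/k0.
- apply: (radial_estimates cK oU Uz0 fF FH cH sH bf F0 bz0 onu WA cA) => //.
  rewrite horner_prod; apply/prodf_neq0 => i _; rewrite hornerXsubC sub0r oppr_eq0.
  exact: lt0r_neq0.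
Qed.

End CurvatureTrace.

(** * Integrals of nonnegative functions without measurability *)

Section UpperIntegral.
Context d (T : measurableType d) (R : realType) (mu : {measure set T -> \bar R}).
Import HBNNSimple.
Local Open Scope ereal_scope.
Implicit Types (D E : set T) (f g : T -> \bar R).

(** The integral of a nonnegative function is a supremum over simple functions,
    hence monotone even without measurability. The integrands in question are the
    dual quermassintegral along the boundary and powers of radial functions. *)
Lemma ge0_le_integral_subset D E f g : (forall x, D x -> 0 <= f x) -> (forall x, E x -> 0 <= g x) ->
  (forall x, D x -> E x /\ f x <= g x) -> \int[mu]_(x in D) f x <= \int[mu]_(x in E) g x.
Proof.
move=> f0 g0 fg; rewrite !ge0_integralE//; apply: le_ereal_sup => _ [h hf <-]; exists h => // x.
apply: le_trans (hf x) _; rewrite !patchE; case: ifPn => [/set_mem Dx|_].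
  by have [Ex fgx] := fg x Dx; rewrite mem_set.
by case: ifPn => [/set_mem/g0|].
Qed.

Lemma ge0_integral_scale_ge D f (c : R) : (0 < c)%R -> (forall x, D x -> 0 <= f x) ->
  c%:E * \int[mu]_(x in D) f x <= \int[mu]_(x in D) (c%:E * f x).
Proof.
move=> c0 f0; have cf0 x : D x -> 0 <= c%:E * f x.
  by move=> Dx; rewrite mule_ge0 ?f0// lee_fin ltW.
rewrite muleC -lee_pdivlMr//; rewrite ge0_integralE//; apply: ge_ereal_sup => _ [h hf <-].
rewrite lee_pdivlMr// muleC -(sintegralrM mu c h) ge0_integralE//.
apply: ereal_sup_ubound; exists (scale_nnsfun h (ltW c0)) => // x /=.
have := hf x; rewrite EFinM !patchE; case: ifPn => _ hx; first by rewrite lee_pmul2l.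
by rewrite -[leRHS](mule0 c%:E) lee_pmul2l.
Qed.

Lemma ge0_integral_scale D f (c : R) : (0 < c)%R -> (forall x, D x -> 0 <= f x) ->
  \int[mu]_(x in D) (c%:E * f x) = c%:E * \int[mu]_(x in D) f x.
Proof.
move=> c0 f0; apply/eqP; rewrite eq_le ge0_integral_scale_ge// andbT.
have cf0 x : D x -> 0 <= c%:E * f x.
  by move=> Dx; rewrite mule_ge0 ?f0// lee_fin ltW.
have ci0 : (0 < c^-1)%R by rewrite invr_gt0.
have := ge0_integral_scale_ge ci0 cf0.
have -> : \int[mu]_(x in D) (c^-1%:E * (c%:E * f x)) = \int[mu]_(x in D) f x.
  by apply: eq_integral => x _; rewrite muleA -EFinM mulVf ?mul1e// lt0r_neq0.
by rewrite muleC -lee_pdivlMr ?invr_gt0// invrK muleC.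
Qed.

(** The function f is replaced by a measurable bound before the domain is split. *)
Lemma integral_le_two_pieces P C F (f g : T -> R) (c s : R) : measurable C -> measurable F ->
  measurable_fun setT g -> (forall x, C x -> 0 <= g x)%R -> (0 <= c)%R -> mu F <= s%:E ->
  (forall x, P x -> 0 <= f x)%R ->
  (forall x, P x -> (C x /\ f x <= g x)%R \/ (F x /\ f x <= c)%R) ->
  \int[mu]_(x in P) (f x)%:E <= \int[mu]_(x in C) (g x)%:E + (c * s)%:E.
Proof.
move=> mC mF mg g0 c0 Fs f0 fP.
pose h1 := (EFin \o g) \_ C; pose h2 := (cst c%:E : T -> \bar R) \_ F.
have h10 x : 0 <= h1 x by rewrite /h1 patchE; case: ifPn => [/set_mem Cx|//]; rewrite lee_fin g0.
have h20 x : 0 <= h2 x by rewrite /h2 patchE; case: ifPn => [_|//]; rewrite lee_fin.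
have mh1 : measurable_fun setT h1.
  by apply/(measurable_restrictT _ mC); apply: measurable_funTS; exact/measurable_EFinP.
have mh2 : measurable_fun setT h2 by apply/(measurable_restrictT _ mF); exact: measurable_cst.
apply: (@le_trans _ _ (\int[mu]_x (h1 x + h2 x))).
  apply: ge0_le_integral_subset => [x Px|x _|x Px]; [by rewrite lee_fin f0|by rewrite adde_ge0|].
  split=> //; have [[Cx fg]|[Fx fc]] := fP x Px.
    apply: (@le_trans _ _ (h1 x)); last by rewrite leeDl.
    by rewrite /h1 patchE mem_set// lee_fin.
  apply: (@le_trans _ _ (h2 x)); last by rewrite leeDr.
  by rewrite /h2 patchE mem_set// lee_fin.
rewrite ge0_integralD// /h1 /h2 -!integral_mkcond leeD//.
rewrite integral_cst// EFinM lee_wpmul2l// lee_fin//.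
Qed.

End UpperIntegral.

(** * Powers with exponent close to -1 *)

Section PowerBounds.
Context {R : realType}.
Implicit Types (a b c q r s x y : R).

Lemma powR_expR x p : 0 < x -> x `^ p = expR (p * ln x).
Proof. by move=> x0; rewrite /powR gt_eqF. Qed.

Lemma powR_quotient a b x q : 0 < a -> 0 < b -> 0 < x ->
  (b * a / x) `^ (q - 1) = b `^ (q - 1) * x `^ (- q) * (a `^ (q - 1) * x).
Proof.
move=> a0 b0 x0; rewrite !powR_expR ?divr_gt0 ?mulr_gt0//.
rewrite ln_div ?posrE ?mulr_gt0// lnM ?posrE//.
rewrite -{3}(lnK (x0 : x \is Num.pos)) -!expRD; congr expR; ring.
Qed.

(** The factor mu ^ (- q) tends to 1, so that the bound is essentially linear in
    x: a power of a quadratic form is replaced by the form itself, which can be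
    integrated. *)
Lemma powR_chord_upper q a b r x mu : 0 < q < 1 -> 0 < a -> 0 < b -> 0 < mu -> mu <= x ->
  b * a <= x * r -> r `^ (q - 1) <= b `^ (q - 1) * mu `^ (- q) * (a `^ (q - 1) * x).
Proof.
move=> /andP[q0 q1] a0 b0 mu0 mux bar; have x0 := lt_le_trans mu0 mux.
have y0 : 0 < b * a / x by rewrite divr_gt0// mulr_gt0.
have q1' : q - 1 <= 0 by rewrite subr_le0 ltW.
have yr : b * a / x <= r by rewrite ler_pdivrMr// [r * x]mulrC.
apply: (le_trans (le_powR_anti q1' y0 yr)); rewrite powR_quotient//.
rewrite ler_wpM2r ?mulr_ge0 ?powR_ge0 ?(ltW x0)// ler_wpM2l ?powR_ge0//.
by rewrite le_powR_anti// oppr_le0 ltW.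
Qed.

Lemma powR_chord_lower q a b r x B : 0 < q < 1 -> 0 < a -> 0 < b -> 0 < x -> x <= B -> 0 < r ->
  x * r <= b * a -> b `^ (q - 1) * B `^ (- q) * (a `^ (q - 1) * x) <= r `^ (q - 1).
Proof.
move=> /andP[q0 q1] a0 b0 x0 xB r0 bar.
have q1' : q - 1 <= 0 by rewrite subr_le0 ltW.
have yr : r <= b * a / x by rewrite ler_pdivlMr// [r * x]mulrC.
apply: le_trans (le_powR_anti q1' r0 yr); rewrite powR_quotient//.
rewrite ler_wpM2r ?mulr_ge0 ?powR_ge0 ?(ltW x0)// ler_wpM2l ?powR_ge0//.
by rewrite le_powR_anti// oppr_le0 ltW.
Qed.

Lemma cvg_powR_exponent (S : Type) (Fl : set_system S) (g : S -> R) b p : Filter Fl -> 0 < b ->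
  g s @[s --> Fl] --> p -> b `^ (g s) @[s --> Fl] --> b `^ p.
Proof.
move=> FF b0 gp; rewrite powR_expR//.
rewrite (_ : (fun s : S => b `^ (g s)) = (fun s : S => expR (g s * ln b))); last first.
  by apply/funext => s; rewrite powR_expR.
have gl : g s * ln b @[s --> Fl] --> p * ln b by exact: cvgMl.
exact: (cvg_comp _ _ gl (@continuous_expR R (p * ln b))).
Qed.

Lemma cvg_exponent_at_right : (q : R) @[q --> 0^'+] --> (0 : R).
Proof. by apply: cvg_at_right_filter; exact: cvg_id. Qed.

(** The second summand comes from the steep directions: it is q times a bounded
    quantity. *)
Lemma upper_factor_cvg b mu X c s : 0 < b -> 0 < mu -> 0 < c ->
  b `^ (q - 1) * mu `^ (- q) * X + q * (c `^ (q - 1) * s) @[q --> 0^'+] --> X / b.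
Proof.
move=> b0 mu0 c0; have q0 := cvg_exponent_at_right.
have q1 : (q : R) - 1 @[q --> 0^'+] --> (- 1 : R).
  by rewrite -[X in _ --> X]sub0r; apply: cvgB => //; exact: cvg_cst.
have q2 : - (q : R) @[q --> 0^'+] --> (0 : R).
  by rewrite -[X in _ --> X]oppr0; apply: cvgN.
have -> : X / b = b `^ (- 1) * mu `^ 0 * X + 0 * (c `^ (- 1) * s).
  by rewrite mul0r addr0 powRr0 mulr1 powR_inv1 ?(ltW b0)// mulrC.
apply: cvgD; last by apply: cvgM => //; apply: cvgMl; exact: cvg_powR_exponent.
by apply: cvgMl; apply: cvgM; exact: cvg_powR_exponent.
Qed.

Lemma lower_factor_cvg b B X d : 0 < b -> 0 < B -> 0 < d ->
  b `^ (q - 1) * B `^ (- q) * (d `^ q * X) @[q --> 0^'+] --> X / b.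
Proof.
move=> b0 B0 d0; have q0 := cvg_exponent_at_right.
have q1 : (q : R) - 1 @[q --> 0^'+] --> (- 1 : R).
  by rewrite -[X in _ --> X]sub0r; apply: cvgB => //; exact: cvg_cst.
have q2 : - (q : R) @[q --> 0^'+] --> (0 : R).
  by rewrite -[X in _ --> X]oppr0; apply: cvgN.
have -> : X / b = b `^ (- 1) * B `^ 0 * (d `^ 0 * X).
  by rewrite !powRr0 mulr1 mul1r powR_inv1 ?(ltW b0)// mulrC.
apply: cvgM; first by apply: cvgM; exact: cvg_powR_exponent.
by apply: cvgMl; exact: cvg_powR_exponent.
Qed.

End PowerBounds.

(** * Limits of the dual quermassintegrals *)

Section RadialIntegral.
Context {R : realType}.
Variable m : nat.
Local Notation n := m.+1.
Local Notation T := (@sphere_type R n).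
Implicit Types (K : set 'rV[R]_n) (z u w nu : 'rV[R]_n) (M C : 'M[R]_n).

Lemma quad_add_scalar M (e : R) u : unit_sphere u -> quad (M + e%:M) u = quad M u + e.
Proof.
by move=> uS; rewrite /quad mulmxDr dotDl mul_mx_scalar dotZl unit_dot// mulr1.
Qed.

Lemma quadN C u : quad C (- u) = quad C u.
Proof. by rewrite /quad mulNmx dotNl dotNr opprK. Qed.

Lemma unit_sphereN u : unit_sphere u -> unit_sphere (- u).
Proof. by rewrite /unit_sphere/= /enorm dotNl dotNr opprK. Qed.

Lemma measurable_quad C : measurable_fun setT (fun u : T => quad C (u : 'rV[R]_n)).
Proof.
have -> : (fun u : T => quad C (u : 'rV[R]_n)) =
  (fun u : T => \sum_(p : 'I_n * 'I_n) C p.1 p.2 * ((u : 'rV[R]_n) 0 p.1 * (u : 'rV[R]_n) 0 p.2)).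
  by apply/funext => u; rewrite quadE.
apply: (measurable_sum_mulr (f := fun p (_ : T) => C p.1 p.2)) => p; first exact: measurable_cst.
exact: (measurable_funM (@measurable_coord R n isT p.1) (@measurable_coord R n isT p.2)).
Qed.

Lemma measurable_weighted_quad C w (A q : R) :
  measurable_fun setT (fun u : T => A * (dot (u : 'rV[R]_n) w `^ (q - 1) * quad C (u : 'rV[R]_n))).
Proof.
have mp : measurable_fun setT (fun u : T => dot (u : 'rV[R]_n) w `^ (q - 1)).
  exact: (measurableT_comp (measurable_powR (q - 1)) (@measurable_dotl R n isT w)).
exact: (measurable_funM (measurable_cst A) (measurable_funM mp (measurable_quad C))).
Qed.

Section AtPoint.
Variables (K : set 'rV[R]_n) (z nu : 'rV[R]_n) (M : 'M[R]_n) (e m0 d c q : R).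
Hypotheses (q01 : 0 < q < 1) (e0 : 0 < e) (em : e < m0) (e1 : e < 1)
  (c0 : 0 < c).
Hypothesis prof : forall u, unit_sphere u ->
    [/\ 0 <= dot u nu -> radial K z u <= 0,
        0 < - dot u nu < d -> [/\ 0 < radial K z u,
          (quad M u - e) * radial K z u <= 2 * (1 + e) * (- dot u nu),
          2 * (1 - e) * (- dot u nu) <= (quad M u + e) * radial K z u &
          2 * m0 <= quad M u] &
        d <= - dot u nu -> c <= radial K z u].
Let w := - nu.
Variables a b : R.
Hypothesis moments : forall C,
  (\int[spherical n]_(u in band w d) (dot (u : 'rV[R]_n) w `^ (q - 1) * quad C u)%:E =
         ((\tr C - quad C w) * a + quad C w * b)%:E)%E.
Local Notation I C := ((\tr (C)%R - quad (C)%R w) * a + quad (C)%R w * b).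

Lemma integral_weighted_quad C (A : R) : 0 < A -> (forall u, band w d u -> 0 <= quad C u) ->
  (\int[spherical n]_(u in band w d) (A * (dot (u : 'rV[R]_n) w `^ (q - 1) * quad C u))%:E =
   (A * I C)%:E)%E.
Proof.
move=> A0 C0; under eq_integral do rewrite EFinM.
rewrite (@ge0_integral_scale _ T R (spherical n) (band w d))//; first by rewrite moments EFinM.
by move=> u uc; rewrite lee_fin mulr_ge0 ?powR_ge0// C0.
Qed.

Lemma band_profile u : band w d u -> [/\ 0 < dot u w, positive_directions K z u,
          (quad M u - e) * radial K z u <= 2 * (1 + e) * dot u w,
          2 * (1 - e) * dot u w <= (quad M u + e) * radial K z u &
          2 * m0 <= quad M u].
Proof.
move=> [uS uw]; have [_ P _] := prof uS; move: uw (uw); rewrite /w dotNr => /P[r0 h1 h2 h3] /andP[uw _].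
by split.
Qed.

(** Near the tangent hyperplane the chord bound applies, and elsewhere the radial
    function is at least c. *)
Lemma radial_integral_upper :
  (\int[spherical n]_(u in (positive_directions K z : set T)) (radial K z u `^ (q - 1))%:E <=
   ((2 * (1 - e)) `^ (q - 1) * (2 * m0) `^ (- q) * I (M + e%:M) +
    c `^ (q - 1) * fine (spherical n (@unit_sphere R n)))%:E)%E.
Proof.
have m00 : 0 < m0 by rewrite (lt_trans e0).
have b0 : 0 < 2 * (1 - e) by rewrite mulr_gt0// subr_gt0.
have mu0 : 0 < 2 * m0 by rewrite mulr_gt0.
pose A := (2 * (1 - e)) `^ (q - 1) * (2 * m0) `^ (- q).
have A0 : 0 < A by rewrite mulr_gt0// powR_gt0.
have Cq u : band w d u -> 0 <= quad (M + e%:M) u.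
  move=> uc; have [_ _ _ _ h] := band_profile uc; rewrite quad_add_scalar; last by case: uc.
  by rewrite addr_ge0 ?(ltW e0)// (le_trans _ h)// ltW.
rewrite [X in (_ <= X)%E]EFinD -(integral_weighted_quad A0 Cq).
apply: (@integral_le_two_pieces _ T R (spherical n) (positive_directions K z) (band w d)
  (@unit_sphere R n) (fun u => radial K z u `^ (q - 1))).
- exact: measurable_band.
- exact: Smeas_sphere.
- exact: measurable_weighted_quad.
- by move=> u uc; rewrite mulr_ge0 ?(ltW A0)// mulr_ge0 ?powR_ge0// Cq.
- exact: powR_ge0.
- rewrite fineK// ge0_fin_numE//; exact: spherical_fin.
- by move=> u _; exact: powR_ge0.
move=> u [uS ur]; have [P1 P2 P3] := prof uS.
have uw : 0 < dot u w.
  rewrite /w dotNr oppr_gt0 ltNge; apply/negP => /P1 ur'.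
  by have := lt_le_trans ur ur'; rewrite ltxx.
have [ud|du] := ltP (dot u w) d.
  left; have uc : band w d u by split => //; rewrite uw ud.
  split => //; have [_ _ _ h1 h2] := band_profile uc.
  rewrite quad_add_scalar// /A; apply: powR_chord_upper => //.
  by rewrite (le_trans h2)// lerDl ltW.
right; split => //; apply: le_powR_anti => //; last by apply: P3; rewrite -dotNr.
by rewrite subr_le0 ltW//; case/andP: q01.
Qed.

Lemma radial_integral_lower :
  (((2 * (1 + e)) `^ (q - 1) * (n%:R ^+ 2 * `|M| + 1) `^ (- q) * I (M - e%:M))%:E <=
  \int[spherical n]_(u in (positive_directions K z : set T)) (radial K z u `^ (q - 1))%:E)%E.
Proof.
have b0 : 0 < 2 * (1 + e) by rewrite mulr_gt0// addr_gt0.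
have B0 : 0 < n%:R ^+ 2 * `|M| + 1 by rewrite ltr_wpDl// mulr_ge0// exprn_ge0.
pose A := (2 * (1 + e)) `^ (q - 1) * (n%:R ^+ 2 * `|M| + 1) `^ (- q).
have A0 : 0 < A by rewrite mulr_gt0// powR_gt0.
have CE u : unit_sphere u -> quad (M - e%:M) u = quad M u - e.
  by move=> uS; rewrite -scaleN1r scale_scalar_mx mulN1r quad_add_scalar.
have Cq u : band w d u -> 0 < quad M u - e.
  by move=> uc; have [_ _ _ _ h] := band_profile uc; move: em e0 h; lra.
have Cq' u : band w d u -> 0 <= quad (M - e%:M) u.
  by move=> uc; rewrite CE ?(ltW (Cq u uc))//; case: uc.
rewrite -(integral_weighted_quad A0 Cq').
apply: (@ge0_le_integral_subset _ T R (spherical n) (band w d) (positive_directions K z)).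
- by move=> u uc; rewrite lee_fin mulr_ge0 ?(ltW A0)// mulr_ge0 ?powR_ge0// Cq'.
- by move=> u _; rewrite lee_fin powR_ge0.
move=> u uc; have [uw up h1 _ h2] := band_profile uc; have [uS ur] := up; split => //.
rewrite lee_fin CE// /A; apply: powR_chord_lower => //; first exact: Cq.
have := quad_unit_bound M uS; rewrite ler_norml => /andP[_ h3].
by rewrite lerBlDr (le_trans h3)// -addrA lerDl addr_ge0// ltW.
Qed.

End AtPoint.

Lemma near_right (P : R -> Prop) : (\forall q \near 0^'+, P q) ->
  exists2 q0 : R, 0 < q0 & forall q, 0 < q < q0 -> P q.
Proof.
move=> [q0 /= q00 HP]; exists q0 => // q /andP[qp qq]; apply: HP => //=.
by rewrite sub0r normrN gtr0_norm.
Qed.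

(** Both bounds tend to w0 * t / 2 as e tends to 0. *)
Lemma small_parameter (t k w0 eps : R) : 0 < eps ->
  \forall e \near (0 : R)^'+, ((t + k * e) * ((1 + e) * w0) + 2 * e * e) / (2 * (1 - e)) < w0 * t / 2 + eps /\
     w0 * t / 2 - eps < ((t - k * e) * ((1 - e) * w0) - e * e) / (2 * (1 + e)).
Proof.
move=> eps0; have e0 := @cvg_exponent_at_right R.
have c1 (s : R) : 1 + s * e @[e --> (0 : R)^'+] --> (1 : R).
  by rewrite -[X in _ --> X]addr0 -{2}(mulr0 s); apply: cvgD; [exact: cvg_cst|apply: cvgMr].
have inv (s : R) : (2 * (1 + s * e))^-1 @[e --> (0 : R)^'+] --> (2^-1 : R).
  by rewrite -[in X in _ --> X](mulr1 2); apply: cvgV; [rewrite mulr1|apply: cvgMr].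
have U : ((t + k * e) * ((1 + 1 * e) * w0) + 2 * e * e) / (2 * (1 + - 1 * e)) @[e --> (0 : R)^'+] -->
    ((t + k * 0) * (1 * w0) + 2 * 0 * 0) / 2.
  apply: cvgM => //; apply: cvgD; last by apply: cvgM => //; exact: cvgMr.
  apply: cvgM; last exact: cvgMl.
  by apply: cvgD; [exact: cvg_cst|exact: cvgMr].
have L : ((t - k * e) * ((1 + - 1 * e) * w0) - e * e) / (2 * (1 + 1 * e)) @[e --> (0 : R)^'+] -->
    ((t - k * 0) * (1 * w0) - 0 * 0) / 2.
  apply: cvgM => //; apply: cvgB; last exact: cvgM.
  apply: cvgM; last exact: cvgMl.
  by apply: cvgB; [exact: cvg_cst|exact: cvgMr].
have lU : ((t + k * 0) * (1 * w0) + 2 * 0 * 0) / 2 < w0 * t / 2 + eps by lra.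
have lL : w0 * t / 2 - eps < ((t - k * 0) * (1 * w0) - 0 * 0) / 2 by lra.
near=> e; split.
  by rewrite -[in 1 + e](mul1r e) -[in 1 - e]mulN1r; near: e; exact: (cvgr_lt _ U).
by rewrite -[in 1 + e](mul1r e) -[in 1 - e]mulN1r; near: e; exact: (cvgr_gt _ L).
Unshelve. all: by end_near. Qed.

Lemma upper_moment_bound (A t k e W q a b h : R) : 0 <= A -> 0 <= t + k * e -> 0 < e -> 0 <= q * a ->
  q * a <= (1 + e) * W -> 0 <= q * b -> q * b <= e -> 0 <= h <= e ->
  q * (A * ((t + k * e - (h + e)) * a + (h + e) * b)) <= A * ((t + k * e) * ((1 + e) * W) + 2 * e * e).
Proof.
move=> A0 t0 e0 qa0 qaW qb0 qbe /andP[h0 he]; rewrite mulrCA ler_wpM2l//.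
have h1 : (t + k * e) * (q * a) <= (t + k * e) * ((1 + e) * W) by rewrite ler_wpM2l.
have h2 : 0 <= (h + e) * (q * a) by rewrite mulr_ge0// addr_ge0// ltW.
have h3 : (h + e) * (q * b) <= 2 * e * e.
  by rewrite ler_pM// ?addr_ge0 ?(ltW e0)//; lra.
lra.
Qed.

Lemma lower_moment_bound (A t k e W D q a b h : R) : 0 <= A -> 0 <= t - k * e -> 0 < e -> 0 <= W -> e < 1 ->
  0 <= D -> (1 - e) * W * D <= q * a -> 0 <= q * b -> q * b <= e * D -> 0 <= h <= e ->
  A * (D * ((t - k * e) * ((1 - e) * W) - e * e)) <= q * (A * ((t - k * e - (h - e)) * a + (h - e) * b)).
Proof.
move=> A0 t0 e0 W0 e1 D0 qaW qb0 qbe /andP[h0 he]; rewrite [leRHS]mulrCA ler_wpM2l//.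
have qa0 : 0 <= q * a by rewrite (le_trans _ qaW)// !mulr_ge0// subr_ge0 ltW.
have h1 : (t - k * e) * ((1 - e) * W * D) <= (t - k * e) * (q * a) by rewrite ler_wpM2l.
have h2 : 0 <= (e - h) * (q * a) by rewrite mulr_ge0// subr_ge0.
have h3 : (e - h) * (q * b) <= e * (e * D).
  by rewrite ler_pM// ?subr_ge0//; lra.
lra.
Qed.

(** The parameters are chosen in the order e, d, q: for fixed d the steep
    directions contribute q times a bounded quantity, and the band of height d
    contributes half of the trace of M times omega m up to an error controlled
    by e. *)
Lemma local_limit K z0 M (eps : R) : (0 < m)%N -> 0 < \tr M -> radial_profile K z0 M -> 0 < eps ->
  exists2 r : R, 0 < r & exists2 q0 : R, 0 < q0 & forall z (q : R), `|z - z0| < r -> bdry K z -> 0 < q < q0 ->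
   ((omega m * \tr M / 2 - eps)%:E <=
    q%:E * \int[spherical n]_(u in (positive_directions K z : set T)) (radial K z u `^ (q - 1))%:E <=
    (omega m * \tr M / 2 + eps)%:E)%E.
Proof.
move=> mp t0 [m0 m00 Hprof] eps0.
have W0 := @omega_gt0 R m.
pose N : R := n%:R; have N0 : 0 < N by rewrite /N ltr0n.
have [e1 e10 He1] := near_right (small_parameter (\tr M) N (omega m) eps0).
(* The last bound keeps \tr M - n * e positive. *)
pose e := Num.min (Num.min e1 m0) (Num.min 1 (\tr M / N)) / 2.
have e0 : 0 < e by rewrite divr_gt0// !lt_min e10 m00 ltr01 divr_gt0.
have : e < Num.min (Num.min e1 m0) (Num.min 1 (\tr M / N)).
  by rewrite /e ltr_pdivrMr// ltr_pMr ?ltr1n// !lt_min e10 m00 ltr01 divr_gt0.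
rewrite !lt_min => /andP[/andP[ee1 em] /andP[el1 etr]].
have {etr} Ne : N * e < \tr M by rewrite mulrC -ltr_pdivlMr.
have [|hU hL] := He1 e; first by rewrite e0.
set X := (_ + _) in hU; pose Y := (\tr M - N * e) * ((1 - e) * omega m) - e * e; rewrite -/Y in hL.
have [|//|d0 d00 Hd] := Hprof e; first by rewrite e0.
have [d1 /andP[d10 d11] Hmom] := integral_quad_asymptotics mp e0.
pose d := Num.min d0 d1 / 2.
have dp : 0 < d by rewrite divr_gt0// lt_min d00.
have : d < Num.min d0 d1 by rewrite /d ltr_pdivrMr// ltr_pMr ?ltr1n// lt_min d00.
rewrite lt_min => /andP[dd0 dd1].
have [|c [r [c0 r0 Hz]]] := Hd d; first by rewrite dp.
pose s := fine (spherical n (@unit_sphere R n)).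
have b1 : 0 < 2 * (1 - e) by rewrite mulr_gt0// subr_gt0.
have b2 : 0 < 2 * (1 + e) by rewrite mulr_gt0// addr_gt0.
have mu0 : 0 < 2 * m0 by rewrite mulr_gt0.
pose B := n%:R ^+ 2 * `|M| + 1.
have B0 : 0 < B by rewrite ltr_wpDl// mulr_ge0// exprn_ge0.
have cU := @upper_factor_cvg R _ _ X _ s b1 mu0 c0.
have cL := @lower_factor_cvg R _ _ Y _ b2 B0 dp.
have [q1 q10 Hq1] := near_right (cvgr_lt _ cU _ hU).
have [q2 q20 Hq2] := near_right (cvgr_gt _ cL _ hL).
exists r => //; exists (Num.min 1 (Num.min q1 q2)) => [|z q zr bz /andP[qp]]; first by rewrite !lt_min ltr01 q10.
rewrite !lt_min => /and3P[q_lt1 qq1 qq2]; have q01 : 0 < q < 1 by rewrite qp.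
have q01' : 0 < q < q1 by rewrite qp.
have q02' : 0 < q < q2 by rewrite qp.
have {}Hq1 := Hq1 q q01'; have {}Hq2 := Hq2 q q02'.
have [[nu1 _] hnu prof] := Hz z zr bz.
have [|a [b [ha hb mom]]] := Hmom d q _ q01; first by rewrite dp.
have {}mom C := mom (- gauss_map K z) C (unit_sphereN nu1).
have Dp : 0 <= d `^ q by exact: powR_ge0.
have D1 : d `^ q <= 1 by rewrite powR_expR// -expR0 ler_expR mulr_ge0_le0 ?(ltW qp)// ln_le0// ltW// (lt_trans dd1).
have [/andP[ha1 ha2] /andP[hb1 hb2]] := (ha, hb).
have qa0 : 0 <= q * a by rewrite (le_trans _ ha1)// !mulr_ge0// ?subr_ge0 ltW.
have trD (x : R) : \tr (M + x%:M) = \tr M + N * x by rewrite raddfD/= mxtrace_scalar mulr_natl.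
have qE (x : R) : quad (M + x%:M) (- gauss_map K z) = quad M (gauss_map K z) + x.
  by rewrite quadN quad_add_scalar.
have trB : \tr (M - e%:M) = \tr M - N * e by rewrite -scaleN1r scale_scalar_mx mulN1r trD mulrN.
have qB : quad (M - e%:M) (- gauss_map K z) = quad M (gauss_map K z) - e.
  by rewrite -scaleN1r scale_scalar_mx mulN1r qE.
have A0 (x y s' t' : R) : 0 <= x `^ s' * y `^ t' by rewrite mulr_ge0// powR_ge0.
have up := radial_integral_upper q01 e0 em el1 c0 prof mom.
have lo := radial_integral_lower q01 e0 em prof mom.
have qe0 : (0 <= q%:E)%E by rewrite lee_fin ltW.
apply/andP; split.
- apply: le_trans (lee_wpmul2l qe0 lo).
  rewrite -EFinM lee_fin trB qB (le_trans (ltW Hq2))//.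
  by apply: lower_moment_bound => //; [rewrite subr_ge0 ltW|rewrite ltW].
- apply: (le_trans (lee_wpmul2l qe0 up)).
  rewrite -EFinM lee_fin trD qE (le_trans _ (ltW Hq1))// mulrDr lerD//.
  apply: upper_moment_bound => //.
  + by apply: addr_ge0; [exact: ltW|apply: mulr_ge0; exact: ltW].
  + rewrite (le_trans ha2)// ler_piMr//; apply: mulr_ge0; last exact: ltW.
    by apply: addr_ge0; [exact: ler01|exact: ltW].
  + by rewrite (le_trans hb2)// ler_piMr// ltW.
Qed.

End RadialIntegral.

(** * Uniformity along the boundary and conclusion *)

Section UniformLimit.
Context {R : realType}.
Variable m : nat.
Local Notation n := m.+1.
Local Notation T := (@sphere_type R n).
Variable K : set 'rV[R]_n.
Hypotheses (m_gt0 : (0 < m)%N) (bK : convex_body K) (C2 : C2_bdry K) (pK : positive_curvature K).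
Implicit Types (z : 'rV[R]_n).

Definition rescaled_quermass (q : R) z : \bar R :=
  (q%:E * \int[spherical n]_(u in (positive_directions K z : set T)) (radial K z u `^ (q - 1))%:E)%E.

(** The limit of rescaled_quermass as q tends to 0. *)
Definition curvature_limit z : R := omega m * (m%:R * mean_curvature K z) / 2.

Lemma regular_outer_normal z : regular_bdry K z -> outer_normal K z (gauss_map K z).
Proof. by move=> [_ [u [hu _]]]; apply: xgetPex; exists u. Qed.

Lemma regular_bdryW z : regular_bdry K z -> bdry K z.
Proof. by case. Qed.

Lemma mean_curvature_ge0 z : regular_bdry K z -> 0 <= mean_curvature K z.
Proof.
move=> rz; have [M [tM M0 _]] := local_geometry m_gt0 bK C2 pK (regular_bdryW rz) (regular_outer_normal rz).
by move: M0; rewrite tM pmulr_rgt0 ?ltr0n//; exact: ltW.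
Qed.

(** The estimates at z0 and at z apply to the same integral for small q, so that
    the two limits are close; the error can thus be measured relatively to the
    limit at z. *)
Lemma local_relative z0 (e : R) : bdry K z0 -> outer_normal K z0 (gauss_map K z0) -> 0 < e < 1 ->
  exists2 r : R, 0 < r & exists2 q0 : R, 0 < q0 & forall z (q : R), `|z - z0| < r ->
    regular_bdry K z -> 0 < q < q0 ->
    (((1 - e) * curvature_limit z)%:E <= rescaled_quermass q z <= ((1 + e) * curvature_limit z)%:E)%E.
Proof.
move=> bz0 on0 /andP[e0 e1].
have [M [_ M0 prof]] := local_geometry m_gt0 bK C2 pK bz0 on0.
pose L0 := omega m * \tr M / 2; have L00 : 0 < L0 by rewrite divr_gt0// mulr_gt0// omega_gt0.
pose eps := e * L0 / 4; have eps0 : 0 < eps by rewrite divr_gt0// mulr_gt0.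
have [r r0 [q0 q00 H]] := local_limit m_gt0 M0 prof eps0.
exists r => //; exists q0 => // z q zr rz q0q.
have bz := regular_bdryW rz.
have [Mz [tMz Mz0 profz]] := local_geometry m_gt0 bK C2 pK bz (regular_outer_normal rz).
have LE : omega m * \tr Mz / 2 = curvature_limit z by rewrite tMz.
have near : `|curvature_limit z - L0| <= eps.
  (* The limit at z itself is used with an arbitrary error, for a common small s. *)
  have aux (eta : R) : 0 < eta -> `|curvature_limit z - L0| <= eps + eta.
    move=> eta0; have [r1 r10 [q1 q10 H1]] := local_limit m_gt0 Mz0 profz eta0.
    pose s := Num.min q0 q1 / 2; have s0 : 0 < s by rewrite divr_gt0// lt_min q00.
    have : s < Num.min q0 q1 by rewrite /s ltr_pdivrMr// ltr_pMr ?ltr1n// lt_min q00.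
    rewrite lt_min => /andP[sq0 sq1].
    have z1 : `|z - z| < r1 by rewrite subrr normr0.
    have s0' : 0 < s < q0 by rewrite s0.
    have s1' : 0 < s < q1 by rewrite s0.
    have /andP[a1 a2] := H z s zr bz s0'; have /andP[b1 b2] := H1 z s z1 bz s1'.
    have := le_trans a1 b2; have := le_trans b1 a2; rewrite !lee_fin LE -/L0 => h1 h2.
    by rewrite ler_norml; apply/andP; split; lra.
  by apply/ler_addgt0Pr.
move: near; rewrite ler_norml => /andP[n1 n2].
have /andP[a1 a2] := H z q zr bz q0q.
have ee : 4 * eps <= e * L0 by rewrite /eps; lra.
have h : e * eps <= eps by rewrite ler_piMl// ltW.
have h1 : e * (L0 - eps) <= e * curvature_limit z by rewrite ler_wpM2l ?(ltW e0)//; lra.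
rewrite /rescaled_quermass; apply/andP; split.
  by apply: le_trans a1; rewrite lee_fin -/L0; lra.
by apply: (le_trans a2); rewrite lee_fin -/L0; lra.
Qed.

(** Otherwise the Weingarten expansion would make unit normals tend to the
    default value 0. *)
Lemma no_regular_near z0 : bdry K z0 -> ~ outer_normal K z0 (gauss_map K z0) ->
  exists2 r : R, 0 < r & forall z, `|z - z0| < r -> ~ regular_bdry K z.
Proof.
move=> bz0 non; have G0 : gauss_map K z0 = 0.
  by rewrite /gauss_map xgetPN// => u hu; apply: non; apply: xgetPex; exists u.
have [k [A WA _] _] := pK bz0; have [r r0 Hr] := weingarten_norm WA ltr01.
pose L := 1 + n%:R * `|A|; have L0 : 0 < L by rewrite ltr_pwDl// mulr_ge0.
have N0 : 0 < n%:R :> R by rewrite ltr0n.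
exists (Num.min r (n%:R^-1 / L)) => [|z]; first by rewrite lt_min r0 divr_gt0// invr_gt0.
rewrite lt_min ltr_pdivlMr// => /andP[zr ze] rz.
have := Hr z zr (regular_bdryW rz); rewrite G0 subr0 mul1r => h.
have gn : `|gauss_map K z| < n%:R^-1.
  apply: le_lt_trans ze; rewrite -[gauss_map K z](subrK ((z - z0) *m A)).
  rewrite (le_trans (ler_normD _ _))// mulrDr mulr1 lerD//.
  by rewrite (le_trans (mulmx_norm_le _ _))// mulrCA.
have [uS _] := regular_outer_normal rz.
have := dot_le_norm (gauss_map K z) (gauss_map K z); rewrite unit_dot// normr1.
apply/negP; rewrite -ltNge; apply: (@le_lt_trans _ _ (n%:R * (`|gauss_map K z| * 1))).
  by rewrite ler_wpM2l// ler_wpM2l// unit_norm_le.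
by rewrite mulr1 mulrC -ltr_pdivlMr// mul1r.
Qed.

Lemma compact_bdry : compact (bdry K).
Proof.
have [kK _ _] := bK; have cK : closed K := closedK kK.
apply: (subclosed_compact _ kK); last by move=> x [/cK].
apply: closedI; first exact: closed_closure.
by apply: open_closedC; exact: open_interior.
Qed.

(** Compactness of the boundary, which may contain points that are not regular. *)
Lemma uniform_relative (e : R) : 0 < e < 1 -> exists2 q0 : R, 0 < q0 & forall z (q : R),
  regular_bdry K z -> 0 < q < q0 ->
    (((1 - e) * curvature_limit z)%:E <= rescaled_quermass q z <= ((1 + e) * curvature_limit z)%:E)%E.
Proof.
move=> e01.
pose P (q : R) z := 0 < q -> regular_bdry K z ->
  (((1 - e) * curvature_limit z)%:E <= rescaled_quermass q z <= ((1 + e) * curvature_limit z)%:E)%E.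
have loc z0 : bdry K z0 -> exists2 r : R, 0 < r & exists2 q0 : R, 0 < q0 & forall z (q : R),
    `|z - z0| < r -> q < q0 -> P q z.
  move=> bz0; have [on0|non] := pselect (outer_normal K z0 (gauss_map K z0)).
    have [r r0 [q0 q00 H]] := local_relative bz0 on0 e01.
    by exists r => //; exists q0 => // z q zr qq0 qp rz; apply: H => //; rewrite qp.
  have [r r0 H] := no_regular_near bz0 non.
  by exists r => //; exists 1 => // z q /H nz _ _ /nz.
have [q0 q00 H] : exists2 q0 : R, 0 < q0 & forall q, 0 < q < q0 -> bdry K `<=` P q.
  apply: near_right; have /compact_near_coveringP cov := compact_bdry.
  apply: cov => z0 /loc[r r0 [q0 q00 H]].
  exists (ball z0 r, [set q | q < q0]); first split => /=.
  - exact: nbhsx_ballx.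
  - exact: nbhs_right_lt.
  - move=> [z q] /= [zr qq]; apply: H => //.
    by move: zr; rewrite -ball_normE /= distrC.
exists q0 => // z q rz /andP[qp qq]; apply: (H q) => //; first by rewrite qp.
exact: regular_bdryW.
Qed.

End UniformLimit.

Theorem corollary4p14 (R : realType) (n : nat) (hn : (2 <= n)%N)
    (K : set 'rV[R]_n) (hK : convex_body K) (hC2 : C2_bdry K)
    (hpos : positive_curvature K)
    (eta : set 'rV[R]_n) (eta_sphere : eta `<=` unit_sphere)
    (eta_Borel : Borel eta) :
  chord_measure q K eta @[q --> 0^'+] -->
    ((n.-1%:R * omega n.-1 / (n%:R * omega n))%:E * area_measure_n2 K eta)%E.
Proof.
case: n hn K hK hC2 hpos eta {eta_sphere eta_Borel} => [//|m] m_gt0 K bK C2 pK eta.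
rewrite /= in m_gt0 *; have mp : 0 < m%:R :> R by rewrite ltr0n.
pose c := m%:R * @omega R m / (m.+1%:R * omega m.+1).
have c0 : 0 < c by rewrite divr_gt0// mulr_gt0// ?omega_gt0// ltr0n.
pose E := gauss_preimage K eta.
have Hge0 z : E z -> (0 <= (mean_curvature K z)%:E)%E.
  by move=> [rz _]; rewrite lee_fin; exact: mean_curvature_ge0.
have main (e : R) : 0 < e < 1 -> exists2 q0 : R, 0 < q0 & forall q : R, 0 < q < q0 ->
    (((1 - e) * c)%:E * area_measure_n2 K eta <= chord_measure q K eta <=
     ((1 + e) * c)%:E * area_measure_n2 K eta)%E.
  move=> e01; have [q0 q00 H] := uniform_relative m_gt0 bK C2 pK e01.
  exists q0 => // q q0q; have /andP[qp _] := q0q; have /andP[e0 e1] := e01.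
  have k0 : 0 < 2 * q / @omega R m.+1 by rewrite divr_gt0 ?omega_gt0// mulr_gt0.
  pose k := omega m * m%:R / (2 * m.+1%:R * q).
  have kp : 0 < k by rewrite divr_gt0// ?mulr_gt0 ?omega_gt0// ltr0n.
  have kE (s : R) : 2 * q / omega m.+1 * (s * k) = s * c.
    by rewrite /k /c; field; rewrite !lt0r_neq0 ?omega_gt0 ?ltr0n.
  have dual z : regular_bdry K z ->
      (((1 - e) * k)%:E * (mean_curvature K z)%:E <= dual_quermass (q - 1) K z <=
       ((1 + e) * k)%:E * (mean_curvature K z)%:E)%E.
    move=> rz; have /andP[h1 h2] := H z q rz q0q.
    have s0 : (0 <= (m.+1%:R * q)^-1%:E)%E by rewrite lee_fin invr_ge0 mulr_ge0// ltW.
    have dE : dual_quermass (q - 1) K z = ((m.+1%:R * q)^-1%:E * rescaled_quermass K q z)%E.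
      rewrite /dual_quermass /rescaled_quermass muleA -EFinM; congr (_%:E * _)%E.
      by rewrite invfM mulfVK ?lt0r_neq0.
    have lE (s : R) : (m.+1%:R * q)^-1 * (s * curvature_limit K z) = s * k * mean_curvature K z.
      by rewrite /curvature_limit /k; field; rewrite !lt0r_neq0 ?ltr0n.
    rewrite dE -!EFinM -!lE !EFinM; apply/andP; split; exact: lee_wpmul2l.
  have int_scale (s : R) : 0 < s -> ((2 * q / omega m.+1)%:E *
      \int[hausdorff m.+1 m]_(z in E) ((s * k)%:E * (mean_curvature K z)%:E) =
      (s * c)%:E * area_measure_n2 K eta)%E.
    move=> s0; transitivity ((2 * q / omega m.+1)%:E * ((s * k)%:E * area_measure_n2 K eta))%E.
      by congr (_ * _)%E; apply: ge0_integral_scale; [exact: mulr_gt0|exact: Hge0].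
    by rewrite muleA -EFinM kE.
  have e1' : 0 < 1 - e by rewrite subr_gt0.
  have e2' : 0 < 1 + e by rewrite addr_gt0.
  have k0' : (0 <= (2 * q / @omega R m.+1)%:E)%E by rewrite lee_fin ltW.
  have lo0 z : E z -> (0 <= ((1 - e) * k)%:E * (mean_curvature K z)%:E)%E.
    by move=> Ez; rewrite mule_ge0 ?Hge0// lee_fin mulr_ge0// ltW.
  have up0 z : E z -> (0 <= ((1 + e) * k)%:E * (mean_curvature K z)%:E)%E.
    by move=> Ez; rewrite mule_ge0 ?Hge0// lee_fin mulr_ge0// ltW.
  have d0 z : E z -> (0 <= dual_quermass (q - 1) K z)%E.
    by move=> Ez; have [/dual/andP[h _] _] := Ez; exact: le_trans (lo0 z Ez) h.
  rewrite -!int_scale// /chord_measure; apply/andP; split; apply: lee_wpmul2l => //;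
    apply: ge0_le_integral_subset => // z Ez; split=> //; by have [/dual/andP[]] := Ez.
have A0 : (0 <= area_measure_n2 K eta)%E by apply: integral_ge0.
(* If the area measure is infinite then so is the chord measure for small q. *)
have [Ainf|Afin] := eqVneq (area_measure_n2 K eta) +oo%E.
  rewrite Ainf gt0_muley ?lte_fin//.
  have h01 : 0 < (2^-1 : R) < 1 by rewrite invr_gt0 ltr0n invf_lt1// ltr1n.
  have [q0 q00 H] := main _ h01.
  apply: cvg_near_cst; near=> q.
  have q0q : 0 < q < q0 by apply/andP; split; near: q; [exact: nbhs_right_gt|exact: nbhs_right_lt].
  have hc : 0 < (1 - 2^-1) * c by rewrite mulr_gt0// subr_gt0; case/andP: h01.
  have /andP[h _] := H q q0q; move: h; rewrite Ainf gt0_muley ?lte_fin//.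
  by rewrite leye_eq => /eqP.
have [a aE] : exists a, area_measure_n2 K eta = a%:E.
  exists (fine (area_measure_n2 K eta)); rewrite fineK// ge0_fin_numE//.
  by rewrite lt_neqAle Afin leey.
have a0 : 0 <= a by rewrite -lee_fin -aE.
rewrite aE -EFinM; apply/fine_cvgP; split.
  have h01 : 0 < (2^-1 : R) < 1 by rewrite invr_gt0 ltr0n invf_lt1// ltr1n.
  have [q0 q00 H] := main _ h01; near=> q.
  have q0q : 0 < q < q0 by apply/andP; split; near: q; [exact: nbhs_right_gt|exact: nbhs_right_lt].
  have /andP[h1 h2] := H q q0q; rewrite aE -!EFinM in h1 h2.
  by rewrite fin_numE; apply/andP; split; [rewrite -ltNye (lt_le_trans _ h1)// ltNyr|rewrite -ltey (le_lt_trans h2)// ltry].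
apply/cvgrPdist_le => eps eps0.
pose e := Num.min 2^-1 (eps / (c * a + 1)).
have ca : 0 < c * a + 1 by rewrite ltr_wpDl// mulr_ge0// ltW.
have e01 : 0 < e < 1.
  rewrite lt_min invr_gt0 ltr0n divr_gt0//= gt_min invf_lt1 ?ltr1n//.
have ee : e * (c * a + 1) <= eps by rewrite -ler_pdivlMr// ge_min lexx orbT.
have [q0 q00 H] := main _ e01; near=> q.
have q0q : 0 < q < q0 by apply/andP; split; near: q; [exact: nbhs_right_gt|exact: nbhs_right_lt].
have /andP[h1 h2] := H q q0q; rewrite aE -!EFinM in h1 h2.
rewrite /=; move: h1 h2; case: (chord_measure q K eta) => [x||]//=.
rewrite !lee_fin => h1 h2; rewrite -/c ler_distlC.
have /andP[e0 _] := e01; rewrite -mulrA in h1; rewrite -mulrA in h2.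
move: (c * a) h1 h2 ee ca => b h1 h2 ee ca.
by apply/andP; split; lra.
Unshelve. all: by end_near.
Qed.
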